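(* Let $\Lambda$ be a strictly increasing (infinite) sequence of non-negative real numbers satisfying the Müntz condition $\sum_{\lambda\in\Lambda\setminus\{0\}}1/\lambda<\infty$. Let $\Gamma_\Lambda$ be the Cesàro operator viewed as a map from $M_\Lambda^1$ to either $M_\Lambda^\infty$ or $C([0,1])$, and let $V_\Lambda$ be the Volterra operator viewed as a map from $M_\Lambda^1$ to either $M_{1+\Lambda}^\infty$ or $C([0,1])$. Then, for each of these choices of codomain, 1. $\|\Gamma_\Lambda\|_{e}=\|\Gamma_\Lambda\|_{e,w}=\frac{1}{2}$. 2. $\|V_\Lambda\|_{e}=\|V_\Lambda\|_{e,w}=\frac{1}{2}$.
   Context: $M_\Lambda$ is the linear span of the monomials $x^\lambda$, $\lambda\in\Lambda$, as functions on $[0,1]$; $M_\Lambda^1$ is the closure of $M_\Lambda$ in $L^1([0,1])$ (Lebesgue measure), with the $L^1$-norm; $M_\Lambda^\infty$ is the closure of $M_\Lambda$ in $C([0,1])$, with the supremum norm. $1+\Lambda=\{1+\lambda:\lambda\in\Lambda\}$, and $M_{1+\Lambda}^\infty$ is defined in the same way from $1+\Lambda$. Under the Müntz condition, every $f\in M_\Lambda^1$ coincides almost everywhere with a (unique) function that is analytic on $(0,1)$ and continuous on $[0,1)$ (it is a known fact that for every $c\in(0,1)$ there is a constant $N_c$ with $\sup_{[0,c]}|f|\le N_c\|f\|_1$ for all $f\in M_\Lambda^1$); $f$ is identified with this function on $[0,1)$, and in particular $f(0)$ denotes its value at $0$. For $f\in M_\Lambda^1$: $V_\Lambda(f)(x)=\int_0^x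 f(t)\,dt$ for $x\in[0,1]$; $\Gamma_\Lambda(f)(0)=f(0)$ and $\Gamma_\Lambda(f)(x)=\frac1x\int_0^x f(t)\,dt$ for $x\in(0,1]$. For a bounded operator $T:X\to Y$ between Banach spaces, $\|T\|_{e}=\inf\{\|T-S\|: S:X\to Y \text{ compact}\}$ and $\|T\|_{e,w}=\inf\{\|T-S\|: S:X\to Y \text{ weakly compact}\}$ (these depend on the codomain $Y$), where an operator is weakly compact if the image of the unit ball is relatively weakly compact. *)

(* Defs.v *)
From HB Require Import structures.
From mathcomp Require Import all_boot all_order all_algebra.
From mathcomp Require Import all_classical all_reals all_analysis.
From mathcomp Require Import measurable_realfun ring_quotient.

Set Implicit Arguments.
Unset Strict Implicit.
Unset Printing Implicit Defensive.
Import Order.TTheory GRing.Theory Num.Theory.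
Import numFieldNormedType.Exports.

Local Open Scope classical_set_scope.
Local Open Scope ring_scope.
Local Open Scope quotient_scope.

Section Operators.
Context (R : realType) (X Y : normedModType R).

Definition unit_ball : set X := [set x | `|x| <= 1].

Definition op_norm (T : X -> Y) : \bar R :=
  ereal_sup [set (`|T x|)%:E | x in unit_ball].

Definition compact_op (S : {linear X -> Y}) : Prop :=
  compact (closure (S @` unit_ball)).

Definition ess_norm (T : X -> Y) : \bar R :=
  ereal_inf [set op_norm (T \- S) | S in compact_op].

End Operators.

Section Weak.
Context (R : realType).

Record topdual (Y : normedModType R) := TopDual {
  topdual_fun :> {linear Y -> R^o};
  topdual_continuous : continuous topdual_fun }.

HB.instance Definition _ (Y : normedModType R) := gen_eqMixin (topdual Y).
HB.instance Definition _ (Y : normedModType R) := gen_choiceMixin (topdual Y).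

(* The topology of pointwise convergence on functions [topdual Y -> R], pulled
   back along the evaluation map, is the coarsest one for which every element
   of [topdual Y] is continuous. *)
Definition weak_top (Y : normedModType R) : topologicalType :=
  initial_topology
    (fun (y : Y) => (fun phi => phi y) : {ptws (topdual Y) -> R}).

Context (X Y : normedModType R).

Definition weakly_compact_op (S : {linear X -> Y}) : Prop :=
  compact (closure (S @` @unit_ball R X : set (weak_top Y))).

Definition ess_norm_w (T : X -> Y) : \bar R :=
  ereal_inf [set op_norm (T \- S) | S in weakly_compact_op].

End Weak.

Section ClosedSubspace.
Context (R : realType) (V : normedModType R) (W : submodClosed V).

Definition closure_pred : {pred V} := mem (closure [set` W]).

Let closureE v : (v \in closure_pred) <->
  (forall e, 0 < e -> exists2 w, w \in W & `|v - w| < e).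
Proof.
rewrite /closure_pred inE; split.
  move=> cv e e0; have [w [/= wW vw]] := cv _ (nbhsx_ballx v e e0).
  by exists w => //; move: vw; rewrite -ball_normE.
move=> h B /nbhs_ballP[e /= e0 eB]; have [w wW vw] := h e e0.
by exists w; split => //; apply: eB; rewrite -ball_normE.
Qed.

Lemma closure_submod_closed : submod_closed closure_pred.
Proof.
split; first by apply/closureE => e e0; exists 0; rewrite ?rpred0// subrr normr0.
move=> a u v /closureE uW /closureE vW; apply/closureE => e e0.
have a1 : 0 < `|a| + 1 by rewrite ltr_wpDl.
have [u' u'W uu'] := uW (e / 2 / (`|a| + 1)) ltac:(by rewrite !divr_gt0).
have [v' v'W vv'] := vW (e / 2) ltac:(by rewrite divr_gt0).
exists (a *: u' + v'); first by rewrite rpredD// rpredZ.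
rewrite opprD addrACA -scalerBr (le_lt_trans (ler_normD _ _))//.
rewrite [e]splitr ler_ltD// normrZ.
rewrite (@le_trans _ _ ((`|a| + 1) * `|u - u'|))//.
  by rewrite ler_wpM2r// lerDl.
by rewrite mulrC -ler_pdivlMr// ltW.
Qed.

HB.instance Definition _ :=
  GRing.isSubmodClosed.Build R V closure_pred closure_submod_closed.

Record closed_subspace := ClosedSubspace {
  subspace_val :> V;
  subspace_valP : subspace_val \in closure_pred }.

HB.instance Definition _ := [isSub for subspace_val].
HB.instance Definition _ := [Choice of closed_subspace by <:].
HB.instance Definition _ := [SubChoice_isSubLmodule of closed_subspace by <:].

Let norm (x : closed_subspace) : R := `|subspace_val x|.

Let norm_D x y : norm (x + y) <= norm x + norm y.
Proof. exact: ler_normD. Qed.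

Let norm_Z (l : R) x : norm (l *: x) = `|l| * norm x.
Proof. exact: normrZ. Qed.

Let norm_eq0 x : norm x = 0 -> x = 0.
Proof. by move=> /normr0_eq0 x0; exact: val_inj. Qed.

HB.instance Definition _ :=
  Lmodule_isNormed.Build R closed_subspace norm_D norm_Z norm_eq0.

End ClosedSubspace.

Section L1.
Context (R : realType).

Definition mu01 : {measure set (measurableTypeR R) -> \bar R} :=
  mrestr (@lebesgue_measure R) (measurable_itv `[0%R, 1%R]).

#[global] Instance ae01_filter : Filter (nbhs (almost_everywhere mu01)).
Proof. exact: ae_filter_ringOfSetsType. Qed.

Let Lfun1 := LfunType mu01 (@lexx _ _ 1%E).

Definition null_pred : {pred Lfun1} :=
  mem [set f : Lfun1 | (f : R -> R) = cst 0 %[ae mu01]].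

Lemma null_zmod_closed : zmod_closed null_pred.
Proof.
split; first by rewrite inE; apply: nearW => x _.
move=> f g; rewrite !inE => f0 g0.
apply: filterS (filterI f0 g0) => x /= [/(_ I) fx /(_ I) gx] _.
by change (f x - g x = 0); rewrite fx gx subr0.
Qed.

HB.instance Definition _ :=
  GRing.isZmodClosed.Build Lfun1 null_pred null_zmod_closed.

(* Functions are defined on the whole line, but [mu01] does not see what they
   do outside of [0,1]. *)
Definition L1 : Type := Quotient.quot null_pred.
HB.instance Definition _ := GRing.Zmodule.on L1.
HB.instance Definition _ := EqQuotient.on L1.

Definition L1_repr (u : L1) : Lfun1 := repr u.

Lemma L1_reprP (f : Lfun1) : (L1_repr (\pi_L1 f) : R -> R) = f %[ae mu01].
Proof.
have : L1_repr (\pi_L1 f) - f \in null_pred.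
  have /eqmodP // : \pi_L1 (L1_repr (\pi_L1 f)) = \pi_L1 f.
  exact: reprK.
rewrite inE => h.
apply: filterS h => x /= /(_ I) hx _; apply/eqP; rewrite -subr_eq0.
exact/eqP.
Qed.

Lemma L1_eqP (u v : L1) :
  (L1_repr u : R -> R) = L1_repr v %[ae mu01] -> u = v.
Proof.
move=> uv; rewrite -[u]reprK -[v]reprK; apply/eqmodP.
change (L1_repr u - L1_repr v \in null_pred).
rewrite inE; apply: filterS uv => x /= h xT.
change (L1_repr u x - L1_repr v x = 0).
by apply/eqP; rewrite subr_eq0; apply/eqP; exact: h.
Qed.

Lemma L1_reprD (u v : L1) :
  (L1_repr (u + v) : R -> R) = L1_repr u \+ L1_repr v %[ae mu01].
Proof.
have -> : u + v = \pi_L1 (L1_repr u + L1_repr v).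
  by rewrite raddfD /= !reprK.
exact: L1_reprP.
Qed.

Definition L1_scale (a : R) (u : L1) : L1 := \pi_L1 (a *: L1_repr u).

Lemma L1_reprZ a (u : L1) :
  (L1_repr (L1_scale a u) : R -> R) = a \*: L1_repr u %[ae mu01].
Proof. exact: L1_reprP. Qed.

Let scaleA a b u : L1_scale a (L1_scale b u) = L1_scale (a * b) u.
Proof.
apply: L1_eqP.
apply: filterS (filterI (filterI (L1_reprZ a (L1_scale b u)) (L1_reprZ b u))
  (L1_reprZ (a * b) u)).
by move=> x [[/(_ I) h1 /(_ I) h2] /(_ I) h3] _; rewrite h1 h3 /= h2 /= scalerA.
Qed.

Let scale1 : left_id 1 L1_scale.
Proof.
move=> u; apply: L1_eqP; apply: filterS (L1_reprZ 1 u) => x /(_ I) h _.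
by rewrite h /= scale1r.
Qed.

Let scaleDr : right_distributive L1_scale +%R.
Proof.
move=> a u v; apply: L1_eqP.
apply: filterS (filterI (filterI (filterI (filterI
  (L1_reprZ a (u + v)) (L1_reprZ a u)) (L1_reprZ a v)) (L1_reprD u v))
  (L1_reprD (L1_scale a u) (L1_scale a v))).
move=> x [[[[/(_ I) h1 /(_ I) h2] /(_ I) h3] /(_ I) h4] /(_ I) h5] _.
by rewrite h1 h5 /= h2 h3 /= h4 /= scalerDr.
Qed.

Let scaleDl u : {morph L1_scale^~ u : a b / a + b}.
Proof.
move=> a b; apply: L1_eqP.
apply: filterS (filterI (filterI (filterI
  (L1_reprZ (a + b) u) (L1_reprZ a u)) (L1_reprZ b u))
  (L1_reprD (L1_scale a u) (L1_scale b u))).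
move=> x [[[/(_ I) h1 /(_ I) h2] /(_ I) h3] /(_ I) h5] _.
by rewrite h1 h5 /= h2 h3 /= scalerDl.
Qed.

HB.instance Definition _ :=
  GRing.Zmodule_isLmodule.Build R L1 scaleA scale1 scaleDr scaleDl.

Definition L1_norm (u : L1) : R := fine ('N[mu01]_1[EFin \o L1_repr u]).

Let Lfun1_abse_measurable (f : Lfun1) :
  measurable_fun [set: measurableTypeR R] (abse \o (EFin \o f)).
Proof. by apply: measurableT_comp => //; exact/measurable_EFinP. Qed.

Lemma L1_normE (u : L1) (f : Lfun1) : (L1_repr u : R -> R) = f %[ae mu01] ->
  L1_norm u = fine ('N[mu01]_1[EFin \o f]).
Proof.
move=> uf; rewrite /L1_norm !Lnorm1; congr fine.
apply: ae_eq_integral;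
  [by []|exact: Lfun1_abse_measurable|exact: Lfun1_abse_measurable|].
by apply: filterS uf => x /= + xT; move=> /(_ xT) ->.
Qed.

Let norm_D u v : L1_norm (u + v) <= L1_norm u + L1_norm v.
Proof.
rewrite (@L1_normE _ (L1_repr u + L1_repr v)); last exact: L1_reprD.
exact: ler_LnormD.
Qed.

Let norm_Z (a : R) u : L1_norm (a *: u) = `|a| * L1_norm u.
Proof.
rewrite (@L1_normE _ (a *: L1_repr u)); last exact: L1_reprZ.
apply: EFin_inj; rewrite EFinM.
by rewrite (finite_norm_fine (a *: L1_repr u)) (finite_norm_fine (L1_repr u))
  -LnormZ.
Qed.

Let norm_eq0 u : L1_norm u = 0 -> u = 0.
Proof.
move=> /fine_Lnormr_eq0 u0; apply: L1_eqP.
have : (L1_repr 0 : R -> R) = cst 0 %[ae mu01].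
  by rewrite -(raddf0 (\pi_L1)); exact: L1_reprP.
by move=> z; apply: filterS (filterI u0 z) => x [h1 h2] xT; rewrite h1 ?h2.
Qed.

HB.instance Definition _ :=
  Lmodule_isNormed.Build R L1 norm_D norm_Z norm_eq0.

End L1.

Section C01.
Context (R : realType).

(* A function on [0,1] is encoded by its extension by zero to [R]. *)
Definition C01_pred : {pred R -> R} :=
  mem [set f : R -> R | {within `[0, 1], continuous f} /\
                        forall x, x \notin `[0, 1] -> f x = 0].

Lemma C01_submod_closed : submod_closed C01_pred.
Proof.
split; first by rewrite inE; split => // x; exact: cvg_cst.
move=> a f g; rewrite !inE => -[cf f0] [cg g0]; split.
  by move=> x; apply: cvgD; [apply: cvgZr; exact: cf|exact: cg].
by move=> x x01; change (a *: f x + g x = 0);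
rewrite f0// g0// scaler0 addr0.
Qed.

HB.instance Definition _ :=
  GRing.isSubmodClosed.Build R (R -> R) C01_pred C01_submod_closed.

Record C01 := MkC01 { C01_fun :> R -> R; C01P : C01_fun \in C01_pred }.

HB.instance Definition _ := [isSub for C01_fun].
HB.instance Definition _ := [Choice of C01 by <:].
HB.instance Definition _ := [SubChoice_isSubLmodule of C01 by <:].

Definition sup_norm (f : C01) : R := sup [set `|f x| | x in `[0, 1]].

Lemma C01_has_sup (f : C01) : has_sup [set `|f x| | x in `[0, 1]].
Proof.
split; first by exists `|f 0|; exists 0 => //=; rewrite in_itv /= lexx ler01.
have [cf _] : {within `[0, 1], continuous f} /\
    forall x, x \notin `[0, 1] -> f x = 0 by have := C01P f; rewrite inE.
have /compact_bounded[M [_ hM]] :=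
  continuous_compact cf (@segment_compact R 0 1).
by exists (M + 1) => _ [x x01 <-]; apply: hM; [rewrite ltrDl|exists x].
Qed.

Lemma sup_norm_ub (f : C01) x : x \in `[0, 1] -> `|f x| <= sup_norm f.
Proof. by move=> x01; apply: ub_le_sup; [exact: (C01_has_sup f).2|exists x]. Qed.

Lemma sup_norm_le (f : C01) M : (forall x, x \in `[0, 1] -> `|f x| <= M) ->
  sup_norm f <= M.
Proof.
by move=> h; apply: ge_sup; [exact: (C01_has_sup f).1|move=> _ [x /h + <-]].
Qed.

Let norm_D f g : sup_norm (f + g) <= sup_norm f + sup_norm g.
Proof.
apply: sup_norm_le => x x01; rewrite (le_trans (ler_normD _ _))//.
by rewrite lerD// sup_norm_ub.
Qed.

Let norm_Zle (a : R) f : sup_norm (a *: f) <= `|a| * sup_norm f.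
Proof.
by apply: sup_norm_le => x x01; rewrite /= normrM ler_wpM2l// sup_norm_ub.
Qed.

Let norm_Z (a : R) f : sup_norm (a *: f) = `|a| * sup_norm f.
Proof.
apply/eqP; rewrite eq_le norm_Zle /=.
have [->|a0] := eqVneq a 0.
  rewrite normr0 mul0r (le_trans _ (@sup_norm_ub _ 0 _))//.
  by rewrite in_itv /= lexx ler01.
by rewrite -ler_pdivlMl ?normr_gt0// -normfV -{1}[f](scalerK a0) norm_Zle.
Qed.

Let norm_eq0 f : sup_norm f = 0 -> f = 0.
Proof.
move=> f0; apply: val_inj; apply/funext => x /=.
have [x01|x01] := boolP (x \in `[0, 1]).
  by apply/eqP; rewrite -normr_le0 -f0 sup_norm_ub.
by have := C01P f; rewrite inE => -[_ ->].
Qed.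

HB.instance Definition _ :=
  Lmodule_isNormed.Build R C01 norm_D norm_Z norm_eq0.

End C01.

Section Muntz.
Context (R : realType).
Implicit Types (L : set R) (u : L1 R).

(* [powR] satisfies [0 `^ 0 = 1] and [0 `^ l = 0] for [l != 0].  Only the
   values of these functions on [0,1] are used below. *)
Definition monomial (l : R) : R -> R := fun x => x `^ l.

Definition muntz L : set (R -> R) :=
  [set p | exists2 s : seq (R * R), (forall a, a \in s -> L a.2) &
           p = \sum_(a <- s) a.1 *: monomial a.2].

Lemma muntz0 L : muntz L 0.
Proof. by exists [::] => //; rewrite big_nil. Qed.

Lemma muntz_lin L a p q : muntz L p -> muntz L q -> muntz L (a *: p + q).
Proof.
move=> [s sL ->] [t tL ->]; exists ([seq (a * b.1, b.2) | b <- s] ++ t).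
  by move=> b; rewrite mem_cat => /orP[/mapP[c /sL cL ->]//|/tL].
rewrite big_cat /= big_map scaler_sumr; congr +%R.
by apply: eq_bigr => b _; rewrite scalerA.
Qed.

Definition muntz_L1 L : {pred L1 R} :=
  mem [set u | exists2 p, muntz L p & (L1_repr u : R -> R) = p %[ae mu01 R]].

Lemma muntz_L1_submod_closed L : submod_closed (muntz_L1 L).
Proof.
split.
  rewrite inE; exists 0; first exact: muntz0.
  by rewrite -(raddf0 \pi_(L1 R)); exact: L1_reprP.
move=> a u v; rewrite !inE => -[p Lp up] [q Lq vq].
exists (a *: p + q); first exact: muntz_lin.
apply: filterS (filterI (filterI up vq)
  (filterI (L1_reprD (a *: u) v) (L1_reprZ a u))).
move=> x [[/(_ I) h1 /(_ I) h2] [/(_ I) h3 /(_ I) h4]] _.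
by rewrite h3 /= h4 /= h1 h2.
Qed.

HB.instance Definition _ L :=
  GRing.isSubmodClosed.Build R (L1 R) (muntz_L1 L) (muntz_L1_submod_closed L).

Definition muntz_C01 L : {pred C01 R} :=
  mem [set f | exists2 p, muntz L p & {in `[0, 1], C01_fun f =1 p}].

Lemma muntz_C01_submod_closed L : submod_closed (muntz_C01 L).
Proof.
split; first by rewrite inE; exists 0 => //; exact: muntz0.
move=> a f g; rewrite !inE => -[p Lp fp] [q Lq gq].
exists (a *: p + q); first exact: muntz_lin.
by move=> x x01; rewrite /= [LHS]/(a *: f x + g x) fp// gq.
Qed.

HB.instance Definition _ L :=
  GRing.isSubmodClosed.Build R (C01 R) (muntz_C01 L)
    (muntz_C01_submod_closed L).

Definition M1 L : normedModType R := closed_subspace (muntz_L1 L).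
Definition Minf L : normedModType R := closed_subspace (muntz_C01 L).

Definition M1_val L (f : M1 L) : L1 R := subspace_val f.
Definition Minf_val L (f : Minf L) : C01 R := subspace_val f.

(* A representative of [u] that is continuous on [0,1), when there is one.
   Two such representatives agree on [0,1); under the Müntz condition the
   representative of an element of [M1 L] that is analytic on (0,1) and
   continuous on [0,1) is therefore this one. *)
Definition cts_repr u : R -> R :=
  get [set g : R -> R | {within `[0, 1[, continuous g} /\
                        (L1_repr u : R -> R) = g %[ae mu01 R]].

Definition volterra_fun u (x : R) : R :=
  \int[lebesgue_measure]_(t in `[0, x]) L1_repr u t.

Definition cesaro_fun u (x : R) : R :=
  if x == 0 then cts_repr u 0 else x^-1 * volterra_fun u x.

(* [T : M1 L -> Y] is the bounded operator [f |-> F f], where the elements of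
   [Y] are functions on [0,1] through [val : Y -> C01 R].  There is at most one
   such [T] when [val] is injective. *)
Definition is_operator L (Y : normedModType R) (val : Y -> C01 R)
    (F : L1 R -> R -> R) (T : {linear M1 L -> Y}) : Prop :=
  continuous T /\
  forall f, {in `[0, 1], C01_fun (val (T f)) =1 F (M1_val f)}.

End Muntz.

(* Main.v *)
Require Import Defs.
From HB Require Import structures.
From mathcomp Require Import all_boot all_order all_algebra.
From mathcomp Require Import all_classical all_reals all_analysis.
From mathcomp Require Import measurable_realfun ring_quotient.
From mathcomp Require Import ring lra.

Set Implicit Arguments.
Unset Strict Implicit.
Unset Printing Implicit Defensive.
Import Order.TTheory GRing.Theory Num.Theory.
Import numFieldNormedType.Exports.

Local Open Scope classical_set_scope.
Local Open Scope ring_scope.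

(** Write [V f] for the primitive of [f] that vanishes at 0 and [C f] for
    [x |-> V f x / x].

    The lower bound 1/2 is elementary.  The normalized monomials
    [(lambda n + 1) x^(lambda n)] have norm 1, and their images under [V] and [C],
    which are powers of [x], tend to 0 on (0, 1) and equal 1 at 1.  If a weakly
    compact operator came closer than 1/2 to [V] or [C], a weak cluster point of
    its values on these functions would be a continuous function with a jump at 1
    ([ess_norm_w_ge_half]).

    For the upper bound, [C] is compared with the operator
    [S f x = r C f (r x) + x^(lambda 0) V f 1 / 2], where [r < 1] is close to 1.
    For [x] near 1, [x (C f x - S f x)] is nearly the integral of [f] over
    [r x, x] minus half of its integral over [0, 1], that is, half of a difference
    of integrals over complementary sets, and is at most half of the norm of [f].
    For the other [x], the first two terms nearly cancel and the last one is at
    most half of the norm ([cesaro_pert_close]).  The operator [S] is compact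
    ([cesaro_pert_compact]) and has its values in the uniform closure of the Müntz
    polynomials.  Then [V] is [C] followed by multiplication by [x], a contraction
    between the uniform closures for [Lambda] and [1 + Lambda], and the codomain of
    continuous functions is reached by inclusion; such contractions do not increase
    essential norms ([ess_norm_comp_le]).

    All of this rests on one estimate: for [0 < c < c'], Müntz polynomials satisfy
    sup |p| over (0, c] <= N sup |V p| over (0, c'] with [N] independent of [p]
    ([muntz_pointwise_bound]).  It gives the continuous representatives, the
    boundedness of [C], and the compactness of [S], because the primitives of the
    unit ball are then equi-Lipschitz on [0, c].

    The estimate is proved as follows.  The mean of [p] over [x, b x] is controlled
    by the primitive of [p], and each monomial is an eigenvector of the averaging
    operator, with eigenvalue [mean_mult b l].  Given [N] exponents, a polynomial
    [Q] without constant term that equals 1 at their eigenvalues yields a function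
    [p - Q(mean) p] in which these exponents have disappeared, and
    the loss is the sum of the coefficients of [Q].  When the eigenvalues are at
    least 4, a polynomial of degree at most [8 N] has a loss exponentially small in
    [N] ([interpolation_ge0], [primitive_boundU]).  This is applied to the blocks of
    indices [2^j, 2^(j+1)), with [b - 1] of the order of [1 / lambda (2^j)]; the
    total dilation is then governed by the sum of [2^j / lambda (2^j)], which
    converges by the Müntz condition ([tail_primitive_bound]).  The bound so
    obtained is of order [1 / x] near 0.  Tails moreover decay at 0 at any given
    rate, and the finitely many remaining exponents are added one by one with the
    help of the differences [p x - b^(- mu) p (b x)] ([all_decay_bound]). *)

(** * Müntz polynomials, their primitives and their means *)

Section MuntzPolynomials.
Context {R : realType}.
Implicit Types (s : seq (R * R)) (F : set R).

Definition muntz_eval s (x : R) : R := \sum_(a <- s) a.1 * x `^ a.2.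

(** The primitive that vanishes at 0, when the exponents are nonnegative. *)
Definition muntz_prim s (x : R) : R :=
  \sum_(a <- s) a.1 / (a.2 + 1) * x `^ (a.2 + 1).

Definition supported F s := forall a, a \in s -> F a.2.

(** The operators used below (means, dilations, integration up to a power) are
    diagonal in the monomials; this is their common form. *)
Definition multiplier (w : R -> R) s := [seq (a.1 * w a.2, a.2) | a <- s].

Lemma supported_sub F F' s : F `<=` F' -> supported F s -> supported F' s.
Proof. by move=> FF' Fs a /Fs /FF'. Qed.

Lemma supported_multiplier F w s : supported F s -> supported F (multiplier w s).
Proof. by move=> Fs _ /mapP[a /Fs Fa ->]. Qed.

Lemma muntz_eval_multiplier w s x :
  muntz_eval (multiplier w s) x = \sum_(a <- s) a.1 * w a.2 * x `^ a.2.
Proof. by rewrite /muntz_eval big_map. Qed.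

Lemma muntz_prim_multiplier w s x : muntz_prim (multiplier w s) x =
  \sum_(a <- s) a.1 * w a.2 / (a.2 + 1) * x `^ (a.2 + 1).
Proof. by rewrite /muntz_prim big_map. Qed.

Lemma muntz_eval_multiplier_sum n (c : nat -> R) (w : nat -> R -> R) s x :
  muntz_eval (multiplier (fun l => \sum_(i < n) c i * w i l) s) x =
  \sum_(i < n) c i * muntz_eval (multiplier (w i) s) x.
Proof.
rewrite muntz_eval_multiplier.
under [RHS]eq_bigr do rewrite muntz_eval_multiplier mulr_sumr.
rewrite exchange_big /=; apply: eq_bigr => a _.
rewrite mulr_sumr mulr_suml; apply: eq_bigr => i _; ring.
Qed.

(** A multiplier that vanishes on some exponents removes them from the support. *)
Lemma muntz_eval_multiplier_filter w s x :
  muntz_eval (multiplier w [seq a <- s | w a.2 != 0]) x = muntz_eval (multiplier w s) x.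
Proof.
rewrite !muntz_eval_multiplier big_filter [RHS](bigID (fun a => w a.2 != 0)) /=.
rewrite [X in _ + X]big1 ?addr0// => a /negPn/eqP ->.
by rewrite mulr0 mul0r.
Qed.

Lemma muntz_prim_multiplier_filter w s x :
  muntz_prim (multiplier w [seq a <- s | w a.2 != 0]) x = muntz_prim (multiplier w s) x.
Proof.
rewrite !muntz_prim_multiplier big_filter [RHS](bigID (fun a => w a.2 != 0)) /=.
rewrite [X in _ + X]big1 ?addr0// => a /negPn/eqP ->.
by rewrite mulr0 !mul0r.
Qed.

Lemma muntz_eval_sub_multiplier w s x :
  muntz_eval (multiplier (fun l => 1 - w l) s) x =
  muntz_eval s x - muntz_eval (multiplier w s) x.
Proof.
rewrite !muntz_eval_multiplier /muntz_eval -sumrB; apply: eq_bigr => a _; ring.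
Qed.

Lemma muntz_prim_sub_multiplier w s x :
  muntz_prim (multiplier (fun l => 1 - w l) s) x =
  muntz_prim s x - muntz_prim (multiplier w s) x.
Proof.
rewrite !muntz_prim_multiplier /muntz_prim -sumrB; apply: eq_bigr => a _; ring.
Qed.

Lemma is_derive_muntz_prim s (x : R) : supported [set l | 0 <= l] s -> 0 < x ->
  is_derive x 1 (muntz_prim s) (muntz_eval s x).
Proof.
move=> + x0; rewrite /muntz_prim /muntz_eval.
elim: s => [_|a s IH sF].
  under eq_fun do rewrite big_nil.
  by rewrite big_nil; exact: is_derive_cst.
under eq_fun do rewrite big_cons.
rewrite big_cons; apply: is_deriveD; last first.
  by apply: IH => c cs; apply: sF; rewrite in_cons cs orbT.
have a0 : 0 <= a.2 by apply: sF; rewrite mem_head.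
have -> : a.1 * x `^ a.2 = a.1 / (a.2 + 1) *: ((a.2 + 1) * x `^ (a.2 + 1 - 1)).
  rewrite addrK /GRing.scale/= mulrA divfK// gt_eqF//; lra.
by apply: is_deriveZ; apply: is_derive1_powR.
Qed.

Lemma muntz_prim_increment s (x y S : R) : supported [set l | 0 <= l] s ->
  0 < x -> x <= y -> (forall z, x <= z <= y -> `|muntz_eval s z| <= S) ->
  `|muntz_prim s y - muntz_prim s x| <= S * (y - x).
Proof.
move=> sF x0 xy hS.
have dP z : x <= z -> is_derive z 1 (muntz_prim s) (muntz_eval s z).
  by move=> xz; apply: is_derive_muntz_prim => //; exact: lt_le_trans xz.
have [|z|c + ->] := @MVT_segment R (muntz_prim s) (muntz_eval s) x y xy.
- by move=> z /[!in_itv]/= /andP[/ltW xz _]; exact: dP.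
- apply: derivable_within_continuous => t; rewrite in_itv/= => /andP[xt _].
  by have [] := dP _ xt.
- rewrite in_itv/= => cxy; rewrite normrM (ger0_norm (_ : 0 <= y - x)) ?subr_ge0//.
  by rewrite ler_wpM2r ?subr_ge0// hS.
Qed.

(** The mean of [t `^ l] over [1, b], hence the eigenvalue at the monomial of
    exponent [l] of the averaging operator [p |-> fun x => mean of p over [x, b x]]. *)
Definition mean_mult (b l : R) : R := (b `^ (l + 1) - 1) / ((l + 1) * (b - 1)).

Lemma muntz_eval_mean s (b x : R) : supported [set l | 0 <= l] s -> 1 < b -> 0 < x ->
  muntz_eval (multiplier (mean_mult b) s) x =
  (muntz_prim s (b * x) - muntz_prim s x) / ((b - 1) * x).
Proof.
move=> sF b1 x0; rewrite muntz_eval_multiplier /muntz_prim -sumrB mulr_suml.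
apply: eq_big_seq => a /sF /= a0.
rewrite /mean_mult powRM ?(ltW x0)//; last lra.
have -> : x `^ (a.2 + 1) = x `^ a.2 * x.
  by rewrite powRD ?powRr1 ?(ltW x0)// (gt_eqF x0) implybT.
by field; rewrite !gt_eqF//; lra.
Qed.

(** Only one of the averages has to pay the factor [1 / ((b - 1) x)] that turns a
    bound on the primitive into a pointwise bound; the other ones do not increase
    the supremum. *)
Lemma mean_multX s (b x W : R) i : supported [set l | 0 <= l] s -> 1 < b ->
  0 < x ->
  (forall y z, x <= y <= b ^+ i.+1 * x -> x <= z <= b ^+ i.+1 * x ->
     `|muntz_prim s y - muntz_prim s z| <= W) ->
  `|muntz_eval (multiplier (fun l => mean_mult b l ^+ i.+1) s) x|
    <= W / ((b - 1) * x).
Proof.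
move=> sF b1; have b0 : 0 < b by lra.
have bX n : 1 <= b ^+ n by rewrite exprn_ege1 ?ltW.
elim: i x => [|i IH] x x0 osc.
  rewrite -[multiplier _ _]/(multiplier (mean_mult b) s) muntz_eval_mean//.
  have xb : x <= b * x by rewrite ler_peMl ?(ltW x0) ?ltW.
  rewrite normrM normfV [X in _ / X]gtr0_norm; last by rewrite mulr_gt0// subr_gt0.
  apply: ler_wpM2r; first by rewrite invr_ge0 mulr_ge0 ?subr_ge0 ?ltW.
  by apply: osc; rewrite expr1 lexx xb.
set s' := multiplier (fun l => mean_mult b l ^+ i.+1) s.
have -> : multiplier (fun l => mean_mult b l ^+ i.+2) s
        = multiplier (mean_mult b) s'.
  rewrite /s' /multiplier -map_comp; apply: eq_map => a /=.
  by rewrite exprSr mulrA.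
have s'F : supported [set l | 0 <= l] s' by exact: supported_multiplier.
rewrite muntz_eval_mean//.
have bx0 : 0 < (b - 1) * x by rewrite mulr_gt0// subr_gt0.
have W0 : 0 <= W.
  have xX : x <= x <= b ^+ i.+2 * x by rewrite lexx ler_peMl ?(ltW x0).
  exact: le_trans (normr_ge0 _) (osc x x xX xX).
rewrite normrM normfV [X in _ / X]gtr0_norm// ler_pdivrMr// divfK ?gt_eqF//.
have xb : x <= b * x by rewrite ler_peMl ?(ltW x0) ?ltW.
apply: (@le_trans _ _ (W / ((b - 1) * x) * (b * x - x))); last first.
  rewrite (_ : b * x - x = (b - 1) * x) ?divfK ?gt_eqF//; ring.
apply: muntz_prim_increment => // y /andP[xy yb].
have y0 : 0 < y by exact: lt_le_trans xy.
apply: le_trans (IH _ y0 _) _.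
  move=> u v /andP[yu ub] /andP[yv vb]; apply: osc.
    rewrite (le_trans xy)//= (le_trans ub)// [_ ^+ i.+2]exprSr -mulrA.
    by rewrite ler_pM2l// exprn_gt0.
  rewrite (le_trans xy)//= (le_trans vb)// [_ ^+ i.+2]exprSr -mulrA.
  by rewrite ler_pM2l// exprn_gt0.
rewrite ler_wpM2l// lef_pV2 ?posrE ?mulr_gt0 ?subr_gt0//.
by rewrite ler_pM2l// subr_gt0.
Qed.

End MuntzPolynomials.

(** * Removing a block of exponents *)

Section Interpolation.
Context {R : realType}.

Lemma horner_ge0 (G : {poly R}) (x : R) :
  (forall i, 0 <= G`_i) -> 0 <= x -> 0 <= G.[x].
Proof.
by move=> G0 x0; rewrite horner_coef sumr_ge0// => i _; rewrite mulr_ge0 ?exprn_ge0.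
Qed.

(** Horner's scheme at a nonnegative point does not create negative coefficients. *)
Lemma factor_ge0 (G : {poly R}) (u : R) : (forall i, 0 <= G`_i) -> 0 <= u ->
  exists2 G1 : {poly R}, (forall i, 0 <= G1`_i) & G = G.[u]%:P + G1 * ('X - u%:P).
Proof.
move=> G0 u0.
have /factor_theorem[G1 GE] : root (G - G.[u]%:P) u.
  by rewrite rootE hornerD hornerN hornerC subrr.
exists G1; last by rewrite -GE addrC subrK.
have rec i : G1`_i = G`_i.+1 + u * G1`_i.+1.
  have := congr1 (fun p : {poly R} => p`_i.+1) GE.
  rewrite mulrBr !coefB coefC /= subr0 coefMX /= coefMC => ->; ring.
have H n i : (size G1 <= i + n)%N -> 0 <= G1`_i.
  elim: n i => [|n IH] i; first by rewrite addn0 => /leq_sizeP ->.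
  by rewrite addnS -addSn => /IH h; rewrite rec addr_ge0// mulr_ge0.
by move=> i; apply: (H (size G1)); rewrite leq_addl.
Qed.

(** Newton interpolation of [G].  Since the coefficients of the successive
    quotients are nonnegative, their values at [2 rho] control everything: each
    division by [X - u] with [u <= rho] costs at most a factor [1 / rho].  For
    [G = X^M] with [M] much larger than the number of nodes, the right-hand side is
    exponentially small as soon as [2 rho < 1], which is what makes it possible to
    treat many exponents at once. *)
Lemma interpolation_ge0 (rho : R) (us : seq R) (G : {poly R}) : 0 < rho ->
  (forall u, u \in us -> 0 <= u <= rho) -> (forall i, 0 <= G`_i) ->
  exists P : {poly R}, [/\ (size P <= size us)%N,
    forall u, u \in us -> P.[u] = G.[u] &
    \sum_(i < size us) `|P`_i| <= (2 + rho^-1) ^+ size us * G.[2 * rho]].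
Proof.
move=> rho0; elim: us G => [|u us IH] G usr G0.
  exists 0; split=> //; first by rewrite size_poly0.
  by rewrite big_ord0 expr0 mul1r horner_ge0// mulr_ge0// ltW.
have /andP[u0 ur] : 0 <= u <= rho by apply: usr; rewrite mem_head.
have [G1 G10 GE] := factor_ge0 G0 u0.
have [|P1 [sP1 P1E P1l]] := IH G1 _ G10.
  by move=> v vus; apply: usr; rewrite in_cons vus orbT.
have r2 : 0 <= 2 * rho by lra.
have Gu0 := horner_ge0 G0 u0.
have G1r0 := horner_ge0 G10 r2.
have Gr : G.[2 * rho] = G.[u] + G1.[2 * rho] * (2 * rho - u).
  by rewrite {1}GE hornerD hornerC hornerM hornerXsubC.
exists (G.[u]%:P + P1 * ('X - u%:P)); split.
- rewrite (leq_trans (size_polyD _ _))// geq_max (leq_trans (size_polyC_leq1 _))//=.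
  have [->|P10] := eqVneq P1 0; first by rewrite mul0r size_poly0.
  by rewrite size_Mmonic ?monicXsubC// size_XsubC addn2.
- move=> v; rewrite in_cons hornerD hornerC hornerM hornerXsubC.
  case/predU1P => [->|vus]; first by rewrite subrr mulr0 addr0.
  by rewrite P1E// [in RHS]GE hornerD hornerC hornerM hornerXsubC.
- set n := size us in sP1 P1l *.
  have E i : `|(G.[u]%:P + P1 * ('X - u%:P))`_i| <=
      (if i == 0%N then G.[u] else `|P1`_i.-1|) + u * `|P1`_i|.
    rewrite coefD coefC mulrBr coefB coefMX coefMC.
    case: (i == 0%N).
      rewrite sub0r (le_trans (ler_normD _ _))// normrN normrM (ger0_norm Gu0).
      by rewrite (ger0_norm u0) mulrC.
    rewrite add0r (le_trans (ler_normB _ _))// normrM (ger0_norm u0).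
    by rewrite [u * _]mulrC.
  apply: (le_trans (ler_sum _ (fun (i : 'I_n.+1) _ => E i))).
  rewrite big_split /= -mulr_sumr big_ord_recl /= big_ord_recr /=.
  rewrite (_ : P1`_n = 0) ?normr0 ?addr0; last by move/leq_sizeP: sP1; exact.
  under eq_bigr do rewrite /bump /=.
  set L := \sum_(i < n) _ in P1l *.
  apply: (@le_trans _ _ (G.[u] + (1 + rho) * L)).
    rewrite -addrA lerD2l mulrDl mul1r lerD2l ler_wpM2r//.
    by apply: sumr_ge0.
  have K1 : 1 <= (2 + rho^-1) ^+ n.
    by rewrite exprn_ege1//; have : 0 < rho^-1 by [rewrite invr_gt0]; lra.
  have G1le : G1.[2 * rho] <= G.[2 * rho] / rho.
    rewrite ler_pdivlMr// Gr -[leLHS]add0r lerD// ler_wpM2l//; lra.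
  have Gle : G.[u] <= G.[2 * rho].
    by rewrite Gr lerDl mulr_ge0//; lra.
  have Gr0 : 0 <= G.[2 * rho] by exact: le_trans Gle.
  have LL : L <= (2 + rho^-1) ^+ n * (G.[2 * rho] / rho).
    by apply: le_trans P1l _; rewrite ler_wpM2l// (le_trans _ K1).
  rewrite exprS.
  have : (1 + rho) * L <= (1 + rho) * ((2 + rho^-1) ^+ n * (G.[2 * rho] / rho)).
    by rewrite ler_wpM2l//; lra.
  have GK : G.[2 * rho] <= (2 + rho^-1) ^+ n * G.[2 * rho] by rewrite ler_peMl.
  have -> : (1 + rho) * ((2 + rho^-1) ^+ n * (G.[2 * rho] / rho)) =
    (2 + rho^-1) * (2 + rho^-1) ^+ n * G.[2 * rho] - (2 + rho^-1) ^+ n * G.[2 * rho].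
    by field; rewrite gt_eqF.
  lra.
Qed.

End Interpolation.

Section PrimitiveBound.
Context {R : realType}.
Implicit Types (s : seq (R * R)) (F : set R).

(** A bound on [p x] by the oscillation of the primitive of [p] slightly to the
    right of [x]. *)
Definition primitive_bound F (k B : R) := forall s (x W : R),
  supported F s -> 0 < x ->
  (forall y z, x <= y <= B * x -> x <= z <= B * x ->
     `|muntz_prim s y - muntz_prim s z| <= W) ->
  `|muntz_eval s x| <= k * (W / x).

(** Interpolate [u^M] at the inverses of the eigenvalues [v] of the mean on [ls]:
    this gives [Q] without constant term, with small coefficients, such that
    [Q v = 1] there.  Then [p - Q(mean) p] has no exponent in [ls], so the bound
    known for [F] applies to it, while [Q(mean) p] is controlled directly by the
    primitive of [p]. *)
Lemma primitive_boundU F (ls : seq R) (k B b rho : R) M :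
  F `<=` [set l | 0 <= l] -> (forall l, l \in ls -> 0 <= l) ->
  1 < b -> 0 < rho ->
  (forall l, l \in ls -> 0 < mean_mult b l /\ (mean_mult b l)^-1 <= rho) ->
  (size ls <= M)%N -> 0 <= k -> 1 <= B ->
  primitive_bound F k B ->
  let d := (2 + rho^-1) ^+ size ls * (2 * rho) ^+ M / (b - 1) in
  primitive_bound (F `|` [set` ls]) (d + k * (1 + (B - 1) * d)) (B * b ^+ M).
Proof.
move=> F0 ls0 b1 rho0 lsr lsM k0 B1 FkB d s x W sF x0 osc.
have b0 : 0 < b by lra.
have bX n : 1 <= b ^+ n by rewrite exprn_ege1 ?ltW.
have usr u : u \in [seq (mean_mult b l)^-1 | l <- ls] -> 0 <= u <= rho.
  by move=> /mapP[l /lsr[v0 vr] ->]; rewrite vr invr_ge0 ltW.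
have XM0 i : 0 <= ('X^M : {poly R})`_i by rewrite coefXn; case: (_ == _).
have [P [sP PE Pl]] := interpolation_ge0 rho0 usr XM0.
rewrite size_map in sP Pl; rewrite hornerXn in Pl.
set N := size ls in sP Pl lsM d *.
(* Q v = v^M P (1 / v); its exponents M - i are positive since i < N <= M *)
pose e l i := mean_mult b l ^+ (M - i.+1).+1.
pose Q l := \sum_(i < N) P`_i * e l i.
have Q1 l : l \in ls -> Q l = 1.
  move=> lls; have [v0 _] := lsr _ lls.
  have := PE _ (map_f _ lls); rewrite hornerXn (horner_coef_wide _ sP) => /eqP.
  rewrite exprVn -(inj_eq (mulfI (lt0r_neq0 (exprn_gt0 M v0)))) divff; last first.
    by rewrite expf_neq0// gt_eqF.
  move=> /eqP <-; rewrite mulr_sumr; apply: eq_bigr => i _.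
  have iM : (i < M)%N by exact: leq_trans lsM.
  rewrite /e subnSK// mulrCA; congr (_ * _).
  by rewrite exprVn expfB_cond ?gt_eqF//= ltnW.
have s0 : supported [set l | 0 <= l] s.
  by apply: supported_sub sF => l [/F0//|/ls0].
have QE y V : 0 < y ->
    (forall u v, y <= u <= b ^+ M * y -> y <= v <= b ^+ M * y ->
       `|muntz_prim s u - muntz_prim s v| <= V) ->
    `|muntz_eval (multiplier Q s) y| <= d * (V / y).
  move=> y0 oscy.
  rewrite (muntz_eval_multiplier_sum N (fun i => P`_i) (fun i l => e l i)).
  apply: le_trans (ler_norm_sum _ _ _) _.
  have V0 : 0 <= V.
    have yy : y <= y <= b ^+ M * y by rewrite lexx ler_peMl ?(ltW y0).
    exact: le_trans (normr_ge0 _) (oscy y y yy yy).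
  apply: (@le_trans _ _ (\sum_(i < N) `|P`_i| * (V / ((b - 1) * y)))).
    apply: ler_sum => i _; rewrite normrM ler_wpM2l//.
    apply: mean_multX => // u v /andP[yu ub] /andP[yv vb]; apply: oscy.
      rewrite yu (le_trans ub)// ler_pM2r// ler_weXn2l// ?ltW//.
      by rewrite subnSK ?leq_subr// (leq_trans _ lsM).
    rewrite yv (le_trans vb)// ler_pM2r// ler_weXn2l// ?ltW//.
    by rewrite subnSK ?leq_subr// (leq_trans _ lsM).
  rewrite -mulr_suml.
  have -> : d * (V / y) =
      (2 + rho^-1) ^+ N * (2 * rho) ^+ M * (V / ((b - 1) * y)).
    by rewrite /d; field; rewrite !gt_eqF// subr_gt0.
  by rewrite ler_wpM2r// divr_ge0// mulr_ge0 ?subr_ge0 ?ltW.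
have d0 : 0 <= d.
  rewrite /d mulr_ge0 ?invr_ge0 ?subr_ge0 ?(ltW b1)// mulr_ge0// exprn_ge0//.
    by rewrite addr_ge0// invr_ge0 ltW.
  by rewrite mulr_ge0// ltW.
have xBx : x <= B * x by rewrite ler_peMl ?(ltW x0).
have Bb y : y <= B * x -> b ^+ M * y <= B * b ^+ M * x.
  by move=> yB; rewrite -mulrA mulrCA ler_wpM2l// (le_trans _ (bX M)).
have W0 : 0 <= W.
  have xx : x <= x <= B * b ^+ M * x.
    by rewrite lexx -mulrA (le_trans xBx)// ler_wpM2l ?(le_trans _ B1)// ler_peMl ?(ltW x0).
  exact: le_trans (normr_ge0 _) (osc x x xx xx).
have QW y : x <= y <= B * x -> `|muntz_eval (multiplier Q s) y| <= d * (W / x).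
  move=> /andP[xy yB]; have y0 := lt_le_trans x0 xy.
  apply: (@le_trans _ _ (d * (W / y))); last first.
    by rewrite ler_wpM2l// ler_wpM2l// lef_pV2.
  apply: QE => // u v /andP[yu ub] /andP[yv vb]; apply: osc.
    by rewrite (le_trans xy)//= (le_trans ub)// Bb.
  by rewrite (le_trans xy)//= (le_trans vb)// Bb.
pose w l := 1 - Q l.
pose r := multiplier w [seq a <- s | w a.2 != 0].
have rF : supported F r.
  move=> _ /mapP[a + ->] /=; rewrite mem_filter => /andP[wa /sF[//|/= /Q1]].
  by move: wa; rewrite /w => /[swap] ->; rewrite subrr eqxx.
have rE y : muntz_eval r y = muntz_eval s y - muntz_eval (multiplier Q s) y.
  by rewrite /r muntz_eval_multiplier_filter muntz_eval_sub_multiplier.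
have rP y : muntz_prim r y = muntz_prim s y - muntz_prim (multiplier Q s) y.
  by rewrite /r muntz_prim_multiplier_filter muntz_prim_sub_multiplier.
have Qinc y z : x <= y -> y <= z -> z <= B * x ->
    `|muntz_prim (multiplier Q s) z - muntz_prim (multiplier Q s) y| <= (B - 1) * d * W.
  move=> xy yz zB; have y0 := lt_le_trans x0 xy.
  apply: (@le_trans _ _ (d * (W / x) * (z - y))).
    apply: muntz_prim_increment => //; first exact: supported_multiplier.
    by move=> t /andP[yt tz]; rewrite QW// (le_trans xy)//= (le_trans tz).
  have -> : (B - 1) * d * W = d * (W / x) * (B * x - x).
    by field; rewrite gt_eqF.
  apply: ler_wpM2l; last exact: lerB.
  exact: mulr_ge0 d0 (divr_ge0 W0 (ltW x0)).
have oscr y z : x <= y <= B * x -> x <= z <= B * x ->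
    `|muntz_prim r y - muntz_prim r z| <= (1 + (B - 1) * d) * W.
  move=> /andP[xy yB] /andP[xz zB].
  rewrite !rP opprD addrACA -opprD (le_trans (ler_normB _ _))//.
  rewrite mulrDl mul1r lerD//.
    have wide t : t <= B * x -> t <= B * b ^+ M * x.
      move=> tB; rewrite (le_trans tB)// mulrAC ler_peMr//.
      exact: le_trans (ltW x0) xBx.
    by apply: osc; rewrite ?xy ?xz wide.
  by have [yz|/ltW zy] := leP y z; [rewrite distrC|]; exact: Qinc.
have := FkB r x _ rF x0 oscr.
have := QW x; rewrite lexx xBx => /(_ isT).
rewrite rE => QWx rW.
rewrite -[muntz_eval s x](subrK (muntz_eval (multiplier Q s) x)).
rewrite (le_trans (ler_normD _ _))// mulrDl addrC lerD//.
apply: le_trans rW _.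
by rewrite !mulrA lexx.
Qed.

End PrimitiveBound.

(** * Sparse blocks: the Müntz condition at work *)

Section PrimitiveBoundMono.
Context {R : realType}.

Lemma primitive_bound_mono (F F' : set R) (k k' B B' : R) :
  F' `<=` F -> k <= k' -> 1 <= B -> B <= B' ->
  primitive_bound F k B -> primitive_bound F' k' B'.
Proof.
move=> FF kk B1 BB H s x W sF x0 osc.
have BB' y : x <= y <= B * x -> x <= y <= B' * x.
  by move=> /andP[-> yB] /=; rewrite (le_trans yB)// ler_wpM2r// ltW.
have xx : x <= x <= B * x by rewrite lexx ler_peMl// ltW.
have W0 : 0 <= W by exact: le_trans (normr_ge0 _) (osc x x (BB' _ xx) (BB' _ xx)).
apply: le_trans (H s x W (supported_sub FF sF) x0 _) _.
  by move=> y z /BB' ? /BB' ?; exact: osc.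
by rewrite ler_wpM2r// divr_ge0// ltW.
Qed.

Lemma expR_ge1 (x : R) : 0 <= x -> 1 <= expR x.
Proof. by move=> x0; rewrite (le_trans _ (expR_ge1Dx _))// lerDl. Qed.

Lemma mean_mult_gt0 (b l : R) : 1 < b -> 0 <= l -> 0 < mean_mult b l.
Proof.
move=> b1 l0; rewrite /mean_mult divr_gt0//; last first.
  by rewrite mulr_gt0 ?subr_gt0//; lra.
rewrite subr_gt0 -[ltLHS](powRr0 b) /powR gt_eqF; last lra.
by rewrite ltr_expR mul0r mulr_gt0 ?ln_gt0//; lra.
Qed.

(** Enlarging [h] beyond a multiple of [1 / l] makes the nodes [1 / mean_mult] at
    most [1 / 4], the range where the interpolation error is small. *)
Lemma mean_mult_ge4 (h l : R) : 0 < h -> h <= 1 -> 0 <= l -> 32 <= l * h ->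
  4 <= mean_mult (1 + h) l.
Proof.
move=> h0 h1 l0 lh; rewrite /mean_mult.
have lnh : h / 2 <= ln (1 + h).
  have /le_ln1Dx : -1 < - (h / (1 + h)).
    by rewrite ltrN2 ltr_pdivrMr; lra.
  have -> : 1 - h / (1 + h) = (1 + h)^-1 by field; lra.
  rewrite lnV ?posrE; last lra.
  rewrite lerN2; apply: le_trans.
  by rewrite ler_wpM2l ?(ltW h0)// lef_pV2 ?posrE; lra.
set X := (l + 1) * ln (1 + h).
have X0 : 0 <= X by rewrite mulr_ge0//; lra.
have -> : (1 + h) `^ (l + 1) = expR X by rewrite /powR gt_eqF//; lra.
rewrite (_ : 1 + h - 1 = h); last ring.
have lh0 : 0 < (l + 1) * h by rewrite mulr_gt0//; lra.
rewrite ler_pdivlMr//.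
have := expR_ge1Dxn 1 X0.
have XX : (l + 1) * (h / 2) <= X by rewrite ler_wpM2l//; lra.
have X2 : ((l + 1) * (h / 2)) ^+ 2 <= X ^+ 2.
  by rewrite lerXn2r ?nnegrE//; lra.
have -> : 2`!%:R = 2 :> R by [].
have : 32 * ((l + 1) * h) <= ((l + 1) * h) ^+ 2.
  by rewrite expr2 ler_wpM2r ?(ltW lh0)//; rewrite mulrDl mul1r; lra.
have : ((l + 1) * (h / 2)) ^+ 2 = ((l + 1) * h) ^+ 2 / 4 by field.
lra.
Qed.

End PrimitiveBoundMono.

Section Tail.
Context {R : realType} (lambda : nat -> R).
Hypothesis lambda_ge0 : forall n, 0 <= lambda n.
Hypothesis lambda_incr : forall m n, (m < n)%N -> lambda m < lambda n.
Hypothesis muntz_condition :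
  (\sum_(0 <= n <oo | lambda n != 0%R) ((lambda n)^-1)%:E < +oo)%E.

Lemma lambda_le m n : (m <= n)%N -> lambda m <= lambda n.
Proof. by rewrite leq_eqVlt => /predU1P[->//|/lambda_incr/ltW]. Qed.

Lemma lambda_gt0 n : (0 < n)%N -> 0 < lambda n.
Proof. by move=> n0; exact: le_lt_trans (lambda_ge0 0) (lambda_incr n0). Qed.

Lemma muntz_tail (e : R) : 0 < e ->
  exists N, forall K, \sum_(N <= n < K) (lambda n)^-1 <= e.
Proof.
move=> e0.
have l0 k : lambda k != 0 -> (0 <= ((lambda k)^-1)%:E)%E.
  by rewrite lee_fin invr_ge0 lambda_ge0.
have /fine_cvgP[fin] := nneseries_tail_cvg muntz_condition l0.
move=> /cvgrPdist_le/(_ _ e0) near_e.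
have [N _ /(_ N (leqnn N)) /= [Nfin Ne]] : \forall N \near \oo,
    (\sum_(N <= k <oo | lambda k != 0%R) ((lambda k)^-1)%:E)%E \is a fin_num /\
    `|0 - fine (\sum_(N <= k <oo | lambda k != 0%R) ((lambda k)^-1)%:E)%E| <= e.
  by near=> N; split; near: N.
exists N => K; rewrite -lee_fin.
apply: (@le_trans _ _ (\sum_(N <= k <oo | lambda k != 0%R) ((lambda k)^-1)%:E)%E).
  have -> : \sum_(N <= n < K) (lambda n)^-1 =
            \sum_(N <= n < K | lambda n != 0) (lambda n)^-1.
    rewrite [RHS]big_mkcond; apply: eq_bigr => n _.
    by case: eqVneq => //= ->; rewrite invr0.
  by rewrite -sumEFin; apply: nneseries_lim_ge => n _; exact: l0.
rewrite -(fineK Nfin) lee_fin (le_trans (ler_norm _))//.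
by move: Ne; rewrite sub0r normrN.
Unshelve. all: by end_near. Qed.

Lemma lambda_large (A : R) : exists N, forall n, (N <= n)%N -> A <= lambda n.
Proof.
have A0 : 0 < `|A| + 1 by have := normr_ge0 A; lra.
have A1 : 0 < (`|A| + 1)^-1 by rewrite invr_gt0.
have [N hN] := muntz_tail A1.
exists N.+1 => n Nn; have l0 : 0 < lambda n by apply: lambda_gt0; exact: leq_trans Nn.
have := hN n.+1; rewrite big_nat_recr ?(ltnW Nn)//= => h.
have : (lambda n)^-1 <= (`|A| + 1)^-1.
  apply: le_trans h; rewrite lerDr; apply: sumr_ge0 => i _.
  by rewrite invr_ge0.
by rewrite lef_pV2 ?posrE//; have := ler_norm A; lra.
Qed.

Definition tail_exponents n0 : set R := [set lambda n | n in [set n | (n0 <= n)%N]].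

Definition block_exponents (J K : nat) : set R :=
  [set lambda n | n in [set n | (2 ^ J <= n < 2 ^ K)%N]].

(** A common bound, for the block of indices [2^j, 2^(j+1)), of the loss in
    [primitive_boundU] and of the logarithm of the dilation factor. *)
Let weight (j : nat) : R :=
  256 * (2 ^ j)%N%:R / lambda (2 ^ j)%N + 9 * 2^-1 ^+ j.

(** The block [j] is removed with means over [x, (1 + width j) x].  The first term
    makes [mean_mult_ge4] applicable; the second one keeps the width from being too
    small when the exponents grow very fast. *)
Let width (j : nat) : R := 32 / lambda (2 ^ j)%N + 4^-1 ^+ j.

Let weight_ge0 j : 0 <= weight j.
Proof.
apply: addr_ge0; last by rewrite mulr_ge0 ?exprn_ge0.
apply: divr_ge0 (lambda_ge0 _); apply: mulr_ge0 (ler0n _ _); lra.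
Qed.

Let l2_gt0 j : 0 < lambda (2 ^ j)%N.
Proof. by rewrite lambda_gt0// expn_gt0. Qed.

Let width_gt0 j : 0 < width j.
Proof. by rewrite addr_gt0 ?divr_gt0// exprn_gt0 ?invr_gt0. Qed.

Let weight_width j : (8 * 2 ^ j)%N%:R * width j + 2^-1 ^+ j = weight j.
Proof.
rewrite /weight /width.
have -> : 4^-1 ^+ j = 2^-1 ^+ j * 2^-1 ^+ j :> R.
  by rewrite -exprMn; congr (_ ^+ _); field.
have : 2 ^+ j * 2^-1 ^+ j = 1 :> R by rewrite -exprMn divff// expr1n.
rewrite natrM natrX; set u := 2 ^+ j; set v := 2^-1 ^+ j => uv.
have -> : 8 * u * (32 / lambda (2 ^ j) + v * v) = 256 * u / lambda (2 ^ j) + 8 * (u * v) * v by ring.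
rewrite uv; ring.
Qed.

(** The loss of [primitive_boundU] for [2^j] nodes in [0, 1/4] and [M = 8 * 2^j]. *)
Let defect_le j (N := (2 ^ j)%N) :
  (2 + (4^-1)^-1) ^+ N * (2 * 4^-1) ^+ (8 * N) / width j <= 2^-1 ^+ j :> R.
Proof.
have -> : (2 + (4^-1)^-1) ^+ N * (2 * 4^-1) ^+ (8 * N) = (6 / 256) ^+ N :> R.
  by rewrite exprM -exprMn; congr (_ ^+ _); field.
rewrite ler_pdivrMr//.
apply: (@le_trans _ _ (2^-1 ^+ j * 4^-1 ^+ j)); last first.
  by rewrite ler_wpM2l ?exprn_ge0// lerDr divr_ge0.
rewrite -exprMn.
apply: (@le_trans _ _ ((2^-1 * 4^-1) ^+ N)).
  by apply: lerXn2r; rewrite ?nnegrE; lra.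
by rewrite ler_wiXn2l ?(ltnW (ltn_expl _ _))//; lra.
Qed.

(** The blocks are removed from the first one on; with dilation factors below 2,
    the constants [1 + k] multiply. *)
Lemma block_primitive_bound J K : (forall j, (J <= j)%N -> width j <= 1) ->
  expR (\sum_(J <= j < K) weight j) <= 2 ->
  primitive_bound (block_exponents J K)
    (expR (\sum_(J <= j < K) weight j) - 1) (expR (\sum_(J <= j < K) weight j)).
Proof.
move=> width1; move: {-1}(K - J)%N (leqnn (K - J)) => n.
elim: n J width1 => [|n IH] J width1 KJ.
  rewrite leqn0 subn_eq0 in KJ; rewrite big_geq// expR0 subrr => _ [|a s] x W sF x0 _.
    by rewrite /muntz_eval big_nil normr0 mul0r.
  have [m /= /andP[Jm mK] _] : block_exponents J K a.2 by apply: sF; rewrite mem_head.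
  by have := leq_ltn_trans Jm mK; rewrite ltn_exp2l// ltnNge KJ.
have [KJ'|JK] := leqP K J.
  by apply: IH => //; rewrite (eqP (_ : K - J == 0)%N) // subn_eq0.
rewrite big_ltn// expRD; set E' := \sum_(J.+1 <= j < K) weight j => E2.
have E'1 : 1 <= expR E' by rewrite expR_ge1// sumr_ge0.
have w1 : 1 <= expR (weight J) by exact: expR_ge1.
have E'2 : expR E' <= 2 by apply: le_trans E2; rewrite ler_peMl ?expR_ge0.
have {}IH : primitive_bound (block_exponents J.+1 K) (expR E' - 1) (expR E').
  by apply: IH => // [j /ltnW/width1//|]; rewrite subnS -ltnS prednK// subn_gt0.
set ls := [seq lambda m | m <- iota (2 ^ J) (2 ^ J)].
have lsP l : l \in ls -> exists2 m, (2 ^ J <= m)%N & l = lambda m.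
  by move=> /mapP[m]; rewrite mem_iota => /andP[Jm _] ->; exists m.
have wJ1 := width1 _ (leqnn J).
have := @primitive_boundU R (block_exponents J.+1 K) ls (expR E' - 1) (expR E')
  (1 + width J) 4^-1 (8 * 2 ^ J).
have -> : 1 + width J - 1 = width J by ring.
rewrite /= size_map size_iota.
set d := _ / width J.
have dle : d <= 2^-1 ^+ J by exact: defect_le.
have d0 : 0 <= d.
  rewrite /d; apply: divr_ge0 (ltW (width_gt0 J)).
  by apply: mulr_ge0; apply: exprn_ge0; lra.
clearbody d; move=> H; apply: primitive_bound_mono (H _ _ _ _ _ _ _ _ IH).
- move=> _ [m /= /andP[Jm mK] <-].
  have [m2|m2] := leqP (2 ^ J.+1) m; [left|right].
    by exists m => //=; rewrite m2.
  by rewrite /= map_f// mem_iota Jm /= addnn -mul2n -expnS.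
- have dw : 1 + d <= expR (weight J).
    apply: le_trans (expR_ge1Dx _); rewrite lerD2l (le_trans dle)//.
    by rewrite -weight_width lerDr mulr_ge0 ?ltW.
  have E'0 : 0 <= expR E' by exact: expR_ge0.
  have := ler_wpM2r E'0 dw.
  have : 0 <= (expR E' - 1) * ((2 - expR E') * d).
    by rewrite mulr_ge0 ?mulr_ge0 ?subr_ge0.
  nra.
- by rewrite -[leLHS]mul1r ler_pM// exprn_ege1// lerDl ltW.
- rewrite mulrC ler_wpM2r ?expR_ge0//.
  apply: (@le_trans _ _ (expR (width J) ^+ (8 * 2 ^ J))).
    rewrite lerXn2r ?nnegrE ?expR_ge0 ?expR_ge1Dx//.
    by rewrite addr_ge0// ltW.
  by rewrite -expRM_natl ler_expR -weight_width lerDl exprn_ge0.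
- by move=> _ [m _ <-]; exact: lambda_ge0.
- by move=> l /lsP[m _ ->].
- by rewrite ltrDl.
- by rewrite invr_gt0.
- move=> l /lsP[m Jm ->].
  have lm : lambda (2 ^ J)%N <= lambda m by exact: lambda_le.
  split; first by apply: mean_mult_gt0 => //; rewrite ltrDl.
  rewrite lef_pV2 ?posrE ?mean_mult_gt0 ?ltrDl//.
  apply: mean_mult_ge4 => //.
  apply: (@le_trans _ _ (lambda (2 ^ J)%N * (32 / lambda (2 ^ J)%N))).
    by rewrite mulrC divfK// gt_eqF.
  apply: ler_pM => //; first by rewrite divr_ge0 ?lambda_ge0.
  by rewrite lerDl exprn_ge0.
- by rewrite leq_pmull.
- by rewrite subr_ge0.
- by [].
Qed.

(** Half of Cauchy's condensation test, with explicit ranges. *)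
Lemma condensation J K :
  \sum_(J <= j < K) (2 ^ j.+1)%N%:R / lambda (2 ^ j.+1)%N <=
  2 * \sum_(2 ^ J <= n < 2 ^ K) (lambda n)^-1.
Proof.
elim: K => [|K IH].
  by rewrite big_geq// mulr_ge0// sumr_ge0// => i _; rewrite invr_ge0.
have [KJ|JK] := ltnP K J.
  by rewrite big_geq// mulr_ge0// sumr_ge0// => i _; rewrite invr_ge0.
rewrite big_nat_recr//=.
have -> : \sum_(2 ^ J <= n < 2 ^ K.+1) (lambda n)^-1 =
    \sum_(2 ^ J <= n < 2 ^ K) (lambda n)^-1 +
    \sum_(2 ^ K <= n < 2 ^ K.+1) (lambda n)^-1.
  by apply: big_cat_nat; rewrite leq_exp2l.
rewrite mulrDr lerD// expnS natrM -mulrA ler_wpM2l//.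
rewrite [X in (X <= _)%R]mulrC mulr_natr -[X in _ *+ X](_ : 2 * 2 ^ K - 2 ^ K = _)%N; last first.
  by rewrite mul2n -addnn addnK.
rewrite -sumr_const_nat; apply: ler_sum_nat => n /andP[Kn nK].
have n0 : 0 < lambda n by rewrite lambda_gt0// (leq_trans _ Kn)// expn_gt0.
by rewrite -expnS lef_pV2 ?posrE ?l2_gt0// lambda_le// ltnW// expnS.
Qed.

Lemma weight_tail (e : R) : 0 < e ->
  exists J0, (forall j, (J0 <= j)%N -> width j <= 1) /\
    forall K, \sum_(J0 <= j < K) weight j <= e.
Proof.
move=> e0.
have e1 : 0 < e / 1024 by lra.
have [N1 hN1] := muntz_tail e1.
have [N2 hN2] := lambda_large 64.
have e2 : 0 < e / 36 by lra.
have q1 : `|2^-1 : R| < 1 by rewrite ger0_norm; lra.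
have /cvgrPdist_le/(_ _ e2)[N3 _ hN3] := cvg_expr q1.
pose J := (maxn N1 (maxn N2 N3)).+1.
have JN n : (n <= maxn N1 (maxn N2 N3))%N -> (n <= 2 ^ J.-1)%N.
  by move=> h; rewrite (leq_trans h)//= ltnW// ltn_expl.
exists J; split=> [j Jj|K].
  have l64 : 64 <= lambda (2 ^ j)%N.
    apply: hN2; apply: leq_trans (_ : 2 ^ J.-1 <= _)%N.
      by apply: JN; rewrite !leq_max leqnn orbT.
    by rewrite leq_exp2l// (leq_trans (leq_pred _)).
  have : 32 / lambda (2 ^ j)%N <= 2^-1.
    by rewrite ler_pdivrMr ?l2_gt0//; lra.
  have : 4^-1 ^+ j <= 4^-1 ^+ 1 :> R.
    by apply: ler_wiXn2l; [lra|lra|exact: leq_trans Jj].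
  rewrite expr1 /width; lra.
have [KJ|JK] := leqP K J; first by rewrite big_geq// ltW.
rewrite /weight big_split /= [e]splitr; apply: lerD.
  under eq_bigr do rewrite -mulrA.
  rewrite -mulr_sumr (_ : e / 2 = 256 * (e / 512)); last lra.
  rewrite ler_wpM2l ?ler0n//.
  case: K JK => [//|K JK]; rewrite big_add1 /=.
  apply: le_trans (condensation _ _) _.
  apply: (@le_trans _ _ (2 * (e / 1024))); last lra.
  rewrite ler_wpM2l// (le_trans _ (hN1 (2 ^ K)%N))//.
  have NJ : (N1 <= 2 ^ J.-1)%N by apply: JN; rewrite leq_max leqnn.
  have JK' : (2 ^ J.-1 <= 2 ^ K)%N by rewrite leq_exp2l// -ltnS ltnW.
  rewrite [leRHS](big_cat_nat NJ JK')/=.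
  by rewrite lerDr sumr_ge0// => i _; rewrite invr_ge0.
rewrite -mulr_sumr.
have geo : \sum_(J <= j < K) 2^-1 ^+ j = 2 * (2^-1 ^+ J - 2^-1 ^+ K) :> R.
  elim: K JK => [//|K IH]; rewrite ltnS leq_eqVlt => /predU1P[<-|/[dup] JK /IH {}IH].
    by rewrite big_nat1 [2^-1 ^+ J.+1]exprS; field.
  by rewrite big_nat_recr ?(ltnW JK)//= IH [2^-1 ^+ K.+1]exprS; field.
rewrite geo.
have K0 : 0 <= 2^-1 ^+ K :> R by rewrite exprn_ge0.
have : 2^-1 ^+ J <= e / 36 :> R.
  have : (N3 <= J)%N by rewrite leqW// !leq_max leqnn !orbT.
  by move=> /hN3 /=; rewrite sub0r normrN => /(le_trans (ler_norm _)).
lra.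
Qed.

Lemma supported_tail_block J s : supported (tail_exponents (2 ^ J)) s ->
  exists K, supported (block_exponents J K) s.
Proof.
elim: s => [|a s IH] sF; first by exists 0%N.
have [|K hK] := IH; first by move=> c cs; apply: sF; rewrite in_cons cs orbT.
have [n /= Jn na] := sF a (mem_head _ _).
have [L nL] : exists L, (n < 2 ^ L)%N by exists n; exact: ltn_expl.
exists (maxn K L) => c; rewrite in_cons => /predU1P[->|/hK[m /= /andP[Jm mK] <-]].
  by exists n => //=; rewrite Jn (leq_trans nL)// leq_exp2l// leq_maxr.
by exists m => //=; rewrite Jm (leq_trans mK)// leq_exp2l// leq_maxl.
Qed.

(** Far in the sequence, the Müntz condition makes both the constant and the
    dilation factor as good as desired. *)
Theorem tail_primitive_bound (e : R) : 0 < e ->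
  exists n0, primitive_bound (tail_exponents n0) e (1 + e).
Proof.
move=> e0.
pose B := Num.min 2 (1 + e).
have B1 : 1 < B by rewrite /B lt_min; apply/andP; split; lra.
have B2 : B <= 2 by rewrite /B ge_min lexx.
have Be : B <= 1 + e by rewrite /B ge_min lexx orbT.
have lnB : 0 < ln B by rewrite ln_gt0.
have [J [wJ sJ]] := weight_tail lnB.
exists (2 ^ J)%N => s x W sF x0 osc.
have [K sK] := supported_tail_block sF.
have EB : expR (\sum_(J <= j < K) weight j) <= B.
  by rewrite -[B]lnK ?posrE ?ler_expR//; lra.
have E1 : 1 <= expR (\sum_(J <= j < K) weight j).
  by rewrite expR_ge1// sumr_ge0.
have H := block_primitive_bound wJ (le_trans EB B2).
suff : primitive_bound (block_exponents J K) e (1 + e) by apply.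
apply: primitive_bound_mono H => //; lra.
Qed.

(** The finitely many exponents that precede a good tail form one more block.  Its
    constant may be large, but its dilation factor can be taken close to 1. *)
Theorem all_primitive_bound (B : R) : 1 < B ->
  exists2 k, 0 <= k & primitive_bound (tail_exponents 0) k B.
Proof.
move=> B1; pose B0 := expR (ln B / 2).
have lnB : 0 < ln B by rewrite ln_gt0.
have B01 : 1 < B0 by rewrite expR_gt1 divr_gt0.
have e0 : 0 < B0 - 1 by rewrite subr_gt0.
have [n0 hn0] := tail_primitive_bound e0.
rewrite (_ : 1 + (B0 - 1) = B0) in hn0; last ring.
pose ls := [seq lambda n | n <- iota 0 n0].
pose b := expR (ln B / 2 / n0.+1%:R).
have b1 : 1 < b by rewrite expR_gt1 !divr_gt0.
have ls0 l : l \in ls -> 0 <= l by move=> /mapP[n _ ->].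
have [rho rho0 hrho] : exists2 rho, 0 < rho &
    forall l, l \in ls -> 0 < mean_mult b l /\ (mean_mult b l)^-1 <= rho.
  elim: ls ls0 => [|l ls IH] ls0; first by exists 1.
  have [|rho rho0 hrho] := IH; first by move=> m mls; apply: ls0; rewrite in_cons mls orbT.
  have v0 : 0 < mean_mult b l by apply: mean_mult_gt0 => //; apply: ls0; rewrite mem_head.
  have iv0 : 0 < (mean_mult b l)^-1 by rewrite invr_gt0.
  exists (rho + (mean_mult b l)^-1); first by rewrite addr_gt0.
  move=> m; rewrite in_cons => /predU1P[->|/hrho[? ?]]; first by split=> //; lra.
  by split=> //; lra.
have tail0 n : tail_exponents n `<=` [set l | 0 <= l] by move=> _ [m _ <-] /=.
have sls : size ls = n0 by rewrite size_map size_iota.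
have := primitive_boundU (M := n0) (tail0 _) ls0 b1 rho0 hrho _ (ltW e0) (ltW B01) hn0.
rewrite sls leqnn => /(_ isT) /=.
set d := _ / _.
have d0 : 0 <= d.
  rewrite /d; apply: divr_ge0; last by rewrite subr_ge0 ltW.
  by apply: mulr_ge0; apply: exprn_ge0; rewrite ?addr_ge0 ?invr_ge0 ?mulr_ge0 ?(ltW rho0).
clearbody d => H; exists (d + (B0 - 1) * (1 + (B0 - 1) * d)).
  apply: addr_ge0 => //; apply: mulr_ge0 (ltW e0) _.
  by apply: addr_ge0 => //; apply: mulr_ge0 (ltW e0) d0.
apply: primitive_bound_mono H => //.
- move=> _ [n _ <-]; have [nn|nn] := leqP n0 n; [left; exists n => //|right].
  by rewrite /= map_f// mem_iota.
- by rewrite -[leLHS]mul1r ler_pM ?(ltW B01)// exprn_ege1// ltW.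
- rewrite /b /B0 -expRM_natl -expRD -[leRHS]lnK ?posrE; last lra.
  rewrite ler_expR [leRHS]splitr lerD2l mulrCA ler_piMr ?divr_ge0 ?(ltW lnB)//.
  by rewrite ler_pdivrMr// mul1r ler_nat.
Qed.

End Tail.

(** * Behaviour near 0 and the pointwise bound *)

Section Decay.
Context {R : realType}.
Implicit Types (s : seq (R * R)) (F : set R).

Lemma continuous_muntz_eval s (x : R) : 0 < x -> {for x, continuous (muntz_eval s)}.
Proof.
move=> x0; elim: s => [|a s IH].
  have -> : muntz_eval [::] = cst 0 :> (R -> R).
    by apply/funext => y; rewrite /muntz_eval big_nil.
  exact: cvg_cst.
have -> : muntz_eval (a :: s) = (fun y => a.1 * y `^ a.2) \+ muntz_eval s.
  by apply/funext => y; rewrite /muntz_eval big_cons.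
apply: continuousD => //; apply: continuousM; first exact: cvg_cst.
apply: differentiable_continuous; apply/derivable1_diffP.
by apply: derivable_powR; rewrite in_itv/= andbT.
Qed.

Lemma primitive_bound_sup F (e : R) s (x S : R) :
  F `<=` [set l | 0 <= l] -> 0 <= e -> primitive_bound F e (1 + e) ->
  supported F s -> 0 < x ->
  (forall y, x <= y <= (1 + e) * x -> `|muntz_eval s y| <= S) ->
  `|muntz_eval s x| <= e * e * S.
Proof.
move=> F0 e0 H sF x0 hS.
have s0 := supported_sub F0 sF.
have inc y z : x <= y -> y <= z -> z <= (1 + e) * x ->
    `|muntz_prim s z - muntz_prim s y| <= S * (e * x).
  move=> xy yz zB.
  apply: le_trans (muntz_prim_increment s0 (lt_le_trans x0 xy) yz (S := S) _) _.
    by move=> t /andP[yt tz]; apply: hS; rewrite (le_trans xy)//= (le_trans tz).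
  have S0 : 0 <= S.
    apply: le_trans (normr_ge0 _) (hS x _); rewrite lexx/=.
    by rewrite ler_peMl ?(ltW x0)// lerDl.
  by rewrite ler_wpM2l//; lra.
have -> : e * e * S = e * (S * (e * x) / x) by field; rewrite gt_eqF.
apply: H => // y z /andP[xy yB] /andP[xz zB].
by have [yz|/ltW zy] := leP y z; [rewrite distrC|]; exact: inc.
Qed.

(** [primitive_bound] degenerates at 0.  This is the form in which boundedness
    near 0 is transferred from a tail to the whole sequence: values on (0, a] are
    bounded by values on [a, a'], with a rate of decay at 0. *)
Definition decay_bound F (C g a a' : R) := forall s S, supported F s ->
  (forall y, a <= y <= a' -> `|muntz_eval s y| <= S) ->
  forall x, 0 < x -> x <= a -> `|muntz_eval s x| <= C * x `^ g * S.

Lemma decay_bound_sub F F' (C g a a' : R) : F' `<=` F ->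
  decay_bound F C g a a' -> decay_bound F' C g a a'.
Proof. by move=> FF H s S sF; apply: H; exact: supported_sub sF. Qed.

Lemma powR_mono (g x y : R) : 0 <= g -> 0 <= x -> x <= y -> x `^ g <= y `^ g.
Proof. by move=> g0 x0 xy; rewrite ge0_ler_powR ?nnegrE// (le_trans x0). Qed.

(** A property is propagated from [a, a'] to (0, a'] by repeated dilation. *)
Lemma dilation_ind (P : R -> Prop) (b a a' : R) : 1 < b -> 0 < a ->
  b * a <= a' ->
  (forall x, a <= x <= a' -> P x) ->
  (forall x : R, 0 < x -> x < a -> P (b * x) -> P x) ->
  forall x : R, 0 < x -> x <= a' -> P x.
Proof.
move=> b1 a0 baa' base step x x0 xa'.
have [n hn] : exists n, a <= b ^+ n * x.
  have lb : 0 < ln b by rewrite ln_gt0.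
  set m := (Num.truncn (ln (a / x) / ln b)).+1; exists m.
  rewrite -ler_pdivrMr// -[leLHS]lnK ?posrE ?divr_gt0//.
  have -> : b ^+ m = expR (m%:R * ln b).
    by rewrite expRM_natl lnK// posrE (lt_trans _ b1).
  by rewrite ler_expR -ler_pdivrMr// ltW// truncnS_gt.
elim: n => [|n IH] in x x0 xa' hn *.
  by apply: base; rewrite xa' andbT; rewrite expr0 mul1r in hn.
have [ax|xa] := leP a x; first by apply: base; rewrite ax.
apply: step => //; apply: IH.
- by rewrite mulr_gt0// (lt_trans _ b1).
- by rewrite (le_trans _ baa')// ler_pM2l ?(lt_trans _ b1)// ltW.
- by rewrite mulrA -exprSr.
Qed.

(** The function [p x - b `^ (- mu) * p (b * x)] has lost the exponent [mu], hence
    decays like the functions supported in [F]. *)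
Lemma dilation_difference F (C g a a1 a' mu S : R) s :
  0 < a -> a <= a1 -> a1 < a' -> 0 <= mu ->
  decay_bound F C g a a1 -> supported (mu |` F) s ->
  (forall y, a <= y <= a' -> `|muntz_eval s y| <= S) ->
  let b := a' / a1 in
  forall x, 0 < x -> x <= a ->
  `|muntz_eval s x| <= b `^ (- mu) * `|muntz_eval s (b * x)| + 2 * C * x `^ g * S.
Proof.
move=> a0 aa1 a1a' mu0 H sF hS b x x0 xa.
have a10 : 0 < a1 by exact: lt_le_trans aa1.
have b1 : 1 < b by rewrite ltr_pdivlMr// mul1r.
have b0 : 0 < b by exact: lt_trans b1.
pose w l := b `^ (l - mu).
pose r := multiplier (fun l => 1 - w l) [seq c <- s | 1 - w c.2 != 0].
have rE y : 0 < y -> muntz_eval r y = muntz_eval s y - b `^ (- mu) * muntz_eval s (b * y).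
  move=> y0; rewrite /r (muntz_eval_multiplier_filter (fun l => 1 - w l)).
  rewrite muntz_eval_sub_multiplier; congr (_ - _).
  rewrite muntz_eval_multiplier /muntz_eval mulr_sumr; apply: eq_bigr => c _.
  rewrite powRM ?ltW// /w powRD ?(gt_eqF b0) ?implybT//; ring.
have rF : supported F r.
  move=> _ /mapP[c + ->] /=; rewrite mem_filter => /andP[wc /sF[cmu|//]].
  by move: wc; rewrite /w cmu subrr powRr0 subrr eqxx.
have bmu : b `^ (- mu) <= 1.
  by rewrite -(powRr0 b) ler_powR ?(ltW b1)// oppr_le0.
have rS y : a <= y <= a1 -> `|muntz_eval r y| <= 2 * S.
  move=> /andP[ay ya1]; have y0 := lt_le_trans a0 ay.
  rewrite rE// (le_trans (ler_normB _ _))// mulrDl mul1r lerD//.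
    by rewrite hS// ay (le_trans ya1)// ltW.
  rewrite normrM ger0_norm ?powR_ge0// -[leRHS]mul1r ler_pM ?powR_ge0//.
  rewrite hS//; apply/andP; split.
    by rewrite (le_trans ay)// ler_peMl ?ltW.
  by rewrite /b mulrAC ler_pdivrMr// ler_pM2l// (lt_trans a10).
have := H r _ rF rS x x0 xa; rewrite rE// => h.
rewrite -[muntz_eval s x](subrK (b `^ (- mu) * muntz_eval s (b * x))).
rewrite (le_trans (ler_normD _ _))// addrC lerD//.
  by rewrite normrM ger0_norm ?powR_ge0.
by apply: le_trans h _; rewrite le_eqVlt; apply/orP; left; apply/eqP; ring.
Qed.

(** Iterating [dilation_difference] is a contraction for the weight [x `^ (- g)]
    because [b `^ (g - mu) < 1]. *)
Lemma decay_boundU_gt F (C g a a1 a' mu : R) :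
  0 < a -> a <= a1 -> a1 < a' -> 0 <= g -> g < mu -> 0 <= C ->
  decay_bound F C g a a1 ->
  exists2 C', 0 <= C' & decay_bound (mu |` F) C' g a a'.
Proof.
move=> a0 aa1 a1a' g0 gmu C0 H.
have a10 : 0 < a1 by exact: lt_le_trans aa1.
pose b := a' / a1; pose q := b `^ (g - mu).
have b1 : 1 < b by rewrite ltr_pdivlMr// mul1r.
have b0 : 0 < b by exact: lt_trans b1.
have q1 : 0 < 1 - q.
  rewrite subr_gt0 -(powRr0 b) /q /powR gt_eqF// ltr_expR mul0r.
  by rewrite pmulr_llt0 ?ln_gt0// subr_lt0.
pose D := a `^ (- g) + 2 * C / (1 - q).
have D0 : 0 <= D by rewrite addr_ge0 ?powR_ge0// divr_ge0 ?mulr_ge0// ltW.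
exists D => // s S sF hS x x0 xa.
have S0 : 0 <= S.
  by apply: le_trans (normr_ge0 _) (hS a _); rewrite lexx (le_trans aa1)// ltW.
have baa' : b * a <= a'.
  by rewrite /b mulrAC ler_pdivrMr// ler_pM2l// (lt_trans a10).
have xa' : x <= a' by rewrite (le_trans xa)// (le_trans aa1)// ltW.
move: x x0 xa' {xa}; apply: (@dilation_ind _ b a a') => //.
  move=> x /andP[ax xa']; apply: (@le_trans _ _ (1 * S)).
    by rewrite mul1r hS// ax.
  rewrite ler_wpM2r//; apply: (@le_trans _ _ (a `^ (- g) * x `^ g)).
    rewrite -[leLHS](powRr0 a) -(addNr g) powRD ?(gt_eqF a0) ?implybT//.
    by rewrite ler_wpM2l ?powR_ge0// powR_mono// ltW.
  by rewrite ler_wpM2r ?powR_ge0// lerDl divr_ge0 ?mulr_ge0// ltW.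
move=> x x0 xa IH.
apply: le_trans (dilation_difference a0 aa1 a1a' _ H sF hS x0 (ltW xa)) _.
  by rewrite (le_trans g0)// ltW.
rewrite -/b; apply: (@le_trans _ _ (b `^ (- mu) * (D * (b * x) `^ g * S) + 2 * C * x `^ g * S)).
  by rewrite lerD2r ler_wpM2l ?powR_ge0.
have -> : b `^ (- mu) * (D * (b * x) `^ g * S) = q * D * x `^ g * S.
  by rewrite powRM ?ltW// /q powRD ?(gt_eqF b0) ?implybT//; ring.
rewrite -!mulrDl ler_wpM2r// ler_wpM2r ?powR_ge0//.
have : D * (1 - q) = a `^ (- g) * (1 - q) + 2 * C by rewrite /D; field; rewrite gt_eqF.
have : 0 <= a `^ (- g) * (1 - q) by rewrite mulr_ge0 ?powR_ge0// ltW.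
lra.
Qed.

(** Here the added exponent decays more slowly than the others.  The differences
    sum up geometrically, and a bound of the form [(D - K x^(g - mu)) x^mu] is
    stable under the recursion. *)
Lemma decay_boundU_lt F (C g a a1 a' mu : R) :
  0 < a -> a <= a1 -> a1 < a' -> 0 <= mu -> mu < g -> 0 <= C ->
  decay_bound F C g a a1 ->
  exists2 C', 0 <= C' & decay_bound (mu |` F) C' mu a a'.
Proof.
move=> a0 aa1 a1a' mu0 mug C0 H.
have a10 : 0 < a1 by exact: lt_le_trans aa1.
pose b := a' / a1; pose q := b `^ (g - mu).
have b1 : 1 < b by rewrite ltr_pdivlMr// mul1r.
have b0 : 0 < b by exact: lt_trans b1.
have q1 : 0 < q - 1.
  rewrite subr_gt0 -[ltLHS](powRr0 b) /q /powR gt_eqF// ltr_expR mul0r.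
  by rewrite pmulr_lgt0 ?ln_gt0// subr_gt0.
have a'0 : 0 < a' by exact: lt_trans a1a'.
pose K := 2 * C / (q - 1).
have K0 : 0 <= K by rewrite divr_ge0 ?mulr_ge0// ltW.
pose D := a `^ (- mu) + K * a' `^ (g - mu).
have D0 : 0 <= D := addr_ge0 (powR_ge0 _ _) (mulr_ge0 K0 (powR_ge0 _ _)).
exists D => // s S sF hS x x0 xa.
have S0 : 0 <= S.
  by apply: le_trans (normr_ge0 _) (hS a _); rewrite lexx (le_trans aa1)// ltW.
have baa' : b * a <= a'.
  by rewrite /b mulrAC ler_pdivrMr// ler_pM2l.
suff : `|muntz_eval s x| <= (D - K * x `^ (g - mu)) * x `^ mu * S.
  move=> /le_trans; apply; rewrite ler_wpM2r// ler_wpM2r ?powR_ge0//.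
  by rewrite gerBl; exact: mulr_ge0 K0 (powR_ge0 _ _).
have xa' : x <= a' by rewrite (le_trans xa)// (le_trans aa1)// ltW.
move: x x0 xa' {xa}; apply: (@dilation_ind _ b a a') => //.
  move=> x /andP[ax xa']; apply: (@le_trans _ _ (1 * S)).
    by rewrite mul1r hS// ax.
  have x0 : 0 < x by exact: lt_le_trans ax.
  rewrite ler_wpM2r//; apply: (@le_trans _ _ (a `^ (- mu) * x `^ mu)).
    rewrite -[leLHS](powRr0 a) -(addNr mu) powRD ?(gt_eqF a0) ?implybT//.
    by rewrite ler_wpM2l ?powR_ge0// powR_mono// ltW.
  rewrite ler_wpM2r ?powR_ge0// /D -addrA lerDl subr_ge0 ler_wpM2l//.
  by rewrite powR_mono ?subr_ge0 ?(ltW mug) ?(ltW x0).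
move=> x x0 xa IH.
apply: le_trans (dilation_difference a0 aa1 a1a' mu0 H sF hS x0 (ltW xa)) _.
rewrite -/b; apply: (@le_trans _ _ (b `^ (- mu) *
   ((D - K * (b * x) `^ (g - mu)) * (b * x) `^ mu * S) + 2 * C * x `^ g * S)).
  by rewrite lerD2r ler_wpM2l ?powR_ge0.
have bb : b `^ (- mu) * b `^ mu = 1.
  by rewrite powRN mulVf// gt_eqF// powR_gt0.
rewrite !(powRM _ (ltW b0) (ltW x0)) -/q.
have -> : x `^ g = x `^ (g - mu) * x `^ mu.
  by rewrite -powRD ?subrK// (gt_eqF x0) implybT.
set X := x `^ (g - mu); set Y := x `^ mu.
have -> : b `^ (- mu) * ((D - K * (q * X)) * (b `^ mu * Y) * S) =
          (b `^ (- mu) * b `^ mu) * ((D - K * (q * X)) * Y * S) by ring.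
rewrite bb mul1r.
have KC : 2 * C = K * (q - 1) by rewrite /K; field; rewrite gt_eqF.
by rewrite KC le_eqVlt; apply/orP; left; apply/eqP; ring.
Qed.

End Decay.

Section PointwiseBound.
Context {R : realType} (lambda : nat -> R).
Hypothesis lambda_ge0 : forall n, 0 <= lambda n.
Hypothesis lambda_incr : forall m n, (m < n)%N -> lambda m < lambda n.
Hypothesis muntz_condition :
  (\sum_(0 <= n <oo | lambda n != 0%R) ((lambda n)^-1)%:E < +oo)%E.

Let tail_ge0 n : tail_exponents lambda n `<=` [set l | 0 <= l].
Proof. by move=> _ [m _ <-] /=. Qed.

(** A maximum principle: for a tail with a small constant, the maximum of
    [|p x| x `^ (- g)] over an interval that ends slightly to the right of [a]
    cannot be attained to the left of [a], since the value at [x] is much smaller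
    than the maximum over [x, (1 + e) x]. *)
Lemma tail_decay_bound (g a a' : R) : 0 <= g -> 0 < a -> a < a' ->
  exists n0, decay_bound (tail_exponents lambda n0) (a `^ (- g)) g a a'.
Proof.
move=> g0 a0 aa'.
pose e := Num.min (Num.min 1 (a' / a - 1)) (2 `^ (- g) / 2).
have e0 : 0 < e.
  by rewrite !lt_min ltr01 subr_gt0 ltr_pdivlMr// mul1r aa' divr_gt0// powR_gt0.
have e1 : e <= 1 by rewrite /e !ge_min lexx.
have ea : (1 + e) * a <= a'.
  rewrite -ler_pdivlMr// -lerBrDl.
  by rewrite /e !ge_min lexx orbT.
have eg : e * e * (1 + e) `^ g <= 2^-1.
  apply: (@le_trans _ _ (1 * (2 `^ (- g) / 2) * 2 `^ g)).
    apply: ler_pM; rewrite ?mulr_ge0 ?powR_ge0 ?(ltW e0)//.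
      by rewrite ler_pM ?(ltW e0)// /e ge_min lexx orbT.
    by rewrite powR_mono//; lra.
  by rewrite mul1r mulrAC powRN mulVf ?mul1r// gt_eqF// powR_gt0.
have [n0 hn0] := tail_primitive_bound lambda_ge0 lambda_incr muntz_condition e0.
exists n0 => s S sF hS x x0 xa.
pose h y := `|muntz_eval s y| * y `^ (- g).
have xB : x <= (1 + e) * a by rewrite (le_trans xa)// ler_peMl ?(ltW a0)//; lra.
have [|z + hz] := @EVT_max R h x ((1 + e) * a) xB.
  apply: continuous_in_subspaceT => y; rewrite inE/= in_itv/= => /andP[xy _].
  have y0 := lt_le_trans x0 xy.
  apply: (@continuousM _ _ (fun y => `|muntz_eval s y|) (fun y => y `^ (- g))).
    by apply: continuous_comp; [exact: continuous_muntz_eval|exact: norm_continuous].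
  apply: differentiable_continuous; apply/derivable1_diffP.
  by apply: derivable_powR; rewrite in_itv/= andbT.
rewrite in_itv/= => /andP[xz zB].
have z0 := lt_le_trans x0 xz.
have evh y : 0 < y -> `|muntz_eval s y| = h y * y `^ g.
  by move=> y0; rewrite /h -mulrA powRN mulVf ?mulr1// gt_eqF// powR_gt0.
have hxz : h x <= h z by apply: hz; rewrite in_itv/= lexx.
rewrite evh// [leRHS]mulrAC ler_wpM2r ?powR_ge0// (le_trans hxz)//.
have S0 : 0 <= S.
  by apply: le_trans (normr_ge0 _) (hS a _); rewrite lexx ltW.
have [az|za] := leP a z.
  rewrite /h mulrC; apply: ler_pM; rewrite ?powR_ge0//; last first.
    by rewrite hS// az (le_trans zB).
  rewrite !powRN lef_pV2 ?posrE ?powR_gt0//.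
  by rewrite powR_mono// ltW.
have := primitive_bound_sup (@tail_ge0 n0) (ltW e0) hn0 sF z0
  (S := `|muntz_eval s z| * (1 + e) `^ g).
have hyp y : z <= y <= (1 + e) * z -> `|muntz_eval s y| <= `|muntz_eval s z| * (1 + e) `^ g.
  move=> /andP[zy yz]; have y0 := lt_le_trans z0 zy.
  rewrite evh// (evh z)// -mulrA -powRM ?(ltW z0)//; last lra.
  have h0 : 0 <= h y by rewrite /h mulr_ge0 ?powR_ge0.
  apply: ler_pM h0 (powR_ge0 _ _) _ _.
    apply: hz; rewrite in_itv/= (le_trans xz zy)/= (le_trans yz)//.
    by rewrite ler_pM2l ?ltW//; lra.
  by rewrite [z * _]mulrC powR_mono// ltW.
move=> /(_ hyp) hz2; suff -> : h z = 0 by rewrite mulr_ge0 ?powR_ge0.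
have : `|muntz_eval s z| <= 2^-1 * `|muntz_eval s z|.
  apply: le_trans hz2 _; rewrite mulrCA mulrC ler_wpM2r//.
have := normr_ge0 (muntz_eval s z) => ev0 evle.
have : `|muntz_eval s z| = 0 by lra.
by rewrite /h => ->; rewrite mul0r.
Qed.

Lemma tail_decay_down (g a a0 : R) m :
  0 <= g -> 0 < a -> a < a0 -> (forall n, (0 < n)%N -> g < lambda n) ->
  (forall a', a0 < a' -> exists2 C, 0 <= C &
     decay_bound (tail_exponents lambda m.+1) C g a a') ->
  forall a', a0 < a' -> exists2 C, 0 <= C &
    decay_bound (tail_exponents lambda 1) C g a a'.
Proof.
move=> g0 a_gt0 aa0 gl; elim: m => [//|m IH] H; apply: IH => a' a0a'.
pose a1 := (a0 + a') / 2.
have [a0a1 a1a'] : a0 < a1 /\ a1 < a' by rewrite /a1; split; lra.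
have [C C0 hC] := H _ a0a1.
have [||C' C'0 hC'] := decay_boundU_gt (mu := lambda m.+1) a_gt0 _ a1a' g0 _ C0 hC.
- by rewrite ltW// (lt_trans aa0).
- exact: gl.
exists C' => //; apply: decay_bound_sub hC' => _ [n /= + <-].
rewrite leq_eqVlt => /predU1P[<-|mn]; first by left.
by right; exists n.
Qed.

(** All exponents but the first are added to a tail with the rate [g] kept; [g] is
    chosen strictly between the first two exponents so that neither step meets the
    resonant case [mu = g]. *)
Lemma all_decay_bound (a a' : R) : 0 < a -> a < a' ->
  exists2 C, 0 <= C & decay_bound (tail_exponents lambda 0) C (lambda 0) a a'.
Proof.
move=> a_gt0 aa'; pose g := (lambda 0 + lambda 1) / 2.
have l01 := lambda_incr (ltnSn 0).
have [g0 l0g gl1] : [/\ 0 <= g, lambda 0 < g & g < lambda 1].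
  by have := lambda_ge0 0; rewrite /g; split; lra.
have gl n : (0 < n)%N -> g < lambda n.
  by move=> n0; exact: lt_le_trans gl1 (lambda_le lambda_incr n0).
(* each added exponent needs a little more room on the right *)
pose a0 := (2 * a + a') / 3; pose a1 := (a0 + a') / 2.
have [aa0 a0a1 a1a'] : [/\ a < a0, a0 < a1 & a1 < a'].
  by rewrite /a1 /a0; split; lra.
have [n0 hn0] := tail_decay_bound g0 a_gt0 aa0.
have [|C C0 hC] := @tail_decay_down g a a0 n0 g0 a_gt0 aa0 gl _ _ a0a1.
  move=> b a0b; exists (a `^ (- g)); first exact: powR_ge0.
  move=> s S sF hS; apply: hn0.
    by apply: supported_sub sF => _ [n /= /ltnW n0n <-]; exists n.
  by move=> y /andP[ay ya0]; rewrite hS// ay (le_trans ya0)// ltW.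
have [|C' C'0 hC'] := decay_boundU_lt a_gt0 _ a1a' (lambda_ge0 0) l0g C0 hC.
  by rewrite ltW// (lt_trans aa0).
exists C' => //; apply: decay_bound_sub hC' => _ [[|n] /= _ <-]; first by left.
by right; exists n.+1.
Qed.

(** A bound by the primitive rather than by the L1 norm: it also controls
    the topology of pointwise convergence of primitives, which is what compactness
    arguments need. *)
Theorem muntz_pointwise_bound (c c' : R) : 0 < c -> c < c' ->
  exists2 N, 0 <= N & forall s W, supported (range lambda) s ->
    (forall y, 0 < y <= c' -> `|muntz_prim s y| <= W) ->
    forall x, 0 < x <= c -> `|muntz_eval s x| <= N * W.
Proof.
move=> c0 cc'; pose a := (c + c') / 2.
have [ca ac'] : c < a /\ a < c' by rewrite /a; split; lra.
have a0 : 0 < a by exact: lt_trans ca.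
have [C C0 hC] := all_decay_bound c0 ca.
have B1 : 1 < c' / a by rewrite ltr_pdivlMr// mul1r.
have [k k0 hk] := all_primitive_bound lambda_ge0 lambda_incr muntz_condition B1.
exists (C * c `^ lambda 0 * (k * (2 / c))).
  by rewrite !mulr_ge0 ?powR_ge0 ?invr_ge0 ?(ltW c0)//.
move=> s W sF hW x /andP[x0 xc].
have {}sF : supported (tail_exponents lambda 0) s.
  by apply: supported_sub sF => _ [n _ <-]; exists n.
have W0 : 0 <= W.
  by apply: le_trans (normr_ge0 _) (hW c' _); rewrite lexx (lt_trans c0).
have hS y : c <= y <= a -> `|muntz_eval s y| <= k * (2 / c) * W.
  move=> /andP[cy ya]; have y0 := lt_le_trans c0 cy.
  apply: le_trans (hk s y (2 * W) sF y0 _) _.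
    have bnd u : y <= u <= c' / a * y -> `|muntz_prim s u| <= W.
      move=> /andP[yu uB]; rewrite hW// (lt_le_trans y0)//= (le_trans uB)//.
      by rewrite mulrAC ler_pdivrMr// ler_pM2l// (lt_trans c0).
    by move=> u v /bnd ? /bnd ?; rewrite (le_trans (ler_normB _ _))// mulrDl mul1r lerD.
  rewrite -mulrA ler_wpM2l// mulrAC ler_wpM2r// ler_wpM2l// lef_pV2//.
apply: le_trans (hC s _ sF hS x x0 xc) _.
rewrite -!mulrA ler_wpM2l// ler_wpM2r ?mulr_ge0 ?invr_ge0 ?(ltW c0)//.
by rewrite powR_mono ?(ltW x0)// lambda_ge0.
Qed.

End PointwiseBound.

(** * Primitives of integrable functions on the unit interval *)

Section LebesgueOnUnitInterval.
Context {R : realType}.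
Notation leb := (@lebesgue_measure R).
Notation I01 := (`[0%R, 1%R]%classic : set R).
Implicit Types (f g : R -> R).

Lemma ae_mu01P (P : set R) :
  (\forall x \ae mu01 R, P x) <-> leb.-negligible (I01 `\` P).
Proof.
split=> [[A [mA A0 PA]]|[A [mA A0 PA]]].
  exists (A `&` I01); split=> //; first exact: measurableI.
  by move=> x [x01 Px]; split=> //; apply: PA.
exists (A `|` ~` I01); split.
- by apply: measurableU => //; apply: measurableC.
- rewrite /= /mrestr setIUl setICl setU0; apply/eqP; rewrite -measure_le0.
  rewrite (le_trans (le_measure leb _ _ (@subIsetl _ A I01))) ?inE//.
    exact: measurableI.
  by move/eqP: A0; rewrite eq_le => /andP[].
- by move=> x Px; have [x01|x01] := pselect (I01 x); [left; apply: PA|right].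
Qed.

Lemma ae_eq_on01 f g D : D `<=` I01 -> f = g %[ae mu01 R] ->
  ae_eq leb D (EFin \o f) (EFin \o g).
Proof.
move=> D01 /ae_mu01P; apply: negligibleS => x /= /not_implyP[Dx fgx].
split; first exact: D01.
by move=> /(_ I) fg; apply: fgx; rewrite fg.
Qed.

Lemma ae_eq_Rintegral f g D : measurable D -> D `<=` I01 ->
  measurable_fun D f -> measurable_fun D g -> f = g %[ae mu01 R] ->
  \int[leb]_(x in D) f x = \int[leb]_(x in D) g x.
Proof.
move=> mD D01 mf mg fg; congr fine; apply: ae_eq_integral => //.
- exact/measurable_EFinP.
- exact/measurable_EFinP.
- exact: ae_eq_on01.
Qed.

Lemma ge0_integral_mu01 (h : R -> \bar R) : measurable_fun setT h ->
  (forall x, 0 <= h x)%E ->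
  (\int[mu01 R]_x h x = \int[leb]_(x in I01) h x)%E.
Proof.
move=> mh h0.
rewrite (@ge0_negligible_integral _ _ _ (mu01 R) setT (~` I01))//; last 2 first.
- exact: measurableC.
- by rewrite /= /mrestr setICl measure0.
rewrite setTD setCK; apply: eq_measure_integral => A mA A01.
by rewrite /= /mrestr setIidl.
Qed.

Lemma mu01_integrableP f : measurable_fun setT f ->
  (mu01 R).-integrable setT (EFin \o f) <-> leb.-integrable I01 (EFin \o f).
Proof.
move=> mf; have mEf : measurable_fun setT (EFin \o f) by exact/measurable_EFinP.
have mEa : measurable_fun setT (fun x => `|(f x)%:E|%E) by exact: measurableT_comp.
split=> /integrableP[_ fi]; apply/integrableP; split=> //.
- exact: measurable_funTS.
- by rewrite -ge0_integral_mu01.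
- by rewrite ge0_integral_mu01.
Qed.

Lemma L1_repr_measurable (u : L1 R) : measurable_fun setT (L1_repr u).
Proof. exact: measurable_funP. Qed.

Lemma L1_repr_integrable (u : L1 R) : leb.-integrable I01 (EFin \o L1_repr u).
Proof.
apply/mu01_integrableP; first exact: L1_repr_measurable.
by apply/Lfun1_integrable; exact: LfunP.
Qed.

Lemma L1_normRE (u : L1 R) : `|u| = \int[leb]_(x in I01) `|L1_repr u x|.
Proof.
rewrite [LHS]/(L1_norm u) /L1_norm Lnorm1 ge0_integral_mu01//.
apply: measurableT_comp => //; apply/measurable_EFinP.
exact: L1_repr_measurable.
Qed.

Lemma itv_sub01 (x y : R) b1 b2 : 0 <= x -> y <= 1 ->
  [set` Interval (BSide b1 x) (BSide b2 y)] `<=` I01.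
Proof.
move=> x0 y1 z /=; rewrite !in_itv/= => /andP[xz zy].
rewrite (le_trans x0 (_ : x <= z))/=; last by case: b1 xz => //= /ltW.
by rewrite (le_trans (_ : z <= y) y1)//; case: b2 zy => //= /ltW.
Qed.

Lemma integrable_itv01 f (x y : R) b1 b2 : leb.-integrable I01 (EFin \o f) ->
  0 <= x -> y <= 1 ->
  leb.-integrable [set` Interval (BSide b1 x) (BSide b2 y)] (EFin \o f).
Proof. by move=> fi x0 y1; apply: integrableS fi => //; exact: itv_sub01. Qed.

Definition primitive f (x : R) := \int[leb]_(t in `[0, x]) f t.

(** The three increments use disjoint parts of the mass of [f]; the factor 1/2 in
    the essential norm comes from this. *)
Lemma Rintegral_increments f (x y : R) : leb.-integrable I01 (EFin \o f) ->
  0 <= x -> x <= y -> y <= 1 ->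
  `|primitive f x| + `|primitive f y - primitive f x| +
  `|primitive f 1 - primitive f y| <= \int[leb]_(t in I01) `|f t|.
Proof.
move=> fi x0 xy y1.
have nfi := integrable_norm fi.
pose A z := \int[leb]_(t in `[0, z]) `|f t|.
have incr z t : 0 <= z -> z <= t -> t <= 1 -> `|primitive f t - primitive f z| <= A t - A z.
  move=> z0 zt t1; rewrite /primitive /A.
  rewrite !Rintegral_itvB ?bnd_simp//; try exact: integrable_itv01.
  by apply: le_normr_Rintegral => //; exact: integrable_itv01.
have V0 : `|primitive f x| <= A x.
  by apply: le_normr_Rintegral => //; apply: integrable_itv01 => //; exact: le_trans y1.
have := incr x y x0 xy y1.
have := incr y 1 (le_trans x0 xy) y1 (lexx 1).
rewrite -/(A 1); lra.
Qed.

End LebesgueOnUnitInterval.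

Section MuntzInL1.
Context {R : realType}.
Notation leb := (@lebesgue_measure R).
Implicit Types (s : seq (R * R)) (u v : L1 R).

Lemma powR_cvg_right (l : R) : 0 <= l -> x `^ l @[x --> 0^'+] --> (0 : R) `^ l.
Proof.
rewrite le_eqVlt => /predU1P[<-|l0].
  by rewrite powRr0; under eq_fun do rewrite powRr0; exact: cvg_cst.
by rewrite powR0 ?gt_eqF//; exact: powR_cvg0.
Qed.

Lemma muntz_eval_cvg_right s : supported [set l | 0 <= l] s ->
  muntz_eval s x @[x --> 0^'+] --> muntz_eval s 0.
Proof.
elim: s => [_|a s IH sF].
  rewrite (_ : muntz_eval [::] = cst 0); first exact: cvg_cst.
  by apply/funext => y; rewrite /muntz_eval big_nil.
rewrite (_ : muntz_eval (a :: s) = (fun y => a.1 * y `^ a.2) \+ muntz_eval s); last first.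
  by apply/funext => y; rewrite /muntz_eval big_cons.
apply: cvgD; last by apply: IH => c cs; apply: sF; rewrite in_cons cs orbT.
apply: cvgM; first exact: cvg_cst.
by apply: powR_cvg_right; exact: sF (mem_head _ _).
Qed.

Lemma muntz_eval_continuous s (x : R) : supported [set l | 0 <= l] s -> 0 < x ->
  {within `[0, x], continuous (muntz_eval s)}.
Proof.
move=> sF x0; apply/(continuous_within_itvP _ x0); split.
- by move=> y; rewrite in_itv/= => /andP[y0 _]; exact: continuous_muntz_eval.
- exact: muntz_eval_cvg_right.
- exact/cvg_at_left_filter/continuous_muntz_eval.
Qed.

(** Primitives are Müntz polynomials with shifted exponents, and inherit their
    continuity. *)
Lemma muntz_primE s x :
  muntz_prim s x = muntz_eval [seq (a.1 / (a.2 + 1), a.2 + 1) | a <- s] x.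
Proof. by rewrite /muntz_eval big_map. Qed.

Lemma supported_prim s : supported [set l | 0 <= l] s ->
  supported [set l | 0 <= l] [seq (a.1 / (a.2 + 1), a.2 + 1) | a <- s].
Proof. by move=> sF _ /mapP[a /sF/= a0 ->] /=; rewrite addr_ge0. Qed.

Lemma muntz_prim0 s : supported [set l | 0 <= l] s -> muntz_prim s 0 = 0.
Proof.
move=> sF; rewrite /muntz_prim big_seq big1// => a /sF /= a0.
by rewrite powR0 ?mulr0// gt_eqF//; lra.
Qed.

Lemma muntz_eval_integrable s : supported [set l | 0 <= l] s ->
  leb.-integrable `[0, 1] (EFin \o muntz_eval s).
Proof.
move=> sF; apply: continuous_compact_integrable; first exact: segment_compact.
exact: muntz_eval_continuous.
Qed.

Lemma primitive_muntz_eval s (x : R) : supported [set l | 0 <= l] s -> 0 <= x ->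
  primitive (muntz_eval s) x = muntz_prim s x.
Proof.
move=> sF; rewrite le_eqVlt => /predU1P[<-|x0].
  by rewrite /primitive set_itv1 Rintegral_set1 muntz_prim0.
have dP (y : R) : 0 < y -> is_derive y 1 (muntz_prim s) (muntz_eval s y).
  by move=> y0; exact: is_derive_muntz_prim.
rewrite /primitive /Rintegral (@continuous_FTC2 _ _ (muntz_prim s)) ?muntz_prim0//=.
- by rewrite subr0.
- exact: muntz_eval_continuous.
- have -> : muntz_prim s = muntz_eval [seq (a.1 / (a.2 + 1), a.2 + 1) | a <- s].
    by apply/funext => y; exact: muntz_primE.
  split.
  + move=> y; rewrite in_itv/= => /andP[y0 _].
    have -> : muntz_eval [seq (a.1 / (a.2 + 1), a.2 + 1) | a <- s] = muntz_prim s.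
      by apply/funext => z; rewrite muntz_primE.
    by have [] := dP _ y0.
  + by apply: muntz_eval_cvg_right; exact: supported_prim.
  + exact/cvg_at_left_filter/continuous_muntz_eval.
- move=> y; rewrite in_itv/= => /andP[y0 _].
  by rewrite derive1E; have [_] := dP _ y0.
Qed.

Lemma muntzP (L : set R) p :
  muntz L p <-> exists2 s, supported L s & p = muntz_eval s.
Proof.
have E s : \sum_(a <- s) a.1 *: monomial a.2 = muntz_eval s :> (R -> R).
  apply/funext => x; rewrite /muntz_eval; elim: s => [|a s IH].
    by rewrite !big_nil.
  by rewrite !big_cons -IH.
by split=> -[s sL ->]; exists s => //; rewrite E.
Qed.

Lemma measurable_muntz_eval s : measurable_fun setT (muntz_eval s).
Proof.
elim: s => [|a s IH].
  rewrite (_ : muntz_eval [::] = cst 0)//.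
  by apply/funext => y; rewrite /muntz_eval big_nil.
rewrite (_ : muntz_eval (a :: s) = (fun y => a.1 * y `^ a.2) \+ muntz_eval s); last first.
  by apply/funext => y; rewrite /muntz_eval big_cons.
by apply: measurable_funD => //; apply: measurable_funM => //; exact: measurable_powR.
Qed.

Lemma muntz_eval_L1 s : supported [set l | 0 <= l] s ->
  exists u : L1 R, (L1_repr u : R -> R) = muntz_eval s %[ae mu01 R].
Proof.
move=> sF.
have fP : muntz_eval s \in Lfun (mu01 R) 1.
  apply/Lfun1_integrable/mu01_integrableP; first exact: measurable_muntz_eval.
  exact: muntz_eval_integrable.
exists (\pi_(L1 R)%qT (Lfun_Sub (@lexx _ _ 1%E) fP)).
exact: L1_reprP.
Qed.

Lemma volterraE u f (x : R) : 0 <= x -> x <= 1 -> measurable_fun `[0, x] f ->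
  (L1_repr u : R -> R) = f %[ae mu01 R] -> volterra_fun u x = primitive f x.
Proof.
move=> x0 x1 mf uf; apply: ae_eq_Rintegral => //; first exact: itv_sub01.
apply: measurable_funTS; exact: L1_repr_measurable.
Qed.

Lemma volterra_muntz_eval u s (x : R) : supported [set l | 0 <= l] s ->
  (L1_repr u : R -> R) = muntz_eval s %[ae mu01 R] -> 0 <= x -> x <= 1 ->
  volterra_fun u x = muntz_prim s x.
Proof.
move=> sF us x0 x1; rewrite (volterraE x0 x1 _ us) ?primitive_muntz_eval//.
by apply: measurable_funTS; exact: measurable_muntz_eval.
Qed.

Lemma volterra_lin (a : R) u v (x : R) : 0 <= x -> x <= 1 ->
  volterra_fun (a *: u + v) x = a * volterra_fun u x + volterra_fun v x.
Proof.
move=> x0 x1.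
have iu w : leb.-integrable `[0, x] (EFin \o L1_repr w).
  by apply: integrable_itv01 => //; exact: L1_repr_integrable.
rewrite (@volterraE _ (fun t => a * L1_repr u t + L1_repr v t))//.
- have iau : leb.-integrable `[0, x] (EFin \o (fun t => a * L1_repr u t)).
    by apply: eq_integrable (integrableZl _ a (iu u)).
  by rewrite /primitive RintegralD// RintegralZl.
- apply: measurable_funD; first apply: measurable_funM => //.
    by apply: measurable_funTS; exact: L1_repr_measurable.
  by apply: measurable_funTS; exact: L1_repr_measurable.
- apply: filterS (filterI (L1_reprD (a *: u) v) (L1_reprZ a u)).
  by move=> t [/(_ I) h1 /(_ I) h2] _; rewrite h1 /= h2.
Qed.

Lemma volterraB u v (x : R) : 0 <= x -> x <= 1 ->
  volterra_fun (u - v) x = volterra_fun u x - volterra_fun v x.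
Proof.
move=> x0 x1; have -> : u - v = (-1) *: v + u by rewrite scaleN1r addrC.
by rewrite volterra_lin// mulN1r addrC.
Qed.

Lemma volterra_increments u (x y : R) : 0 <= x -> x <= y -> y <= 1 ->
  `|volterra_fun u x| + `|volterra_fun u y - volterra_fun u x| +
  `|volterra_fun u 1 - volterra_fun u y| <= `|u|.
Proof.
move=> x0 xy y1; rewrite L1_normRE.
exact: (Rintegral_increments (L1_repr_integrable u) x0 xy y1).
Qed.

Lemma volterra_le u (x : R) : 0 <= x -> x <= 1 -> `|volterra_fun u x| <= `|u|.
Proof.
move=> x0 x1; apply: le_trans (volterra_increments u x0 x1 (lexx 1)).
by rewrite -addrA lerDl addr_ge0.
Qed.

Lemma volterra0 u : volterra_fun u 0 = 0.
Proof. by rewrite /volterra_fun set_itv1 Rintegral_set1. Qed.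

End MuntzInL1.

(** * The closure of the Müntz polynomials in L1 *)

Section WithinContinuity.
Context {R : realType}.

Lemma within_continuous_approx (A : set R) (f : R -> R) :
  (forall x, A x -> forall e, 0 < e -> exists h : R -> R,
     {within A, continuous h} /\
     \forall y \near x, A y -> `|f y - h y| <= e) ->
  {within A, continuous f}.
Proof.
move=> H; apply/subspace_continuousP => x Ax; apply/cvgrPdist_le => e e0.
have e3 : 0 < e / 3 by lra.
have [h [/subspace_continuousP/(_ x Ax) hc hf]] := H x Ax _ e3.
move/cvgrPdist_le : hc => /(_ _ e3); rewrite !near_withinE => hc.
have hx := nbhs_singleton hf Ax.
apply: filterS2 hc hf => y hy fy Ay.
have := hy Ay; have := fy Ay => fhy hxy.
have -> : f x - f y = (f x - h x) + (h x - h y) - (f y - h y) by ring.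
apply: le_trans (ler_normB _ _) _; apply: le_trans (lerD (ler_normD _ _) (lexx _)) _.
lra.
Qed.

End WithinContinuity.

Section ClosureElements.
Context {R : realType} (lambda : nat -> R).
Hypothesis lambda_ge0 : forall n, 0 <= lambda n.
Hypothesis lambda_incr : forall m n, (m < n)%N -> lambda m < lambda n.
Hypothesis muntz_condition :
  (\sum_(0 <= n <oo | lambda n != 0%R) ((lambda n)^-1)%:E < +oo)%E.
Notation leb := (@lebesgue_measure R).
Notation Lambda := (range lambda).
Implicit Types (s : seq (R * R)) (u v w : L1 R).

Lemma range_ge0 : Lambda `<=` [set l | 0 <= l].
Proof. by move=> _ [n _ <-] /=. Qed.

Lemma closure_predP (V : normedModType R) (W : submodClosed V) (v : V) :
  v \in closure_pred W -> forall e, 0 < e ->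
  exists2 w, w \in W & `|v - w| < e.
Proof.
rewrite /closure_pred inE => cv e e0.
have [w [/= wW vw]] := cv _ (nbhsx_ballx v e e0).
by exists w => //; move: vw; rewrite -ball_normE.
Qed.

Lemma M1_approx (f : M1 Lambda) e : 0 < e -> exists s w, [/\ supported Lambda s,
  (L1_repr w : R -> R) = muntz_eval s %[ae mu01 R] & `|M1_val f - w| < e].
Proof.
move=> e0; have [w] := closure_predP (subspace_valP f) e0.
by rewrite inE => -[p /muntzP[s sL ->] wp] fw; exists s, w.
Qed.

Lemma muntz_prim_increment0 s (x y S : R) : supported [set l | 0 <= l] s ->
  0 <= x -> x <= y -> (forall z, 0 < z <= y -> `|muntz_eval s z| <= S) ->
  `|muntz_prim s y - muntz_prim s x| <= S * (y - x).
Proof.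
move=> sF; rewrite le_eqVlt => /predU1P[<-|x0 xy hS]; last first.
  by apply: muntz_prim_increment => // z /andP[xz zy]; rewrite hS// (lt_le_trans x0).
rewrite le_eqVlt => /predU1P[<-|y0 hS]; first by rewrite !subrr normr0 mulr0.
have pE : muntz_prim s = muntz_eval [seq (a.1 / (a.2 + 1), a.2 + 1) | a <- s].
  by apply/funext => z; exact: muntz_primE.
have [|/=|c + ->] := @MVT R (muntz_prim s) (muntz_eval s) 0 y y0.
- by move=> z; rewrite in_itv/= => /andP[z0 _]; exact: is_derive_muntz_prim.
- by rewrite pE; apply: muntz_eval_continuous => //; exact: supported_prim.
- rewrite in_itv/= => /andP[c0 cy]; rewrite normrM subr0 (gtr0_norm y0).
  by rewrite ler_wpM2r ?(ltW y0)// hS// c0 ltW.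
Qed.

(** By density from [muntz_pointwise_bound]: away from 1, the primitives are
    Lipschitz with a constant controlled by their own size. *)
Lemma volterra_lipschitz (c c' : R) : 0 < c -> c < c' -> c' <= 1 ->
  exists2 N, 0 <= N & forall (f : M1 Lambda) W,
    (forall y, 0 <= y <= c' -> `|volterra_fun (M1_val f) y| <= W) ->
    forall x y, 0 <= x -> x <= y -> y <= c ->
    `|volterra_fun (M1_val f) y - volterra_fun (M1_val f) x| <= N * W * (y - x).
Proof.
move=> c0 cc' c'1.
have [N N0 hN] := muntz_pointwise_bound lambda_ge0 lambda_incr muntz_condition c0 cc'.
exists N => // f W hW x y x0 xy yc.
have c1 : c <= 1 by rewrite (le_trans (ltW cc')).
have y1 := le_trans yc c1; have y0 := le_trans x0 xy; have x1 := le_trans xy y1.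
apply/ler_addgt0Pr => e e0.
have K0 : 0 < N * (y - x) + 2 by rewrite ltr_wpDl// mulr_ge0// subr_ge0.
pose d := e / (N * (y - x) + 2).
have d0 : 0 < d by rewrite divr_gt0.
have [s [w [sL ws fw]]] := M1_approx f d0.
have s0 := supported_sub range_ge0 sL.
have near z : 0 <= z -> z <= 1 -> `|volterra_fun (M1_val f) z - muntz_prim s z| <= d.
  move=> z0 z1; rewrite -(volterra_muntz_eval s0 ws z0 z1).
  rewrite -volterraB//; exact: le_trans (volterra_le _ z0 z1) (ltW fw).
have sW z : 0 < z <= c' -> `|muntz_prim s z| <= W + d.
  move=> /andP[z0 zc']; have z1 := le_trans zc' c'1.
  have := near z (ltW z0) z1; have := hW z; rewrite (ltW z0) zc' => /(_ isT) h1 h2.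
  rewrite -[muntz_prim s z](subKr (volterra_fun (M1_val f) z)).
  by rewrite (le_trans (ler_normB _ _))// lerD.
have ev := hN s (W + d) sL sW.
have := @muntz_prim_increment0 s x y (N * (W + d)) s0 x0 xy.
move=> /(_ _)/wrap[z /andP[z0 zy]|inc]; first by rewrite ev// z0 (le_trans zy).
have -> : volterra_fun (M1_val f) y - volterra_fun (M1_val f) x =
  (volterra_fun (M1_val f) y - muntz_prim s y) + (muntz_prim s y - muntz_prim s x)
  - (volterra_fun (M1_val f) x - muntz_prim s x) by ring.
apply: le_trans (ler_normB _ _) _; apply: le_trans (lerD (ler_normD _ _) (lexx _)) _.
have := near y y0 y1; have := near x x0 x1.
have -> : e = d * (N * (y - x) + 2) by rewrite /d divfK// gt_eqF.
lra.
Qed.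

(** The pointwise bound with the L1 norm, extended to the point 0 by continuity. *)
Lemma muntz_eval_diff_bound (c : R) : 0 < c -> c < 1 ->
  exists2 N, 0 <= N & forall s t v w, supported Lambda s -> supported Lambda t ->
    (L1_repr v : R -> R) = muntz_eval s %[ae mu01 R] ->
    (L1_repr w : R -> R) = muntz_eval t %[ae mu01 R] ->
    forall x, 0 <= x <= c -> `|muntz_eval s x - muntz_eval t x| <= N * `|v - w|.
Proof.
move=> c0 c1.
have [N N0 hN] := muntz_pointwise_bound lambda_ge0 lambda_incr muntz_condition c0 c1.
exists N => // s t v w sL tL vs wt.
have s0 := supported_sub range_ge0 sL; have t0 := supported_sub range_ge0 tL.
pose r := s ++ multiplier (fun=> -1) t.
have rL : supported Lambda r.
  by move=> a; rewrite mem_cat => /orP[/sL//|]; exact: supported_multiplier.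
have rE x : muntz_eval r x = muntz_eval s x - muntz_eval t x.
  rewrite /r {1}/muntz_eval big_cat/= -/(muntz_eval s x) -/(muntz_eval _ x) muntz_eval_multiplier.
  by rewrite -sumrN; congr (_ + _); apply: eq_bigr => a _; ring.
have rP x : muntz_prim r x = muntz_prim s x - muntz_prim t x.
  rewrite /r {1}/muntz_prim big_cat/= -/(muntz_prim s x) -/(muntz_prim _ x) muntz_prim_multiplier.
  by rewrite -sumrN; congr (_ + _); apply: eq_bigr => a _; ring.
have rW y : 0 < y <= 1 -> `|muntz_prim r y| <= `|v - w|.
  move=> /andP[/ltW y0 y1].
  rewrite rP -(volterra_muntz_eval s0 vs y0 y1) -(volterra_muntz_eval t0 wt y0 y1).
  rewrite -volterraB//; exact: volterra_le.
have ev := hN r _ rL rW.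
move=> x /andP[+ xc]; rewrite le_eqVlt => /predU1P[<-|x0]; last first.
  by rewrite -rE ev// x0.
rewrite -rE; have r0 := supported_sub range_ge0 rL.
have cv : `|muntz_eval r y| @[y --> 0^'+] --> `|muntz_eval r 0|.
  by apply: cvg_norm; exact: muntz_eval_cvg_right.
apply: (cvgr_to_le cv).
near=> y; apply: ev; apply/andP; split; near: y.
  exact: nbhs_right_gt.
exact: nbhs_right_le.
Unshelve. all: by end_near. Qed.

End ClosureElements.

Section ContinuousRepresentative.
Context {R : realType} (lambda : nat -> R).
Hypothesis lambda_ge0 : forall n, 0 <= lambda n.
Hypothesis lambda_incr : forall m n, (m < n)%N -> lambda m < lambda n.
Hypothesis muntz_condition :
  (\sum_(0 <= n <oo | lambda n != 0%R) ((lambda n)^-1)%:E < +oo)%E.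
Notation leb := (@lebesgue_measure R).
Notation Lambda := (range lambda).
Implicit Types (s : seq (R * R)) (u v w : L1 R).

Let Lambda_ge0 := range_ge0 lambda_ge0.

(** Approximating polynomials converge uniformly on every [0, c] with [c < 1], and
    their limit is the required representative. *)
Lemma M1_cts_repr (f : M1 Lambda) : exists g : R -> R,
  {within `[0, 1[, continuous g} /\
  (L1_repr (M1_val f) : R -> R) = g %[ae mu01 R].
Proof.
have /choice[sw hsw] : forall n : nat, exists sw : seq (R * R) * L1 R,
    [/\ supported Lambda sw.1, (L1_repr sw.2 : R -> R) = muntz_eval sw.1 %[ae mu01 R]
      & `|M1_val f - sw.2| < n.+1%:R^-1].
  move=> n; have n0 : 0 < n.+1%:R^-1 :> R by rewrite invr_gt0.
  by have [s [w [? ? ?]]] := M1_approx f n0; exists (s, w).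
have aux2 (N e d a b : R) : d * (2 * N + 1) = e -> 0 <= N -> 0 < d ->
    a < d -> b < d -> N * (a + b) < e.
  by move=> <- N0 d0 ad bd; have := ler_wpM2l N0 (ltW (ltrD ad bd)); lra.
have aux1 (N e d a : R) : d * (N + 1) = e -> 0 <= N -> 0 < d ->
    a < d -> N * a <= e.
  by move=> <- N0 d0 ad; have := ler_wpM2l N0 (ltW ad); lra.
pose p n := muntz_eval (sw n).1.
have p0 n : supported [set l | 0 <= l] (sw n).1.
  by have [sL _ _] := hsw n; exact: supported_sub sL.
pose g x := limn (fun n => p n x).
have unif (c : R) : 0 < c -> c < 1 -> exists2 N : R, 0 <= N &
    forall n (x : R), 0 <= x <= c -> `|g x - p n x| <= N * n.+1%:R^-1.
  move=> c0 c1.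
  have [N N0 hN] := muntz_eval_diff_bound lambda_ge0 lambda_incr muntz_condition c0 c1.
  have cau n m (x : R) : 0 <= x <= c ->
      `|p m x - p n x| <= N * (n.+1%:R^-1 + m.+1%:R^-1).
    move=> xc; have [sn wn fn] := hsw n; have [sm wm fm] := hsw m.
    apply: le_trans (hN _ _ _ _ sm sn wm wn x xc) _.
    rewrite ler_wpM2l//.
    have -> : (sw m).2 - (sw n).2 = (M1_val f - (sw n).2) - (M1_val f - (sw m).2).
      by rewrite opprB [RHS]addrC -addrA addKr.
    by rewrite (le_trans (ler_normB _ _))// lerD ?ltW.
  have cvgp (x : R) : 0 <= x <= c -> p n x @[n --> \oo] --> g x.
    move=> xc; apply/cauchy_cvgP/cauchy_ballP => e e0; near_simpl.
    have d0 : 0 < e / (2 * N + 1) by rewrite divr_gt0// ltr_wpDl// mulr_ge0.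
    near=> n m; rewrite -ball_normE/= distrC.
    apply: le_lt_trans (cau _ _ _ xc) _.
    have hn : n.+1%:R^-1 < e / (2 * N + 1).
      by near: n; exact: (near_infty_natSinv_lt (PosNum d0)).
    have hm : m.+1%:R^-1 < e / (2 * N + 1).
      by near: m; exact: (near_infty_natSinv_lt (PosNum d0)).
    have : e / (2 * N + 1) * (2 * N + 1) = e by rewrite divfK// gt_eqF// ltr_wpDl// mulr_ge0.
    by move=> /aux2; apply.
  exists N => // n x xc.
  have cv : `|p m x - p n x| @[m --> \oo] --> `|g x - p n x|.
    by apply: cvg_norm; apply: cvgB; [exact: cvgp|exact: cvg_cst].
  apply/ler_addgt0Pr => e e0; apply: (cvgr_to_le cv).
  have d0 : 0 < e / (N + 1) by rewrite divr_gt0// ltr_wpDl.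
  near=> m; apply: le_trans (cau n m x xc) _; rewrite mulrDr lerD2l.
  have hm : m.+1%:R^-1 < e / (N + 1).
    by near: m; exact: (near_infty_natSinv_lt (PosNum d0)).
  have : e / (N + 1) * (N + 1) = e by rewrite divfK// gt_eqF// ltr_wpDl.
  by move=> /aux1; apply.
have inv0 (e : R) : 0 < e -> exists n, n.+1%:R^-1 < e.
  move=> e0; have [n _ hn] := near_infty_natSinv_lt (PosNum e0).
  by exists n; apply: (hn n); rewrite /=.
have small (N e : R) : 0 <= N -> 0 < e -> exists n, N * n.+1%:R^-1 <= e.
  move=> N0 e0; have d0 : 0 < e / (N + 1) by rewrite divr_gt0// ltr_wpDl.
  have [n hn] := inv0 _ d0; exists n.
  have : e / (N + 1) * (N + 1) = e by rewrite divfK// gt_eqF// ltr_wpDl.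
  by move=> /aux1; apply.
have gc : {within `[0, 1[, continuous g}.
  apply: within_continuous_approx => x; rewrite /= in_itv/= => /andP[x0 x1] e e0.
  pose c := (x + 1) / 2.
  have [c0 c1 xc] : [/\ 0 < c, c < 1 & x < c] by rewrite /c; split; lra.
  have [N N0 hN] := unif c c0 c1; have [n hn] := small N e N0 e0.
  exists (p n); split.
    apply: continuous_subspaceW (muntz_eval_continuous (p0 n) (@ltr01 R)).
    by move=> y /=; rewrite !in_itv/= => /andP[-> /ltW].
  apply: filterS (lt_nbhsl xc) => y yc; rewrite /= in_itv/= => /andP[y0 y1].
  by apply: le_trans hn; apply: hN; rewrite y0 ltW.
exists g; split => //.
(* the limit in L1 and the uniform limit agree almost everywhere on [0, c] *)
have on0c (c : R) : 0 < c -> c < 1 -> leb.-negligible (`[0, c] `\` [set x | L1_repr (M1_val f) x = g x]).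
  move=> c0 c1.
  have gcc : {within `[0, c], continuous g}.
    apply: continuous_subspaceW gc => y /=; rewrite !in_itv/= => /andP[-> yc].
    exact: le_lt_trans c1.
  have gi : leb.-integrable `[0, c] (EFin \o g).
    by apply: continuous_compact_integrable => //; exact: segment_compact.
  have ui : leb.-integrable `[0, c] (EFin \o L1_repr (M1_val f)).
    by apply: integrable_itv01 => //; [exact: L1_repr_integrable|exact: ltW].
  have pin n : leb.-integrable `[0, c] (EFin \o p n).
    by apply: integrable_itv01 => //; [exact: muntz_eval_integrable|exact: ltW].
  pose dif x := L1_repr (M1_val f) x - g x.
  have iB (h1 h2 : R -> R) : leb.-integrable `[0, c] (EFin \o h1) ->
      leb.-integrable `[0, c] (EFin \o h2) ->
      leb.-integrable `[0, c] (EFin \o (fun x => h1 x - h2 x)).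
    by move=> i1 i2; apply: eq_integrable (integrableB _ i1 i2).
  have di : leb.-integrable `[0, c] (EFin \o dif) by exact: iB.
  have [N N0 hN] := unif c c0 c1.
  have int0 : \int[leb]_(x in `[0, c]) `|dif x| = 0.
    apply/eqP; rewrite eq_le; apply/andP; split; last exact: Rintegral_ge0.
    apply/ler_addgt0Pr => e e0; rewrite add0r.
    have [n hn] := small (1 + N) e (addr_ge0 ler01 N0) e0.
    have i1 : leb.-integrable `[0, c] (EFin \o (fun x => `|L1_repr (M1_val f) x - p n x|)).
      exact: (integrable_norm (iB _ _ ui (pin n))).
    have i2 : leb.-integrable `[0, c] (EFin \o (fun x => `|p n x - g x|)).
      exact: (integrable_norm (iB _ _ (pin n) gi)).
    have le1 : \int[leb]_(x in `[0, c]) `|dif x| <=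
        \int[leb]_(x in `[0, c]) (`|L1_repr (M1_val f) x - p n x| + `|p n x - g x|).
      apply: le_Rintegral => //.
      - exact: (integrable_norm di).
      - by apply: eq_integrable (integrableD _ i1 i2).
      - move=> x _; rewrite /dif -[X in `|X - _|](subrK (p n x)) -addrA.
        exact: ler_normD.
    apply: le_trans le1 _; rewrite RintegralD//.
    apply: le_trans hn; rewrite mulrDl mul1r lerD//.
      have [sL wp fw] := hsw n.
      apply: le_trans (ltW fw); rewrite L1_normRE.
      apply: (@le_trans _ _ (\int[leb]_(x in `[0, c]) `|L1_repr (M1_val f - (sw n).2) x|)).
        rewrite le_eqVlt; apply/orP; left; apply/eqP.
        apply: ae_eq_Rintegral => //; first by apply: itv_sub01 => //; exact: ltW.
        + by have /measurable_int/measurable_EFinP := i1.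
        + apply: measurableT_comp => //; apply: measurable_funTS.
          exact: L1_repr_measurable.
        + have -> : M1_val f - (sw n).2 = M1_val f + (-1) *: (sw n).2.
            by rewrite scaleN1r.
          apply: filterS (filterI wp (filterI
            (L1_reprD (M1_val f) ((-1) *: (sw n).2)) (L1_reprZ (-1) (sw n).2))).
          move=> x [/(_ I) h1 [/(_ I) h2 /(_ I) h3]] _.
          by rewrite h2 /= h3 /= h1 scaleN1r.
      have wi := integrable_norm (L1_repr_integrable (M1_val f - (sw n).2)).
      have lc : (BLeft 0 <= BRight c)%O by rewrite bnd_simp ltW.
      have rc : (BRight c <= BRight 1)%O by rewrite bnd_simp ltW.
      by rewrite -subr_ge0 (Rintegral_itvB wi lc rc); apply: Rintegral_ge0 => ? _ /=.
    apply: (@le_trans _ _ (\int[leb]_(x in `[0, c]) (N * n.+1%:R^-1))).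
      apply: le_Rintegral => //.
        apply: continuous_compact_integrable; first exact: segment_compact.
        by move=> x; exact: cvg_cst.
      by move=> x; rewrite /= in_itv/= distrC => xc; exact: hN.
    rewrite Rintegral_cst//= lebesgue_measure_itv/= lte_fin c0 oppr0 adde0/=.
    by rewrite ler_piMr ?(ltW c1)// mulr_ge0.
  have := int0; rewrite /Rintegral => int0'.
  have eint0 : (\int[leb]_(x in `[0%R, c]) `|(dif x)%:E| = 0)%E.
    have fi : (\int[leb]_(x in `[0%R, c]) `|(dif x)%:E|)%E \is a fin_num.
      by apply: integrable_fin_num => //; exact: (integrable_norm di).
    by rewrite -(fineK fi) [fine _]int0'.
  have mdif : measurable_fun `[0, c] (EFin \o dif) by exact: measurable_int di.
  have := (ae_eq_integral_abs leb (measurable_itv _) mdif).1 eint0.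
  apply: negligibleS => x [/= xc fgx] /(_ xc) [] /eqP.
  by rewrite subr_eq0 => /eqP.
apply/ae_mu01P.
pose c k : R := 1 - k.+2%:R^-1.
have cP k : 0 < c k /\ c k < 1.
  have k2 : k.+2%:R^-1 <= 2^-1 :> R by rewrite lef_pV2 ?posrE// ler_nat.
  have k0 : 0 < k.+2%:R^-1 :> R by rewrite invr_gt0.
  by rewrite /c; move: (k.+2%:R^-1 : R) k2 k0 => t t2 t0; split; lra.
have n1 : leb.-negligible [set 1 : R].
  by apply/negligibleP => //; exact: lebesgue_measure_set1.
have nk := negligible_bigcup (fun k => on0c (c k) (cP k).1 (cP k).2).
apply: negligibleS (negligibleU nk n1) => x [/= + ux].
rewrite in_itv/= => /andP[x0]; rewrite le_eqVlt => /predU1P[->|x1]; first by right.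
left; have d0 : 0 < 1 - x by rewrite subr_gt0.
have [k hk] := inv0 _ d0; exists k => //; split=> [|h]; last by apply: ux => _.
rewrite /= in_itv/= x0/= /c.
have k2 : k.+2%:R^-1 <= k.+1%:R^-1 :> R by rewrite lef_pV2 ?posrE// ler_nat.
by have := le_lt_trans k2 hk; move: (k.+2%:R^-1 : R) => t; lra.
Unshelve. all: by end_near. Qed.

Lemma cts_reprP (f : M1 Lambda) :
  {within `[0, 1[, continuous (cts_repr (M1_val f))} /\
  ((L1_repr (M1_val f) : R -> R) = (cts_repr (M1_val f) : R -> R) %[ae mu01 R]).
Proof. exact: getPex (M1_cts_repr f). Qed.

(** The value at 0 of the continuous representative is the limit of the means, so
    that it can be handled without reference to the representative. *)
Lemma volterra_mean_cvg (f : M1 Lambda) :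
  x^-1 * volterra_fun (M1_val f) x @[x --> 0^'+] --> cts_repr (M1_val f) 0.
Proof.
have [gc ug] := cts_reprP f; set g := cts_repr _ in gc ug *.
have g0 : 0 \in `[(0 : R), 1[ by rewrite in_itv/= lexx ltr01.
have /subspace_continuousP/(_ 0 g0)/cvgrPdist_le gc0 := gc.
apply/cvgrPdist_le => e e0.
have := gc0 e e0; rewrite near_withinE => /nbhs_ballP[d /= d0 hd].
have m0 : 0 < Num.min d 1 by rewrite lt_min d0 ltr01.
near=> x.
have x0 : 0 < x by near: x; exact: nbhs_right_gt.
have : x < Num.min d 1 by near: x; exact: nbhs_right_lt.
rewrite lt_min => /andP[xd x1].
have gcc : {within `[0, x], continuous g}.
  apply: continuous_subspaceW gc => y /=; rewrite !in_itv/= => /andP[-> yx].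
  exact: le_lt_trans x1.
have gi : leb.-integrable `[0, x] (EFin \o g).
  by apply: continuous_compact_integrable => //; exact: segment_compact.
have ci : leb.-integrable `[0, x] (EFin \o cst (g 0)).
  apply: continuous_compact_integrable; first exact: segment_compact.
  by move=> y; exact: cvg_cst.
have ei : leb.-integrable `[0, x] (EFin \o cst e).
  apply: continuous_compact_integrable; first exact: segment_compact.
  by move=> y; exact: cvg_cst.
have di : leb.-integrable `[0, x] (EFin \o (fun y => g 0 - g y)).
  by apply: eq_integrable (integrableB _ ci gi).
have Rcst (k : R) : \int[leb]_(y in `[0, x]) k = k * x.
  by rewrite Rintegral_cst//= lebesgue_measure_itv/= lte_fin x0 oppr0 adde0.
rewrite (volterraE (ltW x0) (ltW x1) _ ug); last first.
  by have /measurable_int/measurable_EFinP := gi.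
have -> : g 0 - x^-1 * primitive g x =
    x^-1 * \int[leb]_(y in `[0, x]) (g 0 - g y).
  by rewrite RintegralB// Rcst mulrBr mulrCA mulVf ?mulr1// gt_eqF.
rewrite normrM normfV (gtr0_norm x0) mulrC ler_pdivrMr//.
apply: le_trans (le_normr_Rintegral _ di) _ => //.
rewrite -Rcst; apply: le_Rintegral => //; first exact: (integrable_norm di).
move=> y; rewrite /= in_itv/= => /andP[y0 yx]; apply: hd.
  by rewrite -ball_normE/= sub0r normrN ger0_norm// (le_lt_trans yx).
by rewrite in_itv/= y0 (le_lt_trans yx).
Unshelve. all: by end_near. Qed.

End ContinuousRepresentative.

(** * Operators into the uniform closure, and the Cesàro operator *)

Section MinfOperators.
Context {R : realType}.
Implicit Types (s : seq (R * R)) (L : set R).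

Lemma C01_eq (f g : C01 R) : {in `[0, 1], C01_fun f =1 g} -> f = g.
Proof.
move=> fg; apply: val_inj; apply/funext => x /=.
have [x01|x01] := boolP (x \in `[0, 1]); first exact: fg.
by have := C01P f; have := C01P g; rewrite !inE => -[_ ->// [_ ->]].
Qed.

Lemma Minf_eq L (f g : Minf L) :
  (forall x, x \in `[0, 1] -> Minf_val f x = Minf_val g x) -> f = g.
Proof. by move=> fg; apply: val_inj; exact: C01_eq. Qed.

Lemma C01_norm_le (f : C01 R) M :
  (forall x, x \in `[0, 1] -> `|f x| <= M) -> `|f| <= M.
Proof. exact: sup_norm_le. Qed.

Lemma C01_norm_ub (f : C01 R) x : x \in `[0, 1] -> `|f x| <= `|f|.
Proof. exact: sup_norm_ub. Qed.

Lemma Minf_norm L (f : Minf L) : `|f| = `|Minf_val f|.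
Proof. by []. Qed.

Lemma Minf_valD L (f g : Minf L) x : Minf_val (f + g) x = Minf_val f x + Minf_val g x.
Proof. by []. Qed.

Lemma C01_valZ (a : R) (f : C01 R) x : C01_fun (a *: f) x = a * C01_fun f x.
Proof. by []. Qed.

Lemma Minf_valZ L (a : R) (f : Minf L) x :
  Minf_val (a *: f) x = a * Minf_val f x.
Proof.
have -> : Minf_val (a *: f) = a *: Minf_val f by [].
exact: C01_valZ.
Qed.

Lemma Minf_val_linear L : linear (@Minf_val R L).
Proof.
move=> a f g; have <- : Minf_val (a *: f) = a *: Minf_val f by [].
by [].
Qed.

Lemma Minf_valB L (f g : Minf L) x : Minf_val (f - g) x = Minf_val f x - Minf_val g x.
Proof. by []. Qed.

Lemma muntz_eval_continuous01 s : supported [set l | 0 <= l] s ->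
  {within `[0, 1], continuous (muntz_eval s)}.
Proof. by move=> s0; exact: muntz_eval_continuous. Qed.

Definition extend0 (f : R -> R) (x : R) : R := if x \in `[0, 1] then f x else 0.

Lemma extend0_C01 (f : R -> R) : {within `[0, 1], continuous f} ->
  extend0 f \in @C01_pred R.
Proof.
move=> cf; rewrite inE; split.
  apply: (subspace_eq_continuous _ cf) => x; rewrite inE/= => x01.
  by change (f x = extend0 f x); rewrite /extend0 x01.
by move=> x; rewrite /extend0 => /negbTE ->.
Qed.

Lemma Minf_limit L (f : R -> R) : L `<=` [set l | 0 <= l] ->
  (forall e, 0 < e -> exists s, supported L s /\
     forall x, x \in `[0, 1] -> `|f x - muntz_eval s x| <= e) ->
  exists F : Minf L, forall x, x \in `[0, 1] -> Minf_val F x = f x.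
Proof.
move=> L0 H.
have cf : {within `[0, 1], continuous f}.
  apply: within_continuous_approx => x x01 e e0.
  have [s [sL hs]] := H e e0; exists (muntz_eval s); split.
    by apply: muntz_eval_continuous01; exact: supported_sub sL.
  by apply: (@filterS _ (nbhs x) _ setT) => [y _ y01|]; [exact: hs|exact: filterT].
pose F0 := MkC01 (extend0_C01 cf).
have F0P : F0 \in closure_pred (muntz_C01 L).
  rewrite /closure_pred inE => B /nbhs_ballP[e /= e0 eB].
  have e2 : 0 < e / 2 by rewrite divr_gt0.
  have [s [sL hs]] := H _ e2.
  have sc : {within `[0, 1], continuous (muntz_eval s)}.
    by apply: muntz_eval_continuous01; exact: supported_sub sL.
  pose G := MkC01 (extend0_C01 sc); exists G; split.
    rewrite /= inE; exists (muntz_eval s); first by apply/muntzP; exists s.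
    by move=> x x01; rewrite /G /= /extend0 x01.
  apply: eB; rewrite -ball_normE /= .
  apply: (@le_lt_trans _ _ (e / 2)); last by rewrite gtr_pMr//; lra.
  apply: C01_norm_le => x x01.
  rewrite [X in `|X|](_ : _ = extend0 f x - extend0 (muntz_eval s) x)//.
  by rewrite /extend0 x01 hs.
by exists (ClosedSubspace F0P) => x x01; rewrite /= /extend0 x01.
Qed.

(** Packs a proof of linearity, for maps that only exist inside a proof. *)
Definition linear_of (X Y : lmodType R) (f : X -> Y) (lf : linear f) : {linear X -> Y} :=
  HB.pack f (GRing.isLinear.Build R X Y *:%R f lf).

Lemma Minf_operator (X : normedModType R) L (T : X -> R -> R) (K : R) :
  L `<=` [set l | 0 <= l] ->
  (forall f e, 0 < e -> exists s, supported L s /\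
     forall x, x \in `[0, 1] -> `|T f x - muntz_eval s x| <= e) ->
  (forall a f g x, x \in `[0, 1] -> T (a *: f + g) x = a * T f x + T g x) ->
  (forall f x, x \in `[0, 1] -> `|T f x| <= K * `|f|) ->
  exists G : {linear X -> Minf L}, continuous G /\
    forall f x, x \in `[0, 1] -> Minf_val (G f) x = T f x.
Proof.
move=> L0 Ta Tl Tb.
have /choice[G0 hG] : forall f, exists F : Minf L,
    forall x, x \in `[0, 1] -> Minf_val F x = T f x.
  by move=> f; apply: Minf_limit => //; exact: Ta.
have lG : linear G0.
  move=> a f g; apply: Minf_eq => x x01.
  by rewrite Minf_valD Minf_valZ !hG// Tl.
exists (linear_of lG); split; last exact: hG.
apply: bounded_linear_continuous; apply/linear_boundedP.
apply: filterS (nbhs_pinfty_ge (num_real K)) => r Kr f.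
rewrite Minf_norm; apply: C01_norm_le => x x01.
by rewrite hG//; apply: le_trans (Tb f x x01) _; rewrite ler_wpM2r.
Qed.

End MinfOperators.

Section Cesaro.
Context {R : realType} (lambda : nat -> R).
Hypothesis lambda_ge0 : forall n, 0 <= lambda n.
Hypothesis lambda_incr : forall m n, (m < n)%N -> lambda m < lambda n.
Hypothesis muntz_condition :
  (\sum_(0 <= n <oo | lambda n != 0%R) ((lambda n)^-1)%:E < +oo)%E.
Notation leb := (@lebesgue_measure R).
Notation Lambda := (range lambda).
Implicit Types (s : seq (R * R)) (f g : M1 Lambda).

Let Lambda_ge0 := range_ge0 lambda_ge0.

Let V f := volterra_fun (M1_val f).
Let C f := cesaro_fun (M1_val f).

Lemma M1_muntz_eval s : supported Lambda s -> exists w : M1 Lambda,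
  (L1_repr (M1_val w) : R -> R) = muntz_eval s %[ae mu01 R].
Proof.
move=> sL; have [u us] := muntz_eval_L1 (supported_sub Lambda_ge0 sL).
have uP : u \in closure_pred (muntz_L1 Lambda).
  rewrite /closure_pred inE; apply: subset_closure; rewrite /= inE.
  by exists (muntz_eval s) => //; apply/muntzP; exists s.
by exists (ClosedSubspace uP).
Qed.

Lemma M1_norm f : `|f| = `|M1_val f|. Proof. by []. Qed.

Lemma M1_dense f e : 0 < e -> exists s (w : M1 Lambda), [/\ supported Lambda s,
  (L1_repr (M1_val w) : R -> R) = muntz_eval s %[ae mu01 R] & `|f - w| < e].
Proof.
move=> e0; have [s [u [sL us fu]]] := M1_approx f e0.
have [w ws] := M1_muntz_eval sL; exists s, w; split => //.
have uw : u = M1_val w.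
  apply: L1_eqP; apply: filterS (filterI us ws) => x [/(_ I) h1 /(_ I) h2] _.
  by rewrite h1 h2.
by rewrite uw in fu.
Qed.

Lemma M1_volterra_lin a f g x : x \in `[0, 1] -> V (a *: f + g) x = a * V f x + V g x.
Proof. by rewrite in_itv/= => /andP[x0 x1]; exact: volterra_lin. Qed.

Lemma M1_volterra_le f x : x \in `[0, 1] -> `|V f x| <= `|f|.
Proof. by rewrite in_itv/= => /andP[x0 x1]; exact: volterra_le. Qed.

Lemma cesaro_gt0 f x : 0 < x -> C f x = x^-1 * V f x.
Proof. by move=> x0; rewrite /C /cesaro_fun gt_eqF. Qed.

Lemma cesaro_cvg0 f : C f x @[x --> 0^'+] --> C f 0.
Proof.
rewrite [C f 0]/C /cesaro_fun eqxx.
have := @volterra_mean_cvg _ _ lambda_ge0 lambda_incr muntz_condition f.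
apply: cvg_trans; apply: near_eq_cvg; near=> x.
by rewrite cesaro_gt0//; near: x; exact: nbhs_right_gt.
Unshelve. all: by end_near. Qed.

Lemma right_limit_unique (h k : R -> R) (a b : R) :
  h x @[x --> 0^'+] --> a -> k x @[x --> 0^'+] --> b ->
  (\forall x \near 0^'+, h x = k x) -> a = b.
Proof.
move=> ha kb hk; rewrite -(cvg_lim (@Rhausdorff R) ha); apply: cvg_lim => //.
apply: cvg_trans kb; apply: near_eq_cvg.
by apply: filterS hk => x ->.
Qed.

Lemma cesaro_lin a f g x : x \in `[0, 1] -> C (a *: f + g) x = a * C f x + C g x.
Proof.
rewrite in_itv/= => /andP[+ x1]; rewrite le_eqVlt => /predU1P[<-|x0].
  have cv : a * C f x + C g x @[x --> 0^'+] --> a * C f 0 + C g 0.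
    apply: cvgD; last exact: cesaro_cvg0.
    by apply: cvgM; [exact: cvg_cst|exact: cesaro_cvg0].
  apply: (right_limit_unique (@cesaro_cvg0 (a *: f + g)) cv); near=> y.
  have y0 : 0 < y by near: y; exact: nbhs_right_gt.
  have y1 : y <= 1 by near: y; exact: nbhs_right_le.
  by rewrite !cesaro_gt0// M1_volterra_lin ?in_itv/= ?(ltW y0)//; ring.
rewrite !cesaro_gt0// M1_volterra_lin; first by ring.
by rewrite in_itv/= x1 ltW.
Unshelve. all: by end_near. Qed.

(** Stated with the size of the primitive on [0, c'] instead of the norm of [f], as
    needed for compactness. *)
Lemma cesaro_bound (c c' : R) : 0 < c -> c < c' -> c' <= 1 ->
  exists2 N, 0 <= N & forall f W,
    (forall y, 0 <= y <= c' -> `|V f y| <= W) ->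
    forall x, 0 <= x <= c -> `|C f x| <= N * W.
Proof.
move=> c0 cc' c'1.
have [N N0 hN] := volterra_lipschitz lambda_ge0 lambda_incr muntz_condition c0 cc' c'1.
exists N => // f W hW.
have pos x : 0 < x -> x <= c -> `|C f x| <= N * W.
  move=> x0 xc; rewrite cesaro_gt0// normrM normfV (gtr0_norm x0) ler_pdivrMl//.
  have := hN f W hW 0 x (lexx 0) (ltW x0) xc.
  by rewrite volterra0 !subr0 mulrC.
move=> x /andP[+ xc]; rewrite le_eqVlt => /predU1P[<-|x0]; last exact: pos.
apply: (cvgr_to_le (cvg_norm (@cesaro_cvg0 f))).
near=> y; apply: pos; near: y; [exact: nbhs_right_gt|exact: nbhs_right_le].
Unshelve. all: by end_near. Qed.

Lemma cesaro_le : exists2 K, 0 <= K &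
  forall f x, x \in `[0, 1] -> `|C f x| <= K * `|f|.
Proof.
have [N N0 hN] := @cesaro_bound 2^-1 1 ltac:(lra) ltac:(lra) (lexx 1).
exists (N + 2) => [|f x]; first by rewrite addr_ge0.
rewrite in_itv/= => /andP[x0 x1].
have [xh|xh] := leP x 2^-1.
  apply: (@le_trans _ _ (N * `|f|)); last by rewrite ler_wpM2r// lerDl.
  by apply: hN; [move=> y y01; apply: M1_volterra_le; rewrite in_itv|rewrite x0].
have {}x0 : 0 < x by apply: lt_trans xh.
rewrite cesaro_gt0// normrM normfV (gtr0_norm x0) ler_pdivrMl//.
apply: (@le_trans _ _ (1 * `|f|)).
  by rewrite mul1r M1_volterra_le// in_itv/= x1 ltW.
rewrite mulrA ler_wpM2r//.
have : 0 <= N * x by rewrite mulr_ge0// ltW.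
lra.
Qed.

Definition cesaro_seq s := multiplier (fun l => (l + 1)^-1) s.

Lemma cesaro_muntz_eval (w : M1 Lambda) s x : supported Lambda s ->
  (L1_repr (M1_val w) : R -> R) = muntz_eval s %[ae mu01 R] -> x \in `[0, 1] ->
  C w x = muntz_eval (cesaro_seq s) x.
Proof.
move=> sL ws; have s0 := supported_sub Lambda_ge0 sL.
have pos y : 0 < y -> y <= 1 -> C w y = muntz_eval (cesaro_seq s) y.
  move=> y0 y1; rewrite cesaro_gt0// /V (volterra_muntz_eval s0 ws) ?(ltW y0)//.
  rewrite muntz_eval_multiplier /muntz_prim mulr_sumr; apply: eq_big_seq => a _.
  have -> : y `^ (a.2 + 1) = y `^ a.2 * y.
    by rewrite powRD ?powRr1 ?(ltW y0)// (gt_eqF y0) implybT.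
  have yV : y^-1 * y = 1 by rewrite mulVf// gt_eqF.
  rewrite -[RHS]mulr1 -yV; ring.
rewrite in_itv/= => /andP[+ x1]; rewrite le_eqVlt => /predU1P[<-|x0]; last exact: pos.
have cs0 : supported [set l | 0 <= l] (cesaro_seq s) by exact: supported_multiplier.
apply: (right_limit_unique (@cesaro_cvg0 w) (muntz_eval_cvg_right cs0)); near=> y.
by apply: pos; near: y; [exact: nbhs_right_gt|exact: nbhs_right_le].
Unshelve. all: by end_near. Qed.

Lemma cesaroB f g x : x \in `[0, 1] -> C (f - g) x = C f x - C g x.
Proof.
move=> x01; have -> : f - g = (-1) *: g + f by rewrite scaleN1r addrC.
by rewrite cesaro_lin// mulN1r addrC.
Qed.

Lemma cesaro_operator : exists G : {linear M1 Lambda -> Minf Lambda},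
  continuous G /\ forall f x, x \in `[0, 1] -> Minf_val (G f) x = C f x.
Proof.
have [K K0 hK] := cesaro_le.
apply: (@Minf_operator _ _ _ (fun f x => C f x) K) => //; last exact: cesaro_lin.
move=> f e e0; have d0 : 0 < e / (K + 1) by rewrite divr_gt0// ltr_wpDl.
have [s [w [sL ws fw]]] := M1_dense f d0.
exists (cesaro_seq s); split; first exact: supported_multiplier.
move=> x x01; rewrite -(cesaro_muntz_eval sL ws x01) -cesaroB//.
apply: le_trans (hK _ _ x01) _.
have : e / (K + 1) * (K + 1) = e by rewrite divfK// gt_eqF// ltr_wpDl.
have := ler_wpM2l K0 (ltW fw); lra.
Qed.

(** The dilation cuts off what happens near 1, which makes the first term compact;
    the second one, of rank 1, subtracts half of the total mass.  The power
    [x `^ lambda 0] keeps the values in the Müntz space and is close to 1 near 1. *)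
Definition cesaro_pert (r : R) f (x : R) : R :=
  r * C f (r * x) + 2^-1 * x `^ lambda 0 * V f 1.

Lemma cesaro_pert_operator (r : R) : 0 < r -> r < 1 ->
  exists G : {linear M1 Lambda -> Minf Lambda},
  continuous G /\ forall f x, x \in `[0, 1] -> Minf_val (G f) x = cesaro_pert r f x.
Proof.
move=> r0 r1; have [K K0 hK] := cesaro_le.
have i1 : (1 : R) \in `[0, 1] by rewrite in_itv/= ler01 lexx.
have rx01 x : x \in `[0, 1] -> r * x \in `[0, 1].
  rewrite !in_itv/= => /andP[x0 x1]; rewrite mulr_ge0 ?(ltW r0)//=.
  by rewrite mulr_ile1 ?(ltW r0) ?(ltW r1).
apply: (@Minf_operator _ _ _ (fun f x => cesaro_pert r f x) (K + 2^-1)) => //.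
- move=> f e e0; have d0 : 0 < e / (K + 1) by rewrite divr_gt0// ltr_wpDl.
  have [s [w [sL ws fw]]] := M1_dense f d0.
  exists ((2^-1 * V f 1, lambda 0) :: multiplier (fun l => r * r `^ l) (cesaro_seq s)).
  split.
    move=> a; rewrite in_cons => /predU1P[->|]; first by exists 0%N.
    by move: a; do 2 apply: supported_multiplier.
  move=> x x01; have x0 : 0 <= x by move: x01; rewrite in_itv/= => /andP[].
  have -> : muntz_eval ((2^-1 * V f 1, lambda 0) ::
      multiplier (fun l => r * r `^ l) (cesaro_seq s)) x =
      2^-1 * V f 1 * x `^ lambda 0 + r * muntz_eval (cesaro_seq s) (r * x).
    rewrite /muntz_eval big_cons/=; congr (_ + _).
    rewrite -/(muntz_eval _ x) muntz_eval_multiplier mulr_sumr; apply: eq_bigr => a _.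
    by rewrite powRM ?(ltW r0)//; ring.
  rewrite -(cesaro_muntz_eval sL ws (rx01 _ x01)) /cesaro_pert.
  have -> : r * C f (r * x) + 2^-1 * x `^ lambda 0 * V f 1 -
     (2^-1 * V f 1 * x `^ lambda 0 + r * C w (r * x)) =
     r * (C f (r * x) - C w (r * x)) by ring.
  rewrite -cesaroB ?rx01// normrM gtr0_norm//.
  apply: (@le_trans _ _ (1 * (K * `|f - w|))).
    by rewrite ler_pM ?(ltW r0) ?(ltW r1)// hK// rx01.
  have : e / (K + 1) * (K + 1) = e by rewrite divfK// gt_eqF// ltr_wpDl.
  have := ler_wpM2l K0 (ltW fw); lra.
- move=> a f g x x01; rewrite /cesaro_pert cesaro_lin ?rx01// M1_volterra_lin//; ring.
- move=> f x x01; rewrite /cesaro_pert (le_trans (ler_normD _ _))// mulrDl lerD//.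
    rewrite normrM gtr0_norm// -[leRHS]mul1r ler_pM ?(ltW r0) ?(ltW r1)//.
    by rewrite hK// rx01.
  move: (x01); rewrite in_itv/= => /andP[x0 x1].
  rewrite !normrM [`|2^-1|]ger0_norm// -mulrA ler_wpM2l//.
  rewrite -[leRHS]mul1r ler_pM// ?M1_volterra_le// ger0_norm ?powR_ge0//.
  have <- : 1 `^ lambda 0 = 1 :> R by rewrite powR1.
  exact: powR_mono.
Qed.

End Cesaro.

(** * A compact perturbation of the Cesàro operator *)

Section UltrafilterCompactness.
Context {R : realType}.

Lemma ultra_bounded_cvg {T : Type} (H : set_system T) (f : T -> R) (M : R) :
  UltraFilter H -> (\forall t \near H, `|f t| <= M) ->
  exists l : R, f t @[t --> H] --> l.
Proof.
move=> HU fM.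
have [|l [_ cl]] := @segment_compact R (- M) M (f @ H) _.
  by apply: filterS fM => t; rewrite ler_norml /= in_itv.
exists l => A Al; have [//|HnA] := in_ultra_setVsetC (f @^-1` A) HU.
by have [y []] := cl (~` A) A HnA Al.
Qed.

(** An ultrafilter on the closure of the image need not come from one on the
    source; it is replaced by one on the source whose image is infinitely close to
    it. *)
Lemma compact_closure_image {T : Type} (Y : normedModType R) (S : T -> Y)
  (B : set T) :
  (forall H : set_system T, UltraFilter H -> H B -> exists p : Y, S @ H --> p) ->
  compact (closure (S @` B)).
Proof.
move=> HS; rewrite compact_ultra => F FU FA.
pose D := [set Pe : set Y * R | F Pe.1 /\ 0 < Pe.2].
pose N (Pe : set Y * R) := B `&` [set t | exists2 y, Pe.1 y & `|y - S t| < Pe.2].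
have NF : ProperFilter (filter_from D N).
  apply: filter_from_proper.
    apply: filter_from_filter.
      by exists (setT, 1); split => //=; exact: filterT.
    move=> [P e] [P' e'] [/= FP e0] [/= FP' e'0].
    exists (P `&` P', Num.min e e'); first by split; [exact: filterI|rewrite /= lt_min e0].
    move=> t [Bt [y [/= Py P'y]]]; rewrite lt_min => /andP[yt yt'].
    by split; split => //; exists y.
  move=> [P e] [/= FP e0].
  have [y [Py Ay]] := filter_ex (filterI FP FA).
  have [_ [[t Bt <-] yt]] := Ay _ (nbhsx_ballx y e e0).
  by exists t; split => //; exists y => //; move: yt; rewrite -ball_normE.
have [H [HU NH]] := ultraFilterLemma NF.
have Dsub P e : F P -> 0 < e -> H (N (P, e)) by move=> FP e0; apply: NH; exists (P, e).
have HB : H B by apply: filterS (Dsub setT 1 filterT ltr01) => t [].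
have [p Sp] := HS H HU HB; exists p; split.
  move=> U /Sp HUp; have {}HUp : H (S @^-1` U) := HUp.
  have [t [Bt Ut]] := filter_ex (filterI HB HUp).
  by exists (S t); split => //; exists t.
apply/cvgrPdist_lt => e e0.
have [//|FnP] := in_ultra_setVsetC [set y | `|p - y| < e] FU.
have e2 : 0 < e / 2 by rewrite divr_gt0.
have {}Sp : H [set t | `|p - S t| < e / 2].
  by move/cvgrPdist_lt : Sp => /(_ _ e2).
have [t [[Bt [y /= Py yt]] pt]] := filter_ex (filterI (Dsub _ _ FnP e2) Sp).
exfalso; apply: Py; rewrite /=.
have -> : p - y = (p - S t) - (y - S t) by rewrite opprB addrA subrK.
rewrite (le_lt_trans (ler_normB _ _))// [e]splitr ltrD//.
Qed.

Lemma Minf_approx (L : set R) (F : Minf L) e : 0 < e ->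
  exists s, supported L s /\
    forall x, x \in `[0, 1] -> `|Minf_val F x - muntz_eval s x| <= e.
Proof.
move=> e0; have [G] := closure_predP (subspace_valP F) e0.
rewrite inE => -[p /muntzP[s sL ->] Gp] FG; exists s; split => // x x01.
rewrite -(Gp x x01); apply: le_trans (ltW FG).
exact: (C01_norm_ub (Minf_val F - G) x01).
Qed.

Lemma Minf_ultra_cvg (L : set R) {T : Type} (H : set_system T) (S : T -> Minf L) :
  L `<=` [set l | 0 <= l] -> UltraFilter H ->
  (forall e, 0 < e -> exists2 E, H E & forall f g x, E f -> E g -> x \in `[0, 1] ->
     `|Minf_val (S f) x - Minf_val (S g) x| <= e) ->
  exists p : Minf L, S @ H --> p.
Proof.
move=> L0 HU cau.
have /choice[phi hphi] : forall x, exists l : R, x \in `[0, 1] ->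
    Minf_val (S f) x @[f --> H] --> l.
  move=> x; have [x01|] := boolP (x \in `[0, 1]); last by exists 0.
  have [E HE hE] := cau 1 ltr01; have [g Eg] := filter_ex HE.
  have [|l hl] := @ultra_bounded_cvg T H (fun f => Minf_val (S f) x)
    (1 + `|Minf_val (S g) x|) HU.
    apply: filterS HE => f Ef; rewrite -lerBlDr.
    by apply: le_trans (lerB_dist _ _) (hE f g x Ef Eg x01).
  by exists l.
have unif e : 0 < e -> exists2 E, H E & forall f x, E f -> x \in `[0, 1] ->
    `|phi x - Minf_val (S f) x| <= e.
  move=> e0; have [E HE hE] := cau e e0; exists E => // f x Ef x01.
  have cv : `|Minf_val (S g) x - Minf_val (S f) x| @[g --> H] -->
            `|phi x - Minf_val (S f) x|.
    by apply: cvg_norm; apply: cvgB; [exact: hphi|exact: cvg_cst].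
  by apply: (cvgr_to_le cv); apply: filterS HE => g Eg; exact: hE.
have [|p hp] := @Minf_limit R L phi L0.
  move=> e e0; have e2 : 0 < e / 2 by rewrite divr_gt0.
  have [E HE hE] := unif _ e2; have [f Ef] := filter_ex HE.
  have [s [sL hs]] := Minf_approx (S f) e2; exists s; split => // x x01.
  have -> : phi x - muntz_eval s x =
    (phi x - Minf_val (S f) x) + (Minf_val (S f) x - muntz_eval s x) by ring.
  by rewrite (le_trans (ler_normD _ _))// [e]splitr lerD// ?hE ?hs.
exists p; apply/cvgrPdist_le => e e0.
have [E HE hE] := unif _ e0; apply: filterS HE => f Ef.
rewrite Minf_norm; apply: C01_norm_le => x x01.
rewrite [X in `|X|](_ : _ = Minf_val p x - Minf_val (S f) x)//.
by rewrite hp// hE.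
Qed.

End UltrafilterCompactness.

Section CesaroPerturbation.
Context {R : realType} (lambda : nat -> R).
Hypothesis lambda_ge0 : forall n, 0 <= lambda n.
Hypothesis lambda_incr : forall m n, (m < n)%N -> lambda m < lambda n.
Hypothesis muntz_condition :
  (\sum_(0 <= n <oo | lambda n != 0%R) ((lambda n)^-1)%:E < +oo)%E.
Notation Lambda := (range lambda).
Implicit Types (f g : M1 Lambda).

Let Lambda_ge0 := range_ge0 lambda_ge0.
Let V f := volterra_fun (M1_val f).
Let C f := cesaro_fun (M1_val f).

(** The primitives of the unit ball are equi-Lipschitz on [0, c], so that their
    convergence on a finite grid is uniform up to a small error. *)
Lemma volterra_ultra_cauchy (c W : R) (H : set_system (M1 Lambda)) :
  0 < c -> c < 1 -> 0 < W -> UltraFilter H -> H (@unit_ball R (M1 Lambda)) ->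
  exists2 E, H E & forall f g, E f -> E g ->
    (forall y, 0 <= y <= c -> `|V (f - g) y| <= W) /\ `|V (f - g) 1| <= W.
Proof.
move=> c0 c1 W0 HU HB.
have [N N0 hN] := volterra_lipschitz lambda_ge0 lambda_incr muntz_condition c0 c1 (lexx 1).
pose h := W / 4 / (N + 1).
have N1 : 0 < N + 1 by rewrite ltr_wpDl.
have h0 : 0 < h by rewrite /h !divr_gt0.
have Nh : N * h <= W / 4.
  have <- : h * (N + 1) = W / 4 by rewrite /h divfK// gt_eqF.
  by rewrite [h * _]mulrC ler_wpM2r ?(ltW h0)// lerDl.
pose m := (Num.truncn (c / h)).+1.
(* the last grid points would leave [0, c] *)
pose x (i : 'I_m.+1) : R := Num.min (i%:R * h) c.
have x01 i : x i \in `[0, 1].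
  rewrite in_itv/= /x le_min mulr_ge0 ?(ltW h0) ?(ltW c0)//=.
  by rewrite ge_min (ltW c1) orbT.
have i1 : (1 : R) \in `[0, 1] by rewrite in_itv/= ler01 lexx.
have lim y : y \in `[0, 1] -> exists l : R, V f y @[f --> H] --> l.
  move=> y01; apply: (@ultra_bounded_cvg _ _ _ _ 1) => //.
  by apply: filterS HB => f f1; apply: le_trans (M1_volterra_le f y01) f1.
have /choice[v hv] : forall i, exists l : R, V f (x i) @[f --> H] --> l.
  by move=> i; exact: lim.
have [v1 hv1] := lim 1 i1.
have W4 : 0 < W / 4 by rewrite divr_gt0.
have near1 : \forall f \near H, `|v1 - V f 1| <= W / 4.
  by move/cvgrPdist_le : hv1; exact.
have neari : \forall f \near H, forall i, `|v i - V f (x i)| <= W / 4.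
  by apply: filter_forall => i; move/cvgrPdist_le : (hv i); exact.
exists (@unit_ball R (M1 Lambda) `&` ([set f | `|v1 - V f 1| <= W / 4] `&`
  [set f | forall i, `|v i - V f (x i)| <= W / 4])).
  by apply: filterI => //; exact: filterI.
move=> f g [f1 [fv1 fv]] [g1 [gv1 gv]]; split; last first.
  rewrite /V (_ : M1_val (f - g) = M1_val f - M1_val g)// volterraB//.
  rewrite -/(V f 1) -/(V g 1).
  have -> : V f 1 - V g 1 = (v1 - V g 1) - (v1 - V f 1) by ring.
  apply: le_trans (ler_normB _ _) _; move: fv1 gv1 => /=; lra.
move=> y /andP[y0 yc].
have lip k : unit_ball k -> forall z t, 0 <= z -> z <= t -> t <= c ->
    `|V k t - V k z| <= N * (t - z).
  move=> k1 z t z0 zt tc; rewrite -[N]mulr1; apply: hN => // u u01.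
  apply: le_trans (M1_volterra_le k _) k1; first by rewrite in_itv.
have [i [iy yi]] : exists i, x i <= y /\ y - x i <= h.
  have yh0 : 0 <= y / h by rewrite divr_ge0// ltW.
  have im : (Num.truncn (y / h) < m.+1)%N.
    rewrite ltnS /m leqW//; apply: le_truncn.
    by rewrite ler_wpM2r// invr_ge0 ltW.
  have ny : (Num.truncn (y / h))%:R * h <= y.
    by rewrite -ler_pdivlMr// truncn_le.
  exists (Ordinal im); rewrite /x /= min_l; last exact: le_trans yc.
  split => //; rewrite lerBlDr -{1}[h]mul1r -mulrDl nat1r.
  by rewrite -ler_pdivrMr// ltW// truncnS_gt.
have y1 := le_trans yc (ltW c1).
rewrite /V (_ : M1_val (f - g) = M1_val f - M1_val g)// volterraB// -/(V f y) -/(V g y).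
move: (x01 i); rewrite in_itv/= => /andP[xi0 xi1].
have bnd k : unit_ball k -> `|V k y - V k (x i)| <= W / 4.
  move=> k1; apply: le_trans (lip k k1 _ _ xi0 iy yc) _.
  by apply: le_trans Nh; rewrite ler_wpM2l.
have -> : V f y - V g y = (V f y - V f (x i)) - (v i - V f (x i))
   + ((v i - V g (x i)) - (V g y - V g (x i))) by ring.
have := bnd f f1; have := bnd g g1; have := fv i; have := gv i => /= a b c' d.
apply: le_trans (ler_normD _ _) _.
have := ler_normB (V f y - V f (x i)) (v i - V f (x i)).
have := ler_normB (v i - V g (x i)) (V g y - V g (x i)).
lra.
Qed.

Lemma cesaro_pert_compact (r : R) (G : {linear M1 Lambda -> Minf Lambda}) :
  0 < r -> r < 1 ->
  (forall f x, x \in `[0, 1] -> Minf_val (G f) x = cesaro_pert r f x) ->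
  compact_op G.
Proof.
move=> r0 r1 GE; apply: compact_closure_image => H HU HB.
apply: Minf_ultra_cvg => // e e0.
pose c := (r + 1) / 2.
have [c0 rc c1] : [/\ 0 < c, r < c & c < 1] by rewrite /c; split; lra.
have [N N0 hN] := cesaro_bound lambda_ge0 lambda_incr muntz_condition r0 rc (ltW c1).
have N1 : 0 < N + 1 by rewrite ltr_wpDl.
have W0 : 0 < e / (N + 1) by rewrite divr_gt0.
have [E HE hE] := volterra_ultra_cauchy c0 c1 W0 HU HB.
exists E => // f g x Ef Eg x01; have [Vc V1] := hE f g Ef Eg.
rewrite -Minf_valB -linearB GE// /cesaro_pert.
move: (x01); rewrite in_itv/= => /andP[x0 x1].
have Cx : `|C (f - g) (r * x)| <= N * (e / (N + 1)).
  by apply: hN => //; rewrite mulr_ge0 ?(ltW r0)//= ler_piMr// ltW.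
have xl : x `^ lambda 0 <= 1.
  have <- : 1 `^ lambda 0 = 1 :> R by rewrite powR1.
  exact: powR_mono.
apply: le_trans (ler_normD _ _) _.
rewrite !normrM (gtr0_norm r0) [`|2^-1|]ger0_norm// (ger0_norm (powR_ge0 _ _)).
have <- : N * (e / (N + 1)) + e / (N + 1) = e by field; rewrite gt_eqF.
apply: lerD.
  by rewrite -[leRHS]mul1r ler_pM ?(ltW r0) ?(ltW r1).
rewrite -[leRHS]mul1r ler_pM ?mulr_ge0 ?powR_ge0//.
rewrite -[leRHS]mulr1 ler_pM ?powR_ge0//; lra.
Qed.

(** On [0, c] the Cesàro mean and its dilated version nearly cancel, since [V f] is
    Lipschitz there, and the rank 1 term is at most 1/2.  On [c, 1] the difference,
    multiplied by [x], is nearly [V f x - V f (r x) - V f 1 / 2], that is, half of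
    the integral over [r x, x] minus half of the integral over the rest of [0, 1]. *)
Lemma cesaro_pert_close (e : R) : 0 < e -> exists r, [/\ 0 < r, r < 1 &
  forall f x, `|f| <= 1 -> x \in `[0, 1] ->
    `|C f x - cesaro_pert r f x| <= 2^-1 + e].
Proof.
move=> e0; pose l := lambda 0.
(* h c bounds the difference at the points of [c, 1] *)
pose h (c : R) := c^-1 * (1 - 2^-1 * c `^ (l + 1)).
have h1 : h 1 = 2^-1 by rewrite /h powR1 invr1; lra.
have hc : {for 1, continuous h}.
  apply: continuousM; first by apply: continuousV => //; exact: cvg_id.
  apply: continuousB; first exact: cvg_cst.
  apply: continuousM; first exact: cvg_cst.
  apply: differentiable_continuous; apply/derivable1_diffP.
  by apply: derivable_powR; rewrite in_itv/= andbT.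
have l0 : 0 <= l := lambda_ge0 0.
have [c [c0 c1 hce]] : exists c, [/\ 0 < c, c < 1 & h c <= 2^-1 + e].
  have /cvgrPdist_le/(_ _ e0) := cvg_at_left_filter hc.
  rewrite h1 => near_h.
  have [c [[hce c1] c0]] : exists c, (`|2^-1 - h c| <= e /\ c < 1) /\ 0 < c.
    near (1 : R)^'- => c; exists c; split; [split|]; near: c => //.
      exact: nbhs_left_lt.
    exact: nbhs_left_gt.
  exists c; split => //; have := ler_norm (h c - 2^-1); rewrite distrC; lra.
have [N N0 hN] := volterra_lipschitz lambda_ge0 lambda_incr muntz_condition c0 c1 (lexx 1).
have [N' N'0 hN'] := cesaro_bound lambda_ge0 lambda_incr muntz_condition c0 c1 (lexx 1).
pose K := N + N' + 1.
have K0 : 0 < K by rewrite ltr_wpDl// addr_ge0.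
pose d := Num.min 2^-1 (e / K).
have d0 : 0 < d by rewrite lt_min invr_gt0 ltr0n/= divr_gt0.
have d1 : d <= 2^-1 by rewrite /d ge_min lexx.
have dK : d * K <= e by rewrite -ler_pdivlMr// /d ge_min lexx orbT.
exists (1 - d); split; [lra|lra|] => f x f1 x01.
set r := 1 - d.
have r0 : 0 < r by rewrite /r; lra.
have r1 : r < 1 by rewrite /r; lra.
have i1 : (1 : R) \in `[0, 1] by rewrite in_itv/= ler01 lexx.
move: (x01); rewrite in_itv/= => /andP[x0 x1].
have VW y : 0 <= y <= 1 -> `|V f y| <= 1.
  by move=> y01; apply: le_trans (M1_volterra_le f _) f1; rewrite in_itv.
have xl : x `^ l <= 1.
  have <- : 1 `^ l = 1 :> R by rewrite powR1.
  by apply: powR_mono => //; exact: lambda_ge0.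
have [xc|cx] := leP x c.
  have main : `|C f x - r * C f (r * x)| <= (N + N') * d.
    move: x0; rewrite le_eqVlt => /predU1P[<-|x0].
      rewrite mulr0 -{1}[C f 0]mul1r -mulrBl normrM.
      have -> : 1 - r = d by rewrite /r; ring.
      rewrite (gtr0_norm d0) mulrC ler_wpM2r ?(ltW d0)//.
      have := hN' f 1 VW 0; rewrite lexx (ltW c0) mulr1 => /(_ isT).
      by move=> /le_trans; apply; rewrite lerDr.
    rewrite /C !cesaro_gt0 ?mulr_gt0// -/(V f x) -/(V f (r * x)).
    have -> : x^-1 * V f x - r * ((r * x)^-1 * V f (r * x)) =
        x^-1 * (V f x - V f (r * x)) by field; rewrite !gt_eqF.
    rewrite normrM normfV (gtr0_norm x0) ler_pdivrMl//.
    have rx : r * x <= x by rewrite ler_piMl ?(ltW x0)// ltW.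
    apply: le_trans (hN f 1 VW _ _ _ rx xc) _; first by rewrite mulr_ge0 ?ltW.
    have -> : x - r * x = x * d by rewrite /r; ring.
    rewrite mulr1 mulrC -mulrA ler_wpM2l ?(ltW x0)// mulrC.
    by rewrite ler_wpM2r ?(ltW d0)// lerDl.
  rewrite /cesaro_pert opprD addrA; apply: le_trans (ler_normB _ _) _.
  rewrite [leRHS]addrC; apply: lerD.
    by apply: le_trans main _; apply: le_trans dK; rewrite mulrC ler_wpM2l ?(ltW d0)// lerDl.
  rewrite !normrM [`|2^-1|]ger0_norm// (ger0_norm (powR_ge0 _ _)) -mulrA.
  rewrite -[leRHS]mulr1 ler_wpM2l// -[leRHS]mul1r ler_pM ?powR_ge0//.
  by apply: VW; rewrite ler01 lexx.
have {}x0 : 0 < x by exact: lt_trans cx.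
rewrite /cesaro_pert /C !cesaro_gt0 ?mulr_gt0// -/(V f x) -/(V f (r * x)) -/(V f 1).
have xl1 : x `^ (l + 1) = x `^ l * x.
  by rewrite powRD ?powRr1 ?(ltW x0)// (gt_eqF x0) implybT.
have -> : x^-1 * V f x - (r * ((r * x)^-1 * V f (r * x)) + 2^-1 * x `^ lambda 0 * V f 1)
  = x^-1 * ((V f x - V f (r * x) - 2^-1 * V f 1)
     + 2^-1 * (1 - x `^ (l + 1)) * V f 1).
  by rewrite xl1 -/l; field; rewrite !gt_eqF.
have rx0 : 0 <= r * x by rewrite mulr_ge0 ?ltW.
have rx : r * x <= x by rewrite ler_piMl ?(ltW x0)// ltW.
have half : `|V f x - V f (r * x) - 2^-1 * V f 1| <= 2^-1.
  have := volterra_increments (M1_val f) rx0 rx x1.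
  rewrite -/(V f x) -/(V f (r * x)) -/(V f 1) => inc.
  have {}inc := le_trans inc f1.
  have -> : V f x - V f (r * x) - 2^-1 * V f 1 =
    2^-1 * ((V f x - V f (r * x)) - (V f (r * x) + (V f 1 - V f x))) by field.
  rewrite normrM [`|2^-1|]ger0_norm// -[leRHS]mulr1 ler_wpM2l//.
  have := ler_normB (V f x - V f (r * x)) (V f (r * x) + (V f 1 - V f x)).
  have := ler_normD (V f (r * x)) (V f 1 - V f x).
  lra.
have l10 : 0 <= l + 1 by rewrite addr_ge0.
have cx1 : c `^ (l + 1) <= x `^ (l + 1) := powR_mono l10 (ltW c0) (ltW cx).
have xle1 : x `^ (l + 1) <= 1.
  by have := powR_mono l10 (ltW x0) x1; rewrite powR1.
apply: le_trans hce; rewrite /h normrM normfV (gtr0_norm x0).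
apply: ler_pM; rewrite ?invr_ge0 ?(ltW x0)//.
  by rewrite lef_pV2 ?posrE// ltW.
apply: le_trans (ler_normD _ _) _.
have V1 : `|2^-1 * (1 - x `^ (l + 1)) * V f 1| <= 2^-1 * (1 - x `^ (l + 1)).
  rewrite normrM ger0_norm ?mulr_ge0 ?subr_ge0//.
  by rewrite ler_piMr ?mulr_ge0 ?subr_ge0// VW// ler01 lexx.
lra.
Unshelve. all: by end_near. Qed.

End CesaroPerturbation.

(** * Weak compactness and essential norms *)

Section WeakTopology.
Context {R : realType} (Y : normedModType R).

Lemma topdual_weak_continuous (phi : topdual Y) :
  continuous (fun y : weak_top Y => (phi y : R)).
Proof.
pose ev (z : Y) : {ptws (topdual Y) -> R} := fun psi => psi z.
move=> y; have evc := @initial_continuous Y {ptws (topdual Y) -> R} ev y.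
move=> B By; have pc := @proj_continuous (topdual Y) (fun=> R) phi (ev y).
exact: (evc _ (pc B By)).
Qed.

Lemma id_weak_continuous : continuous (id : Y -> weak_top Y).
Proof.
apply: continuous_comp_initial => y; apply/cvg_sup => phi; apply/cvg_image.
  by apply/seteqP; split => // r _; exists (fun=> r).
move=> B By; have {}By : nbhs y ((phi : Y -> R) @^-1` B).
  exact: (topdual_continuous (t := phi) By).
exists ((fun h : {ptws (topdual Y) -> R} => h phi) @^-1` B); first exact: By.
apply/seteqP; split=> [_ [h hB <-]//|r Br].
by exists (fun=> r).
Qed.

Lemma weak_hausdorff :
  (forall y z : Y, (forall phi : topdual Y, phi y = phi z) -> y = z) ->
  hausdorff_space (weak_top Y).
Proof.
move=> sep y z yz; apply: sep => phi; apply: (@Rhausdorff R) => A B Ay Bz.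
have [t [At Bt]] := yz _ _ (topdual_weak_continuous Ay) (topdual_weak_continuous Bz).
by exists (phi t).
Qed.

End WeakTopology.

Section EssentialNorms.
Context {R : realType}.
Implicit Types X Y Z : normedModType R.

(** A norm compact closure is weakly compact, and weakly closed since the weak
    topology is Hausdorff; so it contains the weak closure. *)
Lemma ess_norm_w_le X Y (T : X -> Y) :
  (forall y z : Y, (forall phi : topdual Y, phi y = phi z) -> y = z) ->
  (ess_norm_w T <= ess_norm T)%E.
Proof.
move=> sep; apply: ereal_inf_le_tmp => _ [S cS <-]; exists S => //.
rewrite /weakly_compact_op; set B := S @` _.
have cK : compact (closure B : set (weak_top Y)).
  have := continuous_compact (continuous_subspaceT (@id_weak_continuous R Y)) cS.
  by rewrite image_id.
have clK := compact_closed (weak_hausdorff sep) cK.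
apply: subclosed_compact cK _; first exact: closed_closure.
rewrite [X in _ `<=` X](closure_id (closure B : set (weak_top Y))).1//.
by apply: closure_subset; exact: (@subset_closure Y B).
Qed.

Lemma ess_norm_comp_le X Y Z (A : {linear Y -> Z}) (T : {linear X -> Y}) :
  (forall y, `|A y| <= `|y|) -> (ess_norm (A \o T) <= ess_norm T)%E.
Proof.
move=> A1; apply: le_ereal_inf_tmp => _ [S cS <-].
have cA : continuous A.
  apply: bounded_linear_continuous; apply/linear_boundedP.
  apply: filterS (nbhs_pinfty_ge (num_real (1 : R))) => r r1 y.
  by apply: le_trans (A1 y) _; rewrite ler_peMl.
pose AS : {linear X -> Z} := A \o S.
have cAS : compact_op AS.
  have cK := continuous_compact (continuous_subspaceT cA) cS.
  have clK := compact_closed (@norm_hausdorff _ Z) cK.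
  apply: subclosed_compact cK _; first exact: closed_closure.
  rewrite [X in _ `<=` X](closure_id _).1//; apply: closure_subset.
  move=> _ [x x1 <-]; exists (S x) => //; apply: subset_closure.
  by exists x.
apply: (@le_trans _ _ (op_norm ((A \o T) \- AS))).
  by apply: ereal_inf_lbound; exists AS.
apply: ge_ereal_sup => _ [x x1 <-].
apply: (@le_trans _ _ (`|(T \- S) x|%:E)); last by apply: ereal_sup_ubound; exists x.
by rewrite lee_fin /= -linearB; exact: A1.
Qed.

(** For the codomains considered here, elements are functions on [0, 1] and point
    evaluations are enough to study the weak topology. *)
Section PointEvaluations.
Context {X Y : normedModType R} (val : Y -> C01 R).
Hypothesis val_lin : forall a y z x,
  val (a *: y + z) x = a * val y x + val z x.
Hypothesis val_le : forall y, `|val y| <= `|y|.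
Hypothesis val_inj : injective val.

Lemma point_evaluation x : x \in `[0, 1] ->
  exists phi : topdual Y, forall y, phi y = val y x.
Proof.
move=> x01.
have lf : linear (fun y => val y x : R^o) by move=> a y z; exact: val_lin.
have cf : continuous (linear_of lf).
  apply: bounded_linear_continuous; apply/linear_boundedP.
  apply: filterS (nbhs_pinfty_ge (num_real (1 : R))) => r r1 y.
  apply: (@le_trans _ _ (1 * `|y|)); last by rewrite ler_wpM2r.
  by rewrite mul1r; apply: le_trans (val_le y); exact: C01_norm_ub.
by exists (TopDual cf).
Qed.

Lemma topdual_separates (y z : Y) : (forall phi : topdual Y, phi y = phi z) -> y = z.
Proof.
move=> yz; apply: val_inj; apply: C01_eq => x x01.
by have [phi hphi] := point_evaluation x01; rewrite -!hphi.
Qed.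

Let val_sub y z x : val (y - z) x = val y x - val z x.
Proof.
have -> : y - z = (-1) *: z + y by rewrite scaleN1r addrC.
by rewrite val_lin mulN1r addrC.
Qed.

(** If [T - S] had norm [a < 1/2], a weak cluster point of [S (f n)] would be a
    continuous function bounded by [a] on (0, 1) and at least [1 - a] at 1. *)
Lemma ess_norm_w_ge_half (T : X -> Y) (f : nat -> X) :
  (forall n, `|f n| <= 1) ->
  (forall x : R, 0 < x -> x < 1 -> val (T (f n)) x @[n --> \oo] --> (0 : R)) ->
  (forall n, val (T (f n)) 1 = 1) ->
  ((2^-1)%:E <= ess_norm_w T)%E.
Proof.
move=> f1 Tf0 Tf1; apply: le_ereal_inf_tmp => _ [S cS <-].
rewrite leNgt; apply/negP => lt2.
have i1 : (1 : R) \in `[0, 1] by rewrite in_itv/= ler01 lexx.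
have opf n : ((`|T (f n) - S (f n)|%R)%:E <= op_norm (T \- S)%R)%E.
  by apply: ereal_sup_ubound; exists (f n) => //; exact: f1.
have [a a2 ha] : exists2 a : R, a < 2^-1 & forall n, `|T (f n) - S (f n)| <= a.
  move: lt2 opf; case: (op_norm _) => [a|//|].
    by rewrite lte_fin => a2 opf; exists a => // n; rewrite -lee_fin.
  by move=> _ /(_ 0%N); rewrite leeNy_eq.
have dist n x : x \in `[0, 1] -> `|val (T (f n)) x - val (S (f n)) x| <= a.
  move=> x01; rewrite -val_sub; apply: le_trans (ha n); apply: le_trans (val_le _).
  exact: C01_norm_ub.
pose F : set_system (weak_top Y) := (fun n => S (f n) : weak_top Y) @ \oo.
have FK : F (closure (S @` @unit_ball R X : set (weak_top Y))).
  by exists 0%N => // n _; apply: subset_closure; exists (f n) => //; exact: f1.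
have [g [_ clg]] := cS F _ FK.
have near_g x e N : x \in `[0, 1] -> 0 < e ->
    exists2 n, (N <= n)%N & `|val g x - val (S (f n)) x| < e.
  move=> x01 e0; have [phi hphi] := point_evaluation x01.
  pose A : set (weak_top Y) := [set y | exists2 n, (N <= n)%N & y = S (f n)].
  have FA : F A by exists N => // n /= Nn; exists n.
  have Bg : nbhs (g : weak_top Y) [set y | `|val g x - val y x| < e].
    have /cvgrPdist_lt/(_ _ e0) := @topdual_weak_continuous R Y phi g.
    by apply: filterS => y; rewrite /= !hphi.
  by have [_ [[n Nn ->] ?]] := clg _ _ FA Bg; exists n.
have g_small x : 0 < x -> x < 1 -> `|val g x| <= a.
  move=> x0 x1; have x01 : x \in `[0, 1] by rewrite in_itv/= !ltW.
  apply/ler_addgt0Pr => e e0; have e2 : 0 < e / 2 by rewrite divr_gt0.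
  have /cvgrPdist_lt/(_ _ e2)[N _ hN] := Tf0 x x0 x1.
  have [n Nn gn] := near_g x _ N x01 e2.
  have := hN n Nn; rewrite /= sub0r normrN => Tn; have := dist n x x01 => d.
  have -> : val g x = (val g x - val (S (f n)) x)
     - (val (T (f n)) x - val (S (f n)) x) + val (T (f n)) x by ring.
  apply: le_trans (ler_normD _ _) _.
  have := ler_normB (val g x - val (S (f n)) x) (val (T (f n)) x - val (S (f n)) x).
  lra.
have g_large : 1 - a <= val g 1.
  apply/ler_addgt0Pr => e e0.
  have [n _ gn] := near_g 1 e 0%N i1 e0; have := dist n 1 i1; rewrite Tf1.
  rewrite distrC in gn.
  have := ler_norm (val (S (f n)) 1 - val g 1).
  have := ler_norm (1 - val (S (f n)) 1).
  lra.
have g_cvg : `|val g x| @[x --> 1^'-] --> `|val g 1|.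
  apply: cvg_norm.
  have : {within `[0, 1], continuous (val g)} by have := C01P (val g); rewrite inE => -[].
  by move=> /(continuous_within_itvP _ ltr01)[].
have : `|val g 1| <= a.
  apply: (cvgr_to_le g_cvg); near=> x; apply: g_small; near: x.
    exact: nbhs_left_gt.
  exact: nbhs_left_lt.
have := ler_norm (val g 1); lra.
Unshelve. all: by end_near. Qed.

End PointEvaluations.

End EssentialNorms.

(** * The essential norms *)

Section EssentialNormsOfCesaro.
Context {R : realType} (lambda : nat -> R).
Hypothesis lambda_ge0 : forall n, 0 <= lambda n.
Hypothesis lambda_incr : forall m n, (m < n)%N -> lambda m < lambda n.
Hypothesis muntz_condition :
  (\sum_(0 <= n <oo | lambda n != 0%R) ((lambda n)^-1)%:E < +oo)%E.
Notation Lambda := (range lambda).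
Implicit Types (f g : M1 Lambda).

Let Lambda_ge0 := range_ge0 lambda_ge0.
Let V f := volterra_fun (M1_val f).
Let C f := cesaro_fun (M1_val f).

Lemma cesaro_ess_norm_le (G : {linear M1 Lambda -> Minf Lambda}) :
  (forall f x, x \in `[0, 1] -> Minf_val (G f) x = C f x) ->
  (ess_norm G <= (2^-1)%:E)%E.
Proof.
move=> GE; apply/lee_addgt0Pr => e e0.
have [r [r0 r1 hr]] := cesaro_pert_close lambda_ge0 lambda_incr muntz_condition e0.
have [S [_ SE]] := cesaro_pert_operator lambda_ge0 lambda_incr muntz_condition r0 r1.
apply: (@le_trans _ _ (op_norm (G \- S))).
  apply: ereal_inf_lbound; exists S => //.
  exact: (cesaro_pert_compact lambda_ge0 lambda_incr muntz_condition r0 r1 SE).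
apply: ge_ereal_sup => _ [f f1 <-]; rewrite -EFinD lee_fin.
rewrite Minf_norm; apply: C01_norm_le => x x01.
rewrite [X in `|X|](_ : _ = Minf_val (G f) x - Minf_val (S f) x)//.
by rewrite GE// SE//; exact: hr.
Qed.

Lemma normalized_monomials : exists f : nat -> M1 Lambda, forall n,
  [/\ `|f n| <= 1, forall x, x \in `[0, 1] -> C (f n) x = x `^ lambda n &
      forall x, x \in `[0, 1] -> V (f n) x = x `^ (lambda n + 1)].
Proof.
suff /choice[f hf] : forall n, exists f : M1 Lambda, [/\ `|f| <= 1,
    forall x, x \in `[0, 1] -> C f x = x `^ lambda n &
    forall x, x \in `[0, 1] -> V f x = x `^ (lambda n + 1)] by exists f.
move=> n; pose s := [:: (lambda n + 1, lambda n)].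
have l1 : lambda n + 1 != 0 by rewrite gt_eqF// ltr_wpDl.
have sL : supported Lambda s by move=> a /[!inE] /eqP ->; exists n.
have s0 := supported_sub Lambda_ge0 sL.
have [f fs] := M1_muntz_eval lambda_ge0 sL; exists f.
have sE x : muntz_eval s x = (lambda n + 1) * x `^ lambda n by rewrite /muntz_eval big_seq1.
have pE x : muntz_prim s x = x `^ (lambda n + 1).
  by rewrite /muntz_prim big_seq1/= mulfV// mul1r.
split=> [|x x01|x x01].
- rewrite M1_norm L1_normRE.
  have -> : \int[@lebesgue_measure R]_(x in `[0, 1]) `|L1_repr (M1_val f) x| =
      primitive (muntz_eval s) 1.
    apply: ae_eq_Rintegral => //.
    + by apply: measurableT_comp => //; apply: measurable_funTS; exact: L1_repr_measurable.
    + by apply: measurable_funTS; exact: measurable_muntz_eval.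
    + apply: filterS fs => x /(_ I) fx _; rewrite /= fx ger0_norm// sE.
      by rewrite mulr_ge0 ?powR_ge0// addr_ge0.
  by rewrite primitive_muntz_eval// pE powR1.
- rewrite /C (cesaro_muntz_eval lambda_ge0 lambda_incr muntz_condition sL fs x01).
  by rewrite muntz_eval_multiplier big_seq1/= mulfV// mul1r.
- by move: x01; rewrite in_itv/= => /andP[x0 x1]; rewrite /V (volterra_muntz_eval s0 fs).
Qed.

Lemma powR_lambda_cvg0 (x : R) : 0 < x -> x < 1 -> x `^ lambda n @[n --> \oo] --> (0 : R).
Proof.
move=> x0 x1; apply/cvgrPdist_le => e e0.
have lx : ln x < 0 by rewrite ln_lt0// x0.
have [N hN] := lambda_large lambda_ge0 lambda_incr muntz_condition (ln e / ln x).
exists N => // n /= Nn; rewrite sub0r normrN ger0_norm ?powR_ge0//.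
rewrite -[leRHS]lnK ?posrE// /powR gt_eqF// ler_expR.
by rewrite -ler_ndivrMr//; exact: hN.
Qed.

(** Essential norms do not increase under the contraction [A], which yields the
    upper bound for all codomains at once; the lower bound is obtained in each
    codomain, on the normalized monomials. *)
Lemma cesaro_ess_norms (G : {linear M1 Lambda -> Minf Lambda})
  (Y : normedModType R) (val : Y -> C01 R) (A : {linear Minf Lambda -> Y}) :
  (forall f x, x \in `[0, 1] -> Minf_val (G f) x = C f x) ->
  (forall a y z x, val (a *: y + z) x = a * val y x + val z x) ->
  (forall y, `|val y| <= `|y|) -> injective val ->
  (forall F, `|A F| <= `|F|) ->
  (exists2 k, 0 <= k & forall F x, x \in `[0, 1] ->
     val (A F) x = x `^ k * Minf_val F x) ->
  ess_norm (A \o G) = (2^-1)%:E /\ ess_norm_w (A \o G) = (2^-1)%:E.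
Proof.
move=> GE val_lin val_le val_inj A1 [k k0 AE].
have sep := topdual_separates val_lin val_le val_inj.
have [f hf] := normalized_monomials.
have AGE n x : x \in `[0, 1] -> val ((A \o G) (f n)) x = x `^ k * x `^ lambda n.
  by move=> x01; have [_ fE _] := hf n; rewrite /= AE// GE// fE.
have low : ((2^-1)%:E <= ess_norm_w (A \o G))%E.
  apply: (ess_norm_w_ge_half val_lin val_le (f := f)).
  - by move=> n; have [] := hf n.
  - move=> x x0 x1.
    have x01 : x \in `[0, 1] by rewrite in_itv/= !ltW.
    under eq_fun do rewrite AGE//.
    have cv : x `^ k * x `^ lambda n @[n --> \oo] --> x `^ k * 0.
      by apply: cvgM; [exact: cvg_cst|exact: powR_lambda_cvg0].
    by rewrite mulr0 in cv.
  - by move=> n; rewrite AGE ?powR1 ?mulr1// in_itv/= ler01 lexx.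
have upp : (ess_norm (A \o G) <= (2^-1)%:E)%E.
  exact: le_trans (ess_norm_comp_le _ A1) (cesaro_ess_norm_le GE).
have wle := ess_norm_w_le (A \o G) sep.
split; apply/eqP; rewrite eq_le.
  by rewrite upp (le_trans low).
by rewrite low (le_trans wle).
Qed.

End EssentialNormsOfCesaro.

Theorem theorem4p3 (R : realType) (lambda : nat -> R)
  (lambda_ge0 : forall n, 0 <= lambda n)
  (lambda_incr : forall m n, (m < n)%N -> lambda m < lambda n)
  (muntz_condition :
    (\sum_(0 <= n <oo | lambda n != 0%R) ((lambda n)^-1)%:E < +oo)%E) :
  let Lambda := range lambda in
  let Lambda1 := [set 1 + l | l in Lambda] in
  [/\ exists G : {linear M1 Lambda -> Minf Lambda},
        [/\ is_operator (@Minf_val R Lambda) (@cesaro_fun R) G,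
            ess_norm G = (1 / 2)%:E & ess_norm_w G = (1 / 2)%:E],
      exists G : {linear M1 Lambda -> C01 R},
        [/\ is_operator idfun (@cesaro_fun R) G,
            ess_norm G = (1 / 2)%:E & ess_norm_w G = (1 / 2)%:E],
      exists V : {linear M1 Lambda -> Minf Lambda1},
        [/\ is_operator (@Minf_val R Lambda1) (@volterra_fun R) V,
            ess_norm V = (1 / 2)%:E & ess_norm_w V = (1 / 2)%:E] &
      exists V : {linear M1 Lambda -> C01 R},
        [/\ is_operator idfun (@volterra_fun R) V,
            ess_norm V = (1 / 2)%:E & ess_norm_w V = (1 / 2)%:E]].
Proof.
move=> Lambda Lambda1.
have L0 : Lambda `<=` [set l | 0 <= l] := range_ge0 lambda_ge0.
have L10 : Lambda1 `<=` [set l | 0 <= l].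
  by move=> _ [l /L0 /= l0 <-]; rewrite addr_ge0.
have [G [Gc GE]] := cesaro_operator lambda_ge0 lambda_incr muntz_condition.
have ess := cesaro_ess_norms lambda_ge0 lambda_incr muntz_condition GE.
have Mlin (L : set R) (a : R) (y z : Minf L) x :
  Minf_val (a *: y + z) x = a * Minf_val y x + Minf_val z x.
  by rewrite Minf_valD Minf_valZ.
have Mle (L : set R) (y : Minf L) : `|Minf_val y| <= `|y| by [].
have Minj (L : set R) : injective (@Minf_val R L) by exact: val_inj.
have Clin (a : R) (y z : C01 R) x : C01_fun (idfun (a *: y + z)) x =
    a * C01_fun (idfun y) x + C01_fun (idfun z) x by [].
have Cle (y : C01 R) : `|idfun y| <= `|y| by [].
have Cinj : injective (@idfun (C01 R)) by [].
have contr_cont (X Y : normedModType R) (A : {linear X -> Y}) :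
    (forall x, `|A x| <= `|x|) -> continuous A.
  move=> A1; apply: bounded_linear_continuous; apply/linear_boundedP.
  apply: filterS (nbhs_pinfty_ge (num_real (1 : R))) => r r1 y.
  by apply: le_trans (A1 y) _; rewrite ler_peMl.
pose iota L := linear_of (@Minf_val_linear R L).
(* the Volterra operator is the Cesàro operator followed by multiplication by x *)
have [M [Mc ME]] : exists M : {linear Minf Lambda -> Minf Lambda1}, continuous M /\
    forall F x, x \in `[0, 1] -> Minf_val (M F) x = x * Minf_val F x.
  apply: (@Minf_operator _ _ _ (fun F x => x * Minf_val F x) 1) => //.
  - move=> F e e0; have [s [sL hs]] := Minf_approx F e0.
    exists [seq (a.1, 1 + a.2) | a <- s]; split.
      by move=> _ /mapP[a /sL aL ->]; exists a.2.
    move=> x x01; move: (x01); rewrite in_itv/= => /andP[x0 x1].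
    have -> : muntz_eval [seq (a.1, 1 + a.2) | a <- s] x = x * muntz_eval s x.
      rewrite /muntz_eval big_map mulr_sumr; apply: eq_big_seq => a /sL /L0 /= a0.
      by rewrite powRD ?powRr1//=; [ring|rewrite gt_eqF// ltr_pwDl].
    rewrite -mulrBr normrM ger0_norm// -[leRHS]mul1r ler_pM// hs//.
  - by move=> a F H x x01; rewrite Mlin; ring.
  - move=> F x x01; move: (x01); rewrite in_itv/= => /andP[x0 x1].
    rewrite normrM ger0_norm// ler_pM//; exact: C01_norm_ub.
have Mcontr F : `|M F| <= `|F|.
  rewrite Minf_norm; apply: C01_norm_le => x x01; rewrite ME//.
  move: (x01); rewrite in_itv/= => /andP[x0 x1].
  rewrite normrM ger0_norm// -[leRHS]mul1r ler_pM//; exact: C01_norm_ub.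
have VE f x : x \in `[0, 1] -> x * cesaro_fun (M1_val f) x = volterra_fun (M1_val f) x.
  rewrite in_itv/= => /andP[+ _]; rewrite le_eqVlt => /predU1P[<-|x0].
    by rewrite mul0r volterra0.
  by rewrite /cesaro_fun gt_eqF// mulrA mulfV ?mul1r// gt_eqF.
have pow0 (F : Minf Lambda) x : Minf_val F x = x `^ 0 * Minf_val F x.
  by rewrite powRr0 mul1r.
have pow1 (F : Minf Lambda) x : x \in `[0, 1] ->
    Minf_val (M F) x = x `^ 1 * Minf_val F x.
  by move=> x01; rewrite ME//; move: x01; rewrite in_itv/= => /andP[x0 _]; rewrite powRr1.
rewrite div1r; split.
- have [e1 e2] : ess_norm (idfun \o G) = (2^-1)%:E /\ ess_norm_w (idfun \o G) = (2^-1)%:E.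
    apply: (ess _ _ _ (@Mlin _) (@Mle _) (@Minj _)) => //.
    by exists 0 => // F x _; exact: pow0.
  by exists G; split.
- have [e1 e2] : ess_norm (iota Lambda \o G) = (2^-1)%:E /\
      ess_norm_w (iota Lambda \o G) = (2^-1)%:E.
    apply: (ess _ _ _ Clin Cle Cinj) => //.
    by exists 0 => // F x _; exact: pow0.
  exists (iota Lambda \o G); split=> //; split; last exact: GE.
  move=> f; apply: (@continuous_comp _ _ _ G (iota Lambda)); first exact: Gc.
  exact: contr_cont.
- have [e1 e2] : ess_norm (M \o G) = (2^-1)%:E /\ ess_norm_w (M \o G) = (2^-1)%:E.
    apply: (ess _ _ _ (@Mlin _) (@Mle _) (@Minj _)) => //.
    by exists 1 => // F x x01; exact: pow1.
  exists (M \o G); split=> //; split; last first.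
    by move=> f x x01; rewrite /= ME// GE// VE.
  move=> f; apply: (@continuous_comp _ _ _ G M); first exact: Gc.
  exact: Mc.
- have [e1 e2] : ess_norm ((iota Lambda1 \o M) \o G) = (2^-1)%:E /\
      ess_norm_w ((iota Lambda1 \o M) \o G) = (2^-1)%:E.
    apply: (ess _ _ _ Clin Cle Cinj) => //.
    by exists 1 => // F x x01; exact: pow1.
  exists ((iota Lambda1 \o M) \o G); split=> //; split; last first.
    by move=> f x x01; rewrite /= ME// GE// VE.
  move=> f; apply: (@continuous_comp _ _ _ G (iota Lambda1 \o M)); first exact: Gc.
  exact: contr_cont.
Qed.
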